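(* Let $(M,g)$ be a complete noncompact Riemannian manifold on which the $\chi$-type Sobolev inequality holds. Then for every geodesic ball $B_r\subset M$ of radius $r$ (centered at an arbitrary point of $M$), $$\mathrm{Vol}(B_r)\ge C\, r^{\frac{2\chi}{\chi-1}},$$ where $C=C(\chi,\mathbb{S}_\chi(M))>0$ depends only on $\chi$ and the Sobolev constant $\mathbb{S}_\chi(M)$.
   Context: The $\chi$-type Sobolev inequality holds on $(M,g)$ if $\chi>1$ and there is a constant $\mathbb{S}_\chi(M)>0$ such that for every $f\in C_0^\infty(M)$, $$\mathbb{S}_\chi(M)\left(\int_M f^{2\chi}\,dv\right)^{1/\chi}\le\int_M|\nabla f|^2\,dv .$$ $\mathbb{S}_\chi(M)$ denotes this constant. *)

(* Defs.v *)
From HB Require Import structures.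
From mathcomp Require Import all_boot all_order all_algebra.
From mathcomp Require Import all_classical all_reals all_analysis.

Set Implicit Arguments.
Unset Strict Implicit.
Unset Printing Implicit Defensive.

Import Order.TTheory GRing.Theory Num.Theory.
Import numFieldNormedType.Exports.

Local Open Scope classical_set_scope.
Local Open Scope ring_scope.

Section Smoothness.
Context {R : realType} {n : nat} {V : normedModType R}.

Definition partial (i : 'I_n) (f : 'rV[R]_n -> V) : 'rV[R]_n -> V :=
  fun x => 'D_(delta_mx 0 i) f x.

(* C^infinity on the open set U: the iterated partial derivatives of all
   orders (the order-0 one is f itself) are differentiable on U; each is then
   continuous on U, being differentiable. *)
Definition smooth_on (U : set 'rV[R]_n) (f : 'rV[R]_n -> V) : Prop :=
  forall (s : seq 'I_n) (x : 'rV[R]_n), U x -> differentiable (foldr partial f s) x.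

End Smoothness.

(* Lebesgue integral over R^n of a nonnegative Borel function, as an iterated
   one-dimensional integral (Tonelli); the library has no Lebesgue measure on
   'rV[R]_n. *)
Fixpoint lebesgue_int {R : realType} (n : nat) :
    ('rV[R]_n -> \bar R) -> \bar R :=
  match n return ('rV[R]_n -> \bar R) -> \bar R with
  | 0 => fun f => f 0
  | m.+1 => fun f =>
      (\int[lebesgue_measure]_(t in [set: R])
         lebesgue_int (fun v : 'rV[R]_m => f (row_mx (t%:M : 'rV[R]_1) v)))%E
  end.

(* A smooth n-manifold structure on the space M, given by an atlas.
   [chart_map c] and [chart_inv c] are total functions, meaningful only on [chart_dom c] and
   on its image [chart_cod c] respectively; [chart_inv c] is the inverse chart. *)
Record smooth_manifold (R : realType) (n : nat) (M : ptopologicalType) := {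
  manifold_hausdorff : hausdorff_space M ;
  manifold_second_countable : @second_countable M ;
  chart : Type ;
  chart_dom : chart -> set M ;
  chart_map : chart -> M -> 'rV[R]_n ;
  chart_inv : chart -> 'rV[R]_n -> M ;
  chart_cod := fun c : chart => chart_map c @` chart_dom c ;
  chart_dom_open : forall c, open (chart_dom c) ;
  chart_cod_open : forall c, open (chart_cod c) ;
  chart_mapK : forall c x, chart_dom c x -> chart_inv c (chart_map c x) = x ;
  chart_map_continuous : forall c x, chart_dom c x -> {for x, continuous (chart_map c)} ;
  chart_inv_continuous : forall c v, chart_cod c v -> {for v, continuous (chart_inv c)} ;
  transition_smooth : forall c c',
    smooth_on (chart_map c @` (chart_dom c `&` chart_dom c')) (chart_map c' \o chart_inv c) ;
  chart_at : M -> chart ;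
  chart_atP : forall x, chart_dom (chart_at x) x
}.

Definition quad_form {R : realType} {n : nat} (G : 'M[R]_n) (v : 'rV[R]_n) : R :=
  (v *m G *m v^T) 0 0.

(* [gram c v] is the matrix (g_ij) of the metric in the chart c at the point of
   coordinates v. The Jacobian 'J acts on row vectors from the right, so that
   [gram_transition] is the transformation law of a (0,2)-tensor. *)
Record riemannian_metric (R : realType) (n : nat) (M : ptopologicalType)
    (X : smooth_manifold R n M) := {
  gram : chart X -> 'rV[R]_n -> 'M[R]_n ;
  gram_smooth : forall c i j, smooth_on (chart_cod c) (fun v => gram c v i j) ;
  gram_sym : forall c v, chart_cod c v -> (gram c v)^T = gram c v ;
  gram_posdef : forall c v w, chart_cod c v -> w != 0 -> 0 < quad_form (gram c v) w ;
  gram_transition : forall c c' v, (chart_map c @` (chart_dom c `&` chart_dom c')) v ->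
    gram c v = 'J (chart_map c' \o chart_inv c) v
               *m gram c' (chart_map c' (chart_inv c v))
               *m ('J (chart_map c' \o chart_inv c) v)^T
}.

Section RiemannianGeometry.
Context {R : realType} {n : nat} {M : ptopologicalType}.
Variables (X : smooth_manifold R n M) (g : riemannian_metric X).

Definition smooth_compact_support (f : M -> R) : Prop :=
  (forall c : chart X, smooth_on (chart_cod c) (f \o chart_inv c)) /\
  compact (closure [set x | f x != 0]).

(* Matrix of the metric at x, and the gradient and velocity below, are all
   expressed in the chart [chart_at X x]. *)
Definition gram_at (x : M) : 'M[R]_n :=
  gram g (chart_at X x) (chart_map (chart_at X x) x).

(* grad^j = \sum_i (d_i f) g^{ij} *)
Definition gradient (f : M -> R) (x : M) : 'rV[R]_n :=
  (\row_i partial i (f \o chart_inv (chart_at X x)) (chart_map (chart_at X x) x))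
  *m invmx (gram_at x).

Definition gradient_norm2 (f : M -> R) (x : M) : R :=
  quad_form (gram_at x) (gradient f x).

Definition velocity (gam : R -> M) (t : R) : 'rV[R]_n :=
  derive1 (chart_map (chart_at X (gam t)) \o gam) t.

Definition speed (gam : R -> M) (t : R) : R :=
  Num.sqrt (quad_form (gram_at (gam t)) (velocity gam t)).

Definition C1_curve_at (gam : R -> M) (t : R) : Prop :=
  let u : R -> 'rV[R]_n := chart_map (chart_at X (gam t)) \o gam in
  [/\ {for t, continuous gam},
      \forall s \near t, derivable u s 1 &
      {for t, continuous (derive1 u)}].

(* Only the restriction of gam to [0, 1] matters: there is a subdivision
   0 < s_0 < ... < s_k = 1 such that, on each closed piece, gam agrees with a
   curve that is C^1 at every point of the piece, end points included. *)
Definition piecewise_C1 (gam : R -> M) : Prop :=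
  exists s : seq R, [/\ path <%R 0 s, last 0 s = 1 &
    forall j, (j < size s)%N -> exists sigma : R -> M,
      forall t, nth 0 (0 :: s) j <= t <= nth 0 s j ->
        C1_curve_at sigma t /\ gam t = sigma t].

(* The velocity may be meaningless at the finitely many break points, which are
   negligible. *)
Definition curve_length (gam : R -> M) : \bar R :=
  (\int[lebesgue_measure]_(t in `[0%R, 1%R]) (speed gam t)%:E)%E.

(* Equal to +oo when x and y lie in different connected components. *)
Definition riemannian_dist (x y : M) : \bar R :=
  ereal_inf [set curve_length gam |
             gam in [set gam | [/\ piecewise_C1 gam, gam 0 = x & gam 1 = y]]].

Definition geodesic_ball (p : M) (r : R) : set M :=
  [set y | (riemannian_dist p y < r%:E)%E].

Definition riemannian_complete : Prop :=
  forall u : nat -> M,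
    (forall e : R, 0 < e -> exists N, forall i j, (N <= i)%N -> (N <= j)%N ->
       (riemannian_dist (u i) (u j) < e%:E)%E) ->
    exists x, forall e : R, 0 < e -> exists N, forall i, (N <= i)%N ->
      (riemannian_dist (u i) x < e%:E)%E.

End RiemannianGeometry.

Notation borel M := (g_sigma_algebraType (@open M)).

Section RiemannianVolume.
Context {R : realType} {n : nat} {M : ptopologicalType}.
Variables (X : smooth_manifold R n M) (g : riemannian_metric X).

(* dv = sqrt (det g_ij) dx in every chart; M being second countable, this
   determines the Borel measure mu. *)
Definition riemannian_volume (mu : {measure set (borel M) -> \bar R}) : Prop :=
  forall (c : chart X) (A : set (borel M)), measurable A -> A `<=` chart_dom c ->
    mu A = lebesgue_int (fun v =>
             (\1_(chart_map c @` A) v * Num.sqrt (\det (gram g c v)))%:E).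

(* For a real exponent, f^{2 chi} is read as |f|^{2 chi}. *)
Definition sobolev_inequality (mu : {measure set (borel M) -> \bar R})
    (chi S_chi : R) : Prop :=
  [/\ 1 < chi, 0 < S_chi &
  forall f : M -> R, smooth_compact_support X f ->
    (S_chi%:E * (\int[mu]_x (`|f x| `^ (2 * chi))%:E) `^ chi^-1
       <= \int[mu]_x (gradient_norm2 g f x)%:E)%E].

End RiemannianVolume.

(* Main.v *)
Require Import Defs.
From HB Require Import structures.
From mathcomp Require Import all_boot all_order all_algebra perm.
From mathcomp Require Import all_classical all_reals all_analysis.
From mathcomp Require Import measurable_realfun ring lra.

Import Order.TTheory GRing.Theory Num.Theory.
Import numFieldNormedType.Exports.

Local Open Scope classical_set_scope.
Local Open Scope ring_scope.

(** Write V(r) for the volume of a ball of radius r about p. Testing the Sobolev inequality on a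
smooth function that is at least r/8 on the ball of radius r/4, vanishes off the ball of radius r
and has gradient at most 5 gives
<<  S * ((r/8)^(2 chi) * V(r/4))^(1/chi) <= 25 * V(r),  >>
a lower bound for V(r) in terms of V(r/4). In logarithms, if m_k is ln (V(r/4^k)) minus the
logarithm of the expected bound C (r/4^k)^(2 chi/(chi-1)), the right C (the fixed point of the
recursion, a function of chi and S only) turns this inequality into m_(k+1) / chi <= m_k. Since a
Riemannian volume is locally comparable to Lebesgue measure, V(rho) >= c rho^n for small rho, so
m_k is at least some affine function of k; this is negligible against chi^k, hence m_0 >= 0, which
is the theorem ([iterated_lower_bound], [chain_ball_volume_growth]). Neither c nor n survives in
C.

The work lies in the test function: distance to p, cut off, smoothed, and compactly supported,
with a bound on its gradient that does not depend on the dimension.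

Distances are handled through chains of coordinate segments ([seg], [reach]) instead of curves:
for them symmetry, the triangle inequality and the existence of intermediate points are immediate.
A chain ball is contained in the geodesic ball of the same radius, because a curve can be
prolonged by a coordinate segment at the expected cost ([dist_extend]); the same lemma shows that
geodesic balls are open. In the other direction only topology is needed: a smooth function with
gradient at most 1 is 1-Lipschitz for the Riemannian distance ([dist_ge_smooth]), and applied to a
bump function this shows that convergence in distance implies convergence in the manifold
([dist_nbhs]). With completeness, the classical argument of Hopf and Rinow then makes chain balls
relatively compact ([hopf_rinow]), so that the distance function, cut off at radius r/2, has
compact support.

A Lipschitz function u on a small coordinate ball, on which the metric differs from a constant one
by a factor at most 2, is the infimum of the cones u(y) + k|x - y|. Rounding the cones at their
vertices, keeping finitely many of them and replacing the minimum by -(1/beta) ln (sum exp (-beta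
h)) gives a smooth function close to u; it has the same Lipschitz constant, because this soft
minimum is monotone and commutes with adding constants ([euclidean_smoothing]). Such local
approximations are glued along a finite cover by bump functions ([glue_smoothing]): each gluing
step adds to the gradient only the derivative of a bump times the distance between two
approximations of u, and that distance is at our disposal. *)

(** * Smooth functions on open sets of R^n *)

Section SmoothCalculus.
Set Implicit Arguments.
Unset Strict Implicit.
Context {R : realType}.

(** Differentiability is local: the difference of the two functions vanishes near x, so its
differential is 0. *)
Lemma near_eq_differentiable (V W : normedModType R) (f g : V -> W) (x : V) :
  {near x, f =1 g} -> differentiable f x -> differentiable g x.
Proof.
move=> fg df; have -> : g = f + (g - f) by rewrite addrC subrK.
apply: differentiableD => //.
have h0 : (g - f) \o shift x = cst ((g - f) x) + (cst 0 : V -> W) +o_ 0 id.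
  apply/eqaddoP => _/posnumP[e].
  have xf := nbhs_singleton fg.
  have : \forall y \near 0, f (y + x) = g (y + x).
    have : y + x @[y --> (0 : V)] --> 0 + x by apply: cvgD; [exact: cvg_id|exact: cvg_cst].
    by rewrite add0r => /(_ _ fg).
  apply: filterS => y E /=; rewrite !fctE /=.
  by rewrite E xf !subrr addr0 subrr normr0 mulr_ge0.
have d0 : 'd (g - f) x = \0 :> (V -> W).
  by apply: (@diff_unique _ _ _ (g - f) (\0 : {linear V -> W}) x) => //; exact: cst_continuous.
apply/diff_locallyP; rewrite d0; split => //; exact: cst_continuous.
Qed.

Lemma differentiable_chain1 (V : normedModType R) (f : V -> R) (h : R -> R) (x v : V) (l : R) :
  differentiable f x -> is_derive (f x) 1 h l ->
  differentiable (h \o f) x /\ 'D_v (h \o f) x = l * 'D_v f x.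
Proof.
move=> df [dh hl]; have dh' : differentiable h (f x) by apply/derivable1_diffP.
have dhf := differentiable_comp df dh'; split => //.
rewrite !deriveE// diff_comp//= -[X in 'd h _ X]mulr1 [LHS]linearZ/=.
by rewrite -(deriveE _ dh') hl -[LHS]/(_ * _) mulrC.
Qed.

Variable n : nat.
Implicit Types (U W : set 'rV[R]_n).

(** [smooth_on] iterates [partial] on the left; peeling derivatives off from the inside, one at a
time, gives a predicate on which stability lemmas go by induction on k. *)
Fixpoint Ck {V : normedModType R} (k : nat) U (f : 'rV[R]_n -> V) : Prop :=
  (forall x, U x -> differentiable f x) /\
  (if k is k'.+1 then forall i, Ck k' U (partial i f) else True).

Lemma smooth_onP {V : normedModType R} U (f : 'rV[R]_n -> V) :
  smooth_on U f <-> forall k, Ck k U f.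
Proof.
split => [sf k|Cf s].
  elim: k f sf => [|k IH] f sf /=; split => //; try exact: (sf [::]).
  by move=> i; apply: IH => s x Ux; have := sf (rcons s i) x Ux; rewrite foldr_rcons.
elim/last_ind: s f Cf => [|s i IH] f Cf x Ux /=; first by have [df _] := Cf 0%N; exact: df.
rewrite foldr_rcons; apply: IH => // k.
by have [_ H] := Cf k.+1; exact: H.
Qed.

Lemma Ck_diff {V : normedModType R} k U (f : 'rV[R]_n -> V) x : Ck k U f -> U x ->
  differentiable f x.
Proof. by case: k => [|k] []; auto. Qed.

Lemma Ck_pred {V : normedModType R} k U (f : 'rV[R]_n -> V) : Ck k.+1 U f -> Ck k U f.
Proof.
elim: k f => [|k IH] f [df Hf]; split => // i.
by apply: IH; exact: Hf.
Qed.

Lemma Ck_sub {V : normedModType R} k U W (f : 'rV[R]_n -> V) : U `<=` W -> Ck k W f -> Ck k U f.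
Proof.
move=> UW; elim: k f => [|k IH] f [df Hf]; split => //; try by move=> x /UW; exact: df.
by move=> i; apply: IH; exact: Hf.
Qed.

Lemma partial_ext {V : normedModType R} U (f g : 'rV[R]_n -> V) i : open U -> {in U, f =1 g} ->
  {in U, partial i f =1 partial i g}.
Proof.
move=> oU fg x; rewrite inE => Ux; apply: near_eq_derive.
have : \near x, U x by apply: open_nbhs_nbhs.
by apply: filterS => y Uy; apply: fg; rewrite inE.
Qed.

Lemma Ck_ext {V : normedModType R} k U (f g : 'rV[R]_n -> V) : open U -> {in U, f =1 g} ->
  Ck k U f -> Ck k U g.
Proof.
move=> oU; elim: k f g => [|k IH] f g fg [df Hf]; split => //.
1,2: move=> x Ux; apply: (near_eq_differentiable _ (df _ Ux)).
1,2: have : \near x, U x by apply: open_nbhs_nbhs.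
1,2: by apply: filterS => y Uy; apply: fg; rewrite inE.
by move=> i; apply: (IH _ _ _ (Hf i)); exact: partial_ext.
Qed.

Lemma Ck_succ {V : normedModType R} k U (f : 'rV[R]_n -> V) (g : 'I_n -> 'rV[R]_n -> V) : open U ->
  (forall x, U x -> differentiable f x) -> (forall i x, U x -> partial i f x = g i x) ->
  (forall i, Ck k U (g i)) -> Ck k.+1 U f.
Proof.
move=> oU df E Hg; split => // i; apply: Ck_ext (Hg i) => // x; rewrite inE => Ux.
by rewrite E.
Qed.

Lemma Ck_cst {V : normedModType R} k U (a : V) : Ck k U (cst a).
Proof.
elim: k a => [|k IH] a; split => // i.
by rewrite (_ : partial i _ = cst 0); [exact: IH|apply/funext => x; exact: derive_cst].
Qed.

Lemma Ck_linear {V : normedModType R} k U (f : {linear 'rV[R]_n -> V}) : open U -> continuous f ->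
  Ck k U f.
Proof.
move=> oU cf; have df x : differentiable f x by exact: linear_differentiable.
case: k => [|k]; first by split.
apply: (@Ck_succ _ _ _ _ (fun i => cst (f (delta_mx 0 i)))) => // [i x Ux|i].
  by rewrite /partial deriveE// diff_lin.
exact: Ck_cst.
Qed.

Lemma Ck_coord k U j : open U -> Ck k U (fun x : 'rV[R]_n => x 0 j).
Proof.
move=> oU.
have L : linear (fun x : 'rV[R]_n => x 0 j : R) by move=> a u v; rewrite !mxE.
pose l := HB.pack_for {linear 'rV[R]_n ->
  R} (fun x : 'rV[R]_n => x 0 j : R) (@GRing.isLinear.Build _ _ _ _ _ L).
exact: (@Ck_linear _ k U l oU (@coord_continuous _ _ _ _ _)).
Qed.

Lemma CkD {V : normedModType R} k U (f g : 'rV[R]_n -> V) : open U -> Ck k U f -> Ck k U g ->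
  Ck k U (f + g).
Proof.
move=> oU; elim: k f g => [|k IH] f g Cf Cg.
  by split; [move=> x Ux; apply: differentiableD; [exact: Ck_diff Cf Ux|exact: Ck_diff Cg Ux]|].
apply: (@Ck_succ _ _ _ _ (fun i => partial i f + partial i g) oU).
- by move=> x Ux; apply: differentiableD; [exact: Ck_diff Cf Ux|exact: Ck_diff Cg Ux].
- move=> i x Ux; rewrite /partial deriveD//; apply: diff_derivable;
  [exact: Ck_diff Cf Ux|exact: Ck_diff Cg Ux].
- by move=> i; apply: IH; [case: Cf => _ H; exact: H|case: Cg => _ H; exact: H].
Qed.

Lemma CkM k U (f g : 'rV[R]_n -> R) : open U -> Ck k U f -> Ck k U g -> Ck k U (f * g).
Proof.
move=> oU; elim: k f g => [|k IH] f g Cf Cg.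
  by split; [move=> x Ux; apply: differentiableM; [exact: Ck_diff Cf Ux|exact: Ck_diff Cg Ux]|].
apply: (@Ck_succ _ _ _ _ (fun i => f * partial i g + g * partial i f) oU).
- by move=> x Ux; apply: differentiableM; [exact: Ck_diff Cf Ux|exact: Ck_diff Cg Ux].
- move=> i x Ux; rewrite /partial deriveM//; apply: diff_derivable;
  [exact: Ck_diff Cf Ux|exact: Ck_diff Cg Ux].
- move=> i; apply: CkD => //; apply: IH; try exact: Ck_pred.
  by case: Cg => _ H; exact: H. by case: Cf => _ H; exact: H.
Qed.

Lemma Ck_sum k U (I : Type) (r : seq I) (P : pred I) (f : I -> 'rV[R]_n -> R) : open U ->
  (forall i, Ck k U (f i)) -> Ck k U (\sum_(i <- r | P i) f i).
Proof.
move=> oU Cf; elim/big_rec: _ => [|i x _ IH]; first exact: Ck_cst.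
exact: CkD.
Qed.

(** One step of all the inductions below: h \o f gains a derivative as soon as h' \o f, which for
exp, inverse, ln and the flat functions is again built from functions of the same family, has one
less. *)
Lemma Ck_chain1 k U (f : 'rV[R]_n -> R) (h h' : R -> R) : open U ->
  (forall x, U x -> is_derive (f x) 1 h (h' (f x))) ->
  Ck k.+1 U f -> Ck k U (h' \o f) -> Ck k.+1 U (h \o f).
Proof.
move=> oU dh Cf Ch'.
apply: (@Ck_succ _ _ _ _ (fun i => (h' \o f) * partial i f)) => //.
- by move=> x Ux; have [] := differentiable_chain1 0 (Ck_diff Cf Ux) (dh _ Ux).
- by move=> i x Ux; have [_] := differentiable_chain1 (delta_mx 0 i) (Ck_diff Cf Ux) (dh _ Ux).
- by move=> i; apply: CkM => //; case: Cf => _ H; exact: H.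
Qed.

Lemma Ck_chain0 U (f : 'rV[R]_n -> R) (h h' : R -> R) :
  (forall x, U x -> is_derive (f x) 1 h (h' (f x))) -> Ck 0%N U f -> Ck 0%N U (h \o f).
Proof.
by move=> dh Cf; split => // x Ux; have [] := differentiable_chain1 0 (Ck_diff Cf Ux) (dh _ Ux).
Qed.

Lemma Ck_exp k U (f : 'rV[R]_n -> R) : open U -> Ck k U f -> Ck k U (expR \o f).
Proof.
move=> oU; elim: k f => [|k IH] f Cf; first by apply: (@Ck_chain0 U f expR expR).
apply: (@Ck_chain1 k U f expR expR) => //; apply: IH; exact: Ck_pred.
Qed.

Lemma Ck_inv k U (f : 'rV[R]_n -> R) : open U -> (forall x, U x -> f x != 0) ->
  Ck k U f -> Ck k U (GRing.inv \o f).
Proof.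
move=> oU f0.
have dI x : U x -> is_derive (f x) 1 GRing.inv (- (f x)^-1 * (f x)^-1).
  move=> Ux; split; first exact/derivable1_diffP/differentiable_Rinv/f0.
  have := @deriveV R R id (f x) 1 (f0 _ Ux) (@derivable_id _ _ _ _).
  rewrite derive_id => ->; rewrite -[LHS]/(_ * _) mulr1 mulNr; congr (- _).
  by rewrite expr2 invfM.
elim: k f f0 dI => [|k IH] f f0 dI Cf;
  first exact: (@Ck_chain0 U f GRing.inv (fun x => - x^-1 * x^-1)).
apply: (@Ck_chain1 k U f GRing.inv (fun x => - x^-1 * x^-1)) => //=.
have -> : (fun x => - x^-1 * x^-1) \o f = (cst (-1) : 'rV[R]_n ->
  R) * ((GRing.inv \o f) * (GRing.inv \o f)).
  by apply/funext => x; rewrite !fctE /= mulN1r mulNr.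
apply: CkM => //; first exact: Ck_cst.
by apply: CkM => //; apply: IH => //; exact: Ck_pred.
Qed.

Lemma Ck_ln k U (f : 'rV[R]_n -> R) : open U -> (forall x, U x -> 0 < f x) ->
  Ck k U f -> Ck k U (@ln R \o f).
Proof.
move=> oU f0 Cf.
have d x : U x -> is_derive (f x) 1 (@ln R) (f x)^-1 by move=> Ux; exact/is_derive1_ln/f0.
case: k Cf => [|k] Cf; first exact: (@Ck_chain0 U f (@ln R) GRing.inv).
apply: (@Ck_chain1 k U f (@ln R) GRing.inv) => //; apply: Ck_inv => //; last exact: Ck_pred.
by move=> x Ux; rewrite gt_eqF// f0.
Qed.

(** On positive reals sqrt is exp (ln / 2), so the cases of exp and ln suffice. *)
Lemma Ck_sqrt k U (f : 'rV[R]_n -> R) : open U -> (forall x, U x -> 0 < f x) ->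
  Ck k U f -> Ck k U (Num.sqrt \o f).
Proof.
move=> oU f0 Cf.
apply: (@Ck_ext _ k U (expR \o ((cst (2^-1) : 'rV[R]_n -> R) * (@ln R \o f)))) => //; last first.
  apply: Ck_exp => //; apply: CkM => //; first exact: Ck_cst.
  exact: Ck_ln.
move=> x; rewrite inE => Ux; rewrite !fctE/= -powR12_sqrt ?(ltW (f0 _ Ux))//.
by rewrite /powR gt_eqF ?(f0 _ Ux).
Qed.

End SmoothCalculus.

(** * Composition, and the flat function exp (-1/t) *)

Section SmoothComp.
Set Implicit Arguments.
Unset Strict Implicit.
Context {R : realType}.

Lemma Ck_component n m k (U : set 'rV[R]_n) (phi : 'rV[R]_n -> 'rV[R]_m) j : open U ->
  Ck k U phi -> Ck k U (fun x => phi x 0 j).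
Proof.
move=> oU.
have dc (f : 'rV[R]_n -> 'rV[R]_m) x : differentiable f x -> differentiable (fun x => f x 0 j) x.
  move=> df; apply: (@differentiable_comp _ _ _ _ f (fun y => y 0 j)) => //;
    exact: differentiable_coord.
elim: k phi => [|k IH] phi Cp.
  by split => // x Ux; apply: dc; exact: Ck_diff Cp Ux.
apply: (@Ck_succ _ _ _ _ _ _ (fun i x => partial i phi x 0 j)) => //.
- by move=> x Ux; apply: dc; exact: Ck_diff Cp Ux.
- move=> i x Ux; rewrite /partial derive_mx ?mxE//.
  by apply: diff_derivable; exact: Ck_diff Cp Ux.
- by move=> i; apply: IH; case: Cp => _ H; exact: H.
Qed.

Lemma diff_row_sum m (V : normedModType R) (f : 'rV[R]_m -> V) x w : differentiable f x ->
  'd f x w = \sum_j w 0 j *: partial j f x.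
Proof.
move=> df; rewrite {1}[w]row_sum_delta linear_sum; apply: eq_bigr => j _.
by rewrite linearZ/= /partial deriveE.
Qed.

(** The chain rule expresses a partial derivative of f \o phi through the partial derivatives of f,
again composed with phi, and those of the components of phi. *)
Lemma Ck_comp n m k (U : set 'rV[R]_n) (W : set 'rV[R]_m) (phi : 'rV[R]_n ->
  'rV[R]_m) (f : 'rV[R]_m -> R) :
  open U -> (forall x, U x -> W (phi x)) -> Ck k U phi -> Ck k W f -> Ck k U (f \o phi).
Proof.
move=> oU UW; elim: k f => [|k IH] f Cp Cf.
  split => // x Ux; apply: differentiable_comp; [exact: Ck_diff Cp Ux|apply: Ck_diff Cf _;
    exact: UW].
apply: (@Ck_succ _ _ _ _ _ _ (fun i => \sum_j (fun x => partial i phi x 0 j) * (partial j f \o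
  phi))) => //.
- move=> x Ux; apply: differentiable_comp; [exact: Ck_diff Cp Ux|apply: Ck_diff Cf _; exact: UW].
- move=> i x Ux.
  have df : differentiable f (phi x) by apply: Ck_diff Cf _; exact: UW.
  have dp : differentiable phi x by exact: Ck_diff Cp Ux.
  rewrite /partial deriveE; last exact: differentiable_comp.
  rewrite diff_comp//= -(deriveE _ dp) diff_row_sum// fct_sumE.
  by apply: eq_bigr.
- move=> i; apply: Ck_sum => // j; apply: CkM => //.
    by apply: Ck_component => //; case: Cp => _ H; exact: H.
  by apply: IH; [exact: Ck_pred|case: Cf => _ H; exact: H].
Qed.

(** The derivative of t^-m exp (-1/t) is a combination of functions of the same form, hence the
whole family at once; m = 0 is the classical smooth function that is not analytic at 0. *)
Definition flat (m : nat) (t : R) : R := if 0 < t then t^-1 ^+ m * expR (- t^-1) else 0.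

Lemma expR_ge_pow (N : nat) (s : R) : 0 <= s -> (s / N.+1%:R) ^+ N.+1 <= expR s.
Proof.
move=> s0; have -> : expR s = expR (s / N.+1%:R) ^+ N.+1.
  by rewrite -expRM_natl mulrC divfK.
have d0 : 0 <= s / N.+1%:R by rewrite divr_ge0.
rewrite lerXn2r ?nnegrE ?expR_ge0//.
by apply: le_trans (expR_ge1Dx _); rewrite lerDr.
Qed.

Lemma flat_ge0 m t : 0 <= flat m t.
Proof.
by rewrite /flat; case: ifPn => // t0; rewrite mulr_ge0 ?expR_ge0// exprn_ge0// invr_ge0 ltW.
Qed.

(** As 1/t tends to infinity exp (1/t) exceeds any power of it. A bound linear in t, for every m,
is all that differentiability at 0 requires. *)
Lemma flat_le m t : flat m t <= m.+1%:R ^+ m.+1 * `|t|.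
Proof.
rewrite /flat; case: ifPn => [t0|_]; last by rewrite mulr_ge0.
have := @expR_ge_pow m (t^-1); rewrite invr_ge0 => /(_ (ltW t0)) H.
rewrite expRN ler_pdivrMr ?expR_gt0// gtr0_norm//.
apply: le_trans (ler_wpM2l _ H); last by rewrite mulr_ge0 ?exprn_ge0// ltW.
rewrite expr_div_n [t^-1 ^+ m.+1]exprS.
have E : m.+1%:R ^+ m.+1 != 0 :> R by rewrite expf_neq0.
by rewrite -!mulrA (mulrA t) divff ?gt_eqF// mul1r mulrCA divff// mulr1.
Qed.

(** At 0 the difference quotient of [flat m] is [flat m.+1], which tends to 0 by [flat_le]. *)
Lemma is_derive_flat m (t : R) : is_derive t 1 (flat m) (flat m.+2 t - m%:R * flat m.+1 t).
Proof.
have [t0|t0|->] := ltgtP t 0.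
- rewrite /flat ltNge (ltW t0)/= mulr0 subrr.
  apply: (@near_eq_is_derive _ _ _ (cst 0)).
  near=> x; rewrite ltNge; suff -> : x <= 0 by [].
  by apply/ltW; near: x; exact: lt_nbhsl.
- suff D : is_derive t 1 (fun t => t^-1 ^+ m * expR (- t^-1)) (flat m.+2 t - m%:R * flat m.+1 t).
    apply: near_eq_is_derive D; near=> x; rewrite /flat; suff -> : 0 < x by [].
    by near: x; exact: lt_nbhsr.
  rewrite /flat t0.
  have dI : is_derive t 1 (fun x : R => x^-1) (- (t ^- 2)).
    split; first by apply/derivable1_diffP/differentiable_Rinv; rewrite gt_eqF.
    have := @deriveV R R id t 1 (lt0r_neq0 t0) (@derivable_id _ _ _ _).
    by rewrite derive_id => ->; rewrite -[LHS]/(_ * _) mulr1.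
  have dN : is_derive t 1 (fun x : R => - x^-1) (t ^- 2).
    by apply: is_derive_eq; rewrite opprK.
  have dE : is_derive t 1 (fun x : R => expR (- x^-1)) (t ^- 2 * expR (- t^-1)).
    by have := @is_derive1_comp _ expR (fun x : R => - x^-1) t _ _ (is_derive_expR _) dN;
      rewrite mulrC.
  have dX : is_derive t 1 (fun x : R => x^-1 ^+ m) (- m%:R * t^-1 ^+ m.+1).
    case: m => [|m]; first by rewrite oppr0 mul0r (_ : (fun x : R => _) = cst 1);
      [exact: is_derive_cst|apply/funext => x; rewrite expr0].
    have H := @is_deriveX _ _ (fun x : R => x^-1) m.+1 t 1 _ dI.
    have E : (fun x : R => x^-1) ^+ m.+1 = (fun x : R => x^-1 ^+ m.+1) :> (R -> R).
      by apply/funext => x; rewrite exprfctE.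
    rewrite E in H; apply: (is_derive_eq H); rewrite -[LHS]/(_ * _) !exprS expr0.
    by field; rewrite gt_eqF.
  apply: (is_derive_eq (is_deriveM dX dE)); rewrite -[LHS]/(_ * _ + _ * _) !exprS expr0.
  by field; rewrite gt_eqF.
rewrite /flat ltxx mulr0 subrr.
rewrite -/(flat m).
have H : (fun h => h^-1 *: ((flat m \o shift 0) (h *: 1) - flat m 0)) @ 0^' --> (0 : R).
  apply/cvgrPdist_le => e e0; near=> h.
  rewrite sub0r normrN /= addr0 [h *: 1]mulr1 {2}/flat ltxx subr0.
  have -> : h^-1 *: flat m h = flat m.+1 h.
    by rewrite /flat; case: ifPn => _; rewrite ?scaler0// -[LHS]/(_ * _) mulrA -exprS.
  rewrite ger0_norm ?flat_ge0// (le_trans (flat_le _ _))// mulrC -ler_pdivlMr ?exprn_gt0//.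
  by near: h; apply: dnbhs0_le; rewrite divr_gt0// exprn_gt0.
by split; [apply: cvgP H|apply: cvg_lim H].
Unshelve. all: by end_near. Qed.

Variable n : nat.

Lemma Ck_flat m k (U : set 'rV[R]_n) (f : 'rV[R]_n -> R) : open U -> Ck k U f ->
  Ck k U (flat m \o f).
Proof.
move=> oU; elim: k m f => [|k IH] m f Cf.
  by apply: (@Ck_chain0 _ _ U f (flat m) (fun x => flat m.+2 x - m%:R * flat m.+1 x) (fun x _ =>
    is_derive_flat m (f x))).
apply: (@Ck_chain1 _ _ k U f (flat m) (fun x => flat m.+2 x - m%:R * flat m.+1 x) oU (fun x _ =>
  is_derive_flat m (f x))) => //.
have -> : (fun x => flat m.+2 x - m%:R * flat m.+1 x) \o f = (flat m.+2 \o f) + cst (- m%:R) *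
  (flat m.+1 \o f).
  by apply/funext => x; rewrite !fctE/= mulNr.
have Cf' := Ck_pred Cf.
apply: CkD => //; first exact: IH.
by apply: CkM => //; [exact: Ck_cst|exact: IH].
Qed.

End SmoothComp.

(** * Positive definite quadratic forms *)

Section QuadraticForms.
Set Implicit Arguments.
Unset Strict Implicit.
Context {R : realType} {n : nat}.
Implicit Types (G : 'M[R]_n) (v w : 'rV[R]_n).

Definition bil_form G v w : R := (v *m G *m w^T) 0 0.
Definition posdef G := G^T = G /\ forall w, w != 0 -> 0 < quad_form G w.
Definition qnorm G w := Num.sqrt (quad_form G w).

Lemma bilC G v w : G^T = G -> bil_form G v w = bil_form G w v.
Proof.
move=> sG; rewrite /bil_form -[RHS](mxE (nosimpl trmx_key) (fun i j => (w *m G *m v^T) j i)).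
by rewrite -/(trmx _) !trmx_mul sG trmxK mulmxA.
Qed.

Lemma bilDl G u v w : bil_form G (u + v) w = bil_form G u w + bil_form G v w.
Proof. by rewrite /bil_form !mulmxDl mxE. Qed.
Lemma bilZl G a v w : bil_form G (a *: v) w = a * bil_form G v w.
Proof. by rewrite /bil_form -!scalemxAl mxE. Qed.
Lemma bilDr G u v w : bil_form G u (v + w) = bil_form G u v + bil_form G u w.
Proof. by rewrite /bil_form linearD/= mulmxDr mxE. Qed.
Lemma bilZr G a v w : bil_form G v (a *: w) = a * bil_form G v w.
Proof. by rewrite /bil_form linearZ/= -scalemxAr mxE. Qed.

Lemma quad_bil G w : quad_form G w = bil_form G w w. Proof. by []. Qed.

Lemma quadZ G a w : quad_form G (a *: w) = a ^+ 2 * quad_form G w.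
Proof. by rewrite !quad_bil bilZl bilZr mulrA. Qed.

Lemma quad0 G : quad_form G 0 = 0.
Proof. by rewrite -(scale0r 0) quadZ expr0n mul0r. Qed.

Lemma quad_ge0 G w : posdef G -> 0 <= quad_form G w.
Proof.
by move=> [_ pG]; have [->|/pG/ltW//] := eqVneq w 0; rewrite quad0.
Qed.

(** Nonnegativity of the form at v - (B(v,w)/q(w)) w. *)
Lemma cauchy_schwarz G v w : posdef G -> bil_form G v w ^+ 2 <= quad_form G v * quad_form G w.
Proof.
move=> PG; have [sG pG] := PG.
have [->|w0] := eqVneq w 0; first by rewrite -(scale0r 0) bilZr mul0r expr0n quadZ expr0n mul0r
  mulr0.
have q0 := pG _ w0.
have := quad_ge0 (v - (bil_form G v w / quad_form G w) *: w) PG.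
rewrite quad_bil -scaleNr !(bilDl, bilDr, bilZl, bilZr) (bilC w v sG) -!quad_bil.
set b := bil_form G v w; set q := quad_form G w in q0 *.
rewrite [X in 0 <= X](_ : _ = (quad_form G v * q - b ^+ 2) / q); last by field; rewrite gt_eqF.
by rewrite pmulr_lge0 ?invr_gt0// subr_ge0.
Qed.

Lemma qnorm_ge0 G w : 0 <= qnorm G w. Proof. exact: sqrtr_ge0. Qed.

Lemma qnorm_sqr G w : posdef G -> qnorm G w ^+ 2 = quad_form G w.
Proof. by move=> PG; rewrite sqr_sqrtr// quad_ge0. Qed.

Lemma qnormZ G a w : qnorm G (a *: w) = `|a| * qnorm G w.
Proof. by rewrite /qnorm quadZ sqrtrM ?sqr_ge0// sqrtr_sqr. Qed.

Lemma qnormN G w : qnorm G (- w) = qnorm G w.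
Proof. by rewrite -scaleN1r qnormZ normrN1 mul1r. Qed.

Lemma qnorm_bil G v w : posdef G -> `|bil_form G v w| <= qnorm G v * qnorm G w.
Proof.
move=> PG; rewrite -(ler_pXn2r (n:=2)) ?nnegrE ?mulr_ge0 ?qnorm_ge0// real_normK ?num_real//.
by rewrite exprMn !qnorm_sqr// cauchy_schwarz.
Qed.

Lemma qnormD G v w : posdef G -> qnorm G (v + w) <= qnorm G v + qnorm G w.
Proof.
move=> PG; have [sG _] := PG.
rewrite -(ler_pXn2r (n:=2)) ?nnegrE ?addr_ge0 ?qnorm_ge0// sqrrD !qnorm_sqr//.
rewrite !quad_bil bilDl !bilDr (bilC w v sG) -!quad_bil.
have := qnorm_bil v w PG; have := ler_norm (bil_form G v w).
by rewrite mulr2n; lra.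
Qed.

Lemma posdef_unit G : posdef G -> G \in unitmx.
Proof.
move=> [_ pG]; rewrite -row_free_unit -kermx_eq0; apply/eqP/row_matrixP => i.
rewrite row0; apply/eqP; apply: contraT => /pG.
have : row i (kermx G) *m G = 0 by apply/sub_kermxP; exact: row_sub.
by rewrite /quad_form => ->; rewrite mul0mx mxE ltxx.
Qed.

(** The i-th coordinate of w is B(w, e_i G^-1); apply Cauchy-Schwarz. *)
Lemma qnorm_coord G : posdef G -> exists2 A, 0 < A & forall w, `|w| <= A * qnorm G w.
Proof.
move=> PG; have [sG _] := PG; have uG := posdef_unit PG.
pose e i : 'rV[R]_n := delta_mx 0 i *m invmx G.
exists (1 + \sum_i qnorm G (e i)) => [|w].
  by rewrite ltr_pwDl// sumr_ge0// => i _; rewrite qnorm_ge0.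
rewrite [leLHS]/Num.Def.normr/= mx_normrE; apply: bigmax_le => [|[a i] _] /=.
  by rewrite mulr_ge0 ?qnorm_ge0// addr_ge0// sumr_ge0// => i _; rewrite qnorm_ge0.
have -> : w a i = bil_form G w (e i).
  rewrite bilC// /bil_form /e mulmxKV//.
  by rewrite -rowE !mxE; congr (w _ _); exact: ord1.
apply: le_trans (qnorm_bil _ _ PG) _; rewrite mulrC ler_wpM2r ?qnorm_ge0//.
rewrite (bigD1 i)//= addrCA lerDl addr_ge0// sumr_ge0// => j _; exact: qnorm_ge0.
Qed.

Lemma coord_le_norm w i : `|w 0 i| <= `|w|.
Proof. by rewrite [leRHS]/Num.Def.normr/= mx_normrE (le_bigmax _ (fun ij => `|w ij.1 ij.2|) (0,
  i)). Qed.

Lemma quad_sum G w : quad_form G w = \sum_i \sum_j w 0 i * G i j * w 0 j.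
Proof.
rewrite /quad_form mxE exchange_big; apply: eq_bigr => j _ /=.
by rewrite !mxE mulr_suml.
Qed.

Lemma quad_le G w c : (forall i j, `|G i j| <= c) -> `|quad_form G w| <= n%:R ^+ 2 * c * `|w| ^+ 2.
Proof.
move=> Gc; rewrite quad_sum.
apply: (@le_trans _ _ (\sum_(i < n) \sum_(j < n) c * `|w| ^+ 2)).
  apply: le_trans (ler_norm_sum _ _ _) _; apply: ler_sum => i _.
  apply: le_trans (ler_norm_sum _ _ _) _; apply: ler_sum => j _.
  rewrite !normrM; have wG := ler_pM (normr_ge0 _) (normr_ge0 _) (coord_le_norm w i) (Gc i j).
  apply: le_trans (ler_pM _ _ wG (coord_le_norm w j)) _; rewrite ?mulr_ge0//.
  by rewrite mulrAC -expr2 mulrC.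
rewrite !sumr_const !card_ord -(mulr_natl (_ *+ n) n) -(mulr_natl (c * _) n) le_eqVlt; apply/orP;
  left; apply/eqP; ring.
Qed.

Lemma quad_bound G : exists2 b, 0 < b & forall w, qnorm G w <= b * `|w|.
Proof.
pose c := \sum_i \sum_j `|G i j|.
have c0 : 0 <= c by do 2 (apply: sumr_ge0 => ? _).
have Gc i j : `|G i j| <= c.
  rewrite /c (bigD1 i)//= (bigD1 j)//= -addrA lerDl addr_ge0//; apply: sumr_ge0 => // ? _;
    exact: sumr_ge0.
have b0 : 0 <= n%:R ^+ 2 * c by rewrite mulr_ge0.
exists (1 + Num.sqrt (n%:R ^+ 2 * c)) => [|w]; first by rewrite ltr_pwDl.
apply: (@le_trans _ _ (Num.sqrt (n%:R ^+ 2 * c) * `|w|)).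
  rewrite -[X in _ * X]ger0_norm// -sqrtr_sqr -sqrtrM// ler_wsqrtr//.
  apply: le_trans (quad_le w Gc); exact: ler_norm.
by rewrite ler_wpM2r// lerDr.
Qed.

(** If the entries of H and G differ by eps, the values of the forms differ by at most n^2 eps
|w|^2, and |w|^2 is controlled by the form of G. *)
Lemma qnorm_compare G H A eps : posdef G -> posdef H -> (forall w, `|w| <= A * qnorm G w) ->
  0 < A ->
  (forall i j, `|H i j - G i j| <= eps) -> n%:R ^+ 2 * eps * A ^+ 2 <= 2^-1 ->
  forall w, qnorm H w <= 2 * qnorm G w /\ qnorm G w <= 2 * qnorm H w.
Proof.
move=> PG PH AG A0 HG eA w.
have D : `|quad_form H w - quad_form G w| <= 2^-1 * quad_form G w.
  have -> : quad_form H w - quad_form G w = quad_form (H - G) w.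
    by rewrite /quad_form mulmxBr mulmxBl !mxE.
  apply: (@le_trans _ _ (n%:R ^+ 2 * eps * `|w| ^+ 2)).
    by apply: quad_le => i j; rewrite !mxE.
  have [e0|e0] := leP 0 (n%:R ^+ 2 * eps); last first.
    apply: (@le_trans _ _ 0); first by rewrite nmulr_rle0// sqr_ge0.
    by rewrite mulr_ge0 ?quad_ge0.
  apply: (@le_trans _ _ (n%:R ^+ 2 * eps * (A ^+ 2 * quad_form G w))).
    rewrite ler_wpM2l// -qnorm_sqr// -exprMn lerXn2r ?nnegrE ?mulr_ge0 ?qnorm_ge0//; exact: ltW.
  by rewrite mulrA ler_wpM2r ?quad_ge0.
have qG := quad_ge0 w PG; move: D; rewrite ler_norml => /andP[D1 D2].
have two : 2 = Num.sqrt (2 ^+ 2) :> R by rewrite sqrtr_sqr ger0_norm.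
by split; rewrite /qnorm two -sqrtrM ?sqr_ge0// ler_wsqrtr//; lra.
Qed.

Lemma cvgr_sum (T : topologicalType) (x : T) (I : Type) (r : seq I) (f : I -> T -> R) :
  (forall i, f i t @[t --> x] --> f i x) -> \sum_(i <- r) f i t @[t --> x] --> \sum_(i <- r) f i x.
Proof.
move=> cf; elim: r => [|i r IH].
  by rewrite big_nil (_ : (fun t => _) = cst 0); [exact: cvg_cst|apply/funext => t;
    rewrite big_nil].
rewrite big_cons (_ : (fun t => _) = f i \+ (fun t => \sum_(i <- r) f i t)); first exact: cvgD.
by apply/funext => t /=; rewrite big_cons.
Qed.

Lemma det_continuous (T : topologicalType) (f : T -> 'M[R]_n) (x : T) :
  (forall i j, f t i j @[t --> x] --> f x i j) -> \det (f t) @[t --> x] --> \det (f x).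
Proof.
move=> cf; rewrite /determinant;
  apply: (@cvgr_sum _ x _ (index_enum {perm 'I_n}) (fun s t => (-1) ^+ s * \prod_i f t i (s i)))
    => s.
apply: cvgM; first exact: cvg_cst.
elim: (index_enum _) => [|i r IH].
  by rewrite big_nil (_ : (fun t => _) = cst 1); [exact: cvg_cst|apply/funext => t;
    rewrite big_nil].
rewrite big_cons (_ : (fun t => _) = (fun t => f t i (s i)) \* (fun t => \prod_(i <- r) f t i (s
  i))).
  by apply: cvgM.
by apply/funext => t /=; rewrite big_cons.
Qed.

(** The determinant does not vanish on the segment of positive definite matrices from the identity
to G, and it is 1 at the identity. *)
Lemma posdef_det G : posdef G -> 0 < \det G.
Proof.
move=> PG; have [sG pG] := PG.
pose P t := (1 - t)%:M + t *: G : 'M[R]_n.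
have PP t : 0 <= t <= 1 -> posdef (P t).
  move=> /andP[t0 t1]; split; first by rewrite /P linearD/= linearZ/= sG tr_scalar_mx.
  move=> w w0; rewrite /quad_form mulmxDr mulmxDl mxE.
  have w2 : (w *m (1 - t)%:M *m w^T) 0 0 = (1 - t) * \sum_i w 0 i ^+ 2.
    rewrite mul_mx_scalar -scalemxAl mxE; congr (_ * _); rewrite mxE; apply: eq_bigr => i _.
    by rewrite mxE expr2.
  have wG : (w *m (t *: G) *m w^T) 0 0 = t * quad_form G w.
    by rewrite -scalemxAr -scalemxAl mxE.
  rewrite w2 wG.
  have s0 : 0 < \sum_i w 0 i ^+ 2.
    rewrite lt_def sumr_ge0 ?andbT; last by move=> i _; exact: sqr_ge0.
    apply: contra w0 => /eqP s0; apply/eqP/rowP => i; rewrite mxE; apply/eqP.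
    rewrite -(sqrf_eq0 (w 0 i)); have := @psumr_eq0P _ _ xpredT (fun i => w 0 i ^+ 2).
    by move=> /(_ (fun i _ => sqr_ge0 _) s0 i isT) ->.
  have [->|tn0] := eqVneq t 0; first by rewrite subr0 mul1r mul0r addr0.
  apply: ltr_wpDl; first by rewrite mulr_ge0 ?subr_ge0// ltW.
  by rewrite mulr_gt0 ?pG// lt_def tn0.
rewrite ltNge; apply/negP => dG.
have cP : continuous (fun t => \det (P t)).
  move=> t; apply: det_continuous => i j; rewrite /P.
  rewrite !mxE (_ : (fun t => _) = (fun t => (1 - t) *+ (i == j) + t * G i j));
    last by apply/funext => u; rewrite !mxE.
  apply: cvgD; last by apply: cvgM; [exact: cvg_id|exact: cvg_cst].
  by apply: cvgMn; apply: cvgB; [exact: cvg_cst|exact: cvg_id].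
have d0 : \det (P 0) = 1 by rewrite /P subr0 scale0r addr0 det1.
have d1 : \det (P 1) = \det G by rewrite /P subrr scale1r raddf0 add0r.
have [|c c01 dc] := @IVT R (fun t => \det (P t)) 0 1 0 ler01 (continuous_subspaceT cP).
  by rewrite d0 d1 ge_min dG orbT/= le_max ler01.
have /posdef_unit : posdef (P c) by apply: PP; move: c01; rewrite in_itv.
by rewrite unitmxE dc unitr0.
Qed.

End QuadraticForms.

(** * Smooth functions on a manifold and their gradients *)

Section ManifoldCalculus.
Set Implicit Arguments.
Unset Strict Implicit.
Context {R : realType} {n : nat} {M : ptopologicalType}.
Lemma diff_compE (U V W : normedModType R) (f : U -> V) (h : V -> W) x w :
  differentiable f x -> differentiable h (f x) -> 'd (h \o f) x w = 'd h (f x) ('d f x w).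
Proof. by move=> df dh; rewrite (diff_comp df dh). Qed.

(** The term in 'd P carries only the difference F - H, because the coefficients P and 1 - P sum
to 1. *)
Lemma diff_glue (V : normedModType R) (P F H : V -> R) (x w : V) :
  differentiable P x -> differentiable F x -> differentiable H x ->
  'd (P * F + (cst 1 - P) * H) x w =
  P x * 'd F x w + (1 - P x) * 'd H x w + (F x - H x) * 'd P x w.
Proof.
move=> dP dF dH.
have iP := differentiableP dP; have iF := differentiableP dF; have iH := differentiableP dH.
have i1 := is_diffB (is_diff_cst (1 : R) x) iP.
have D := is_diffD (is_diffM iP iF) (is_diffM i1 iH).
have -> := congr1 (fun k : V -> R => k w) (@diff_val _ _ _ _ _ _ _ D).
have G (p f h a b e : R) : p * a + f * e + ((1 - p) * b + h * (0 - e)) = p * a + (1 - p) * b + (f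
  - h) * e by ring.
exact: G.
Qed.

Lemma glue_bound (p f h dF dH dP L A d q : R) : 0 <= p <= 1 -> `|dF| <= L * q -> `|dH| <= L * q ->
  `|dP| <= A * q -> `|f - h| <= d -> 0 <= A -> 0 <= q ->
  `|p * dF + (1 - p) * dH + (f - h) * dP| <= (L + d * A) * q.
Proof.
move=> /andP[p0 p1] HF HH HP fh A0 q0.
apply: le_trans (ler_normD _ _) _; rewrite [leRHS]mulrDl; apply: lerD; last first.
  by rewrite normrM -mulrA; apply: ler_pM.
have p1' : 0 <= 1 - p by rewrite subr_ge0.
apply: le_trans (ler_normD _ _) _; rewrite !normrM (ger0_norm p0) (ger0_norm p1').
have -> : L * q = p * (L * q) + (1 - p) * (L * q) by ring.
by apply: lerD; rewrite ler_wpM2l.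
Qed.

Variables (X : smooth_manifold R n M).
Implicit Types (c : chart X) (U O : set M) (x y : M).

Lemma cod_mem c x : chart_dom c x -> chart_cod c (chart_map c x).
Proof. by exists x. Qed.

Lemma chart_invK c v : chart_cod c v ->
  chart_dom c (chart_inv c v) /\ chart_map c (chart_inv c v) = v.
Proof. by move=> [x dx <-]; rewrite chart_mapK. Qed.

Lemma imageE c U : chart_map c @` (chart_dom c `&` U) = chart_cod c `&` (chart_inv c @^-1` U).
Proof.
apply/seteqP; split => [_ [x [dx Ux] <-]|v [cv Uv]].
  by split; [exact: cod_mem|rewrite /preimage/= chart_mapK].
by have [dv vE] := chart_invK cv; exists (chart_inv c v).
Qed.

Lemma image_open c U : open U -> open (chart_map c @` (chart_dom c `&` U)).
Proof.
move=> oU; rewrite imageE openE => v [cv Uv].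
apply: filterI; first by apply: open_nbhs_nbhs; split => //; exact: chart_cod_open.
by apply: (chart_inv_continuous cv); apply: open_nbhs_nbhs.
Qed.

Lemma dom_near c x : chart_dom c x -> \near x, chart_dom c x.
Proof. by move=> dx; apply: open_nbhs_nbhs; split => //; exact: chart_dom_open. Qed.

(** Smoothness on an open set U of M, read in every chart. *)
Definition msmooth U (f : M -> R) :=
  forall c, smooth_on (chart_map c @` (chart_dom c `&` U)) (f \o chart_inv c).

Lemma msmoothP U f : msmooth U f <-> forall c k,
  Ck k (chart_map c @` (chart_dom c `&` U)) (f \o chart_inv c).
Proof. by split => H c; have := H c; rewrite smooth_onP. Qed.

Lemma msmooth_local U f : (forall x, U x -> exists2 W : set M, W x & msmooth W f) -> msmooth U f.
Proof.
move=> H c s _ [x [dx Ux] <-]; have [W Wx sW] := H _ Ux.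
by apply: (sW c s); exists x.
Qed.

Lemma msmooth_sub U W f : U `<=` W -> msmooth W f -> msmooth U f.
Proof. by move=> UW sf; apply: msmooth_local => x /UW Wx; exists W. Qed.

Lemma msmooth_ext U f h : open U -> {in U, f =1 h} -> msmooth U f -> msmooth U h.
Proof.
move=> oU fh /msmoothP sf; apply/msmoothP => c k.
apply: Ck_ext (sf c k); first exact: image_open.
move=> v; rewrite inE imageE => -[_ Uv] /=; apply: fh; rewrite inE; exact: Uv.
Qed.

Lemma msmoothD U f h : open U -> msmooth U f -> msmooth U h -> msmooth U (f + h).
Proof. by move=> oU /msmoothP sf /msmoothP sh; apply/msmoothP => c k; apply: CkD => //;
  exact: image_open. Qed.

Lemma msmoothM U f h : open U -> msmooth U f -> msmooth U h -> msmooth U (f * h).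
Proof. by move=> oU /msmoothP sf /msmoothP sh; apply/msmoothP => c k; apply: CkM => //;
  exact: image_open. Qed.

Lemma msmooth_cst U (a : R) : msmooth U (cst a).
Proof. by apply/msmoothP => c k; exact: Ck_cst. Qed.

(** In another chart the function is F composed with a transition map. *)
Lemma msmooth_chart c U (F : 'rV[R]_n -> R) : open U -> U `<=` chart_dom c ->
  (forall k, Ck k (chart_map c @` U) F) -> msmooth U (F \o chart_map c).
Proof.
move=> oU Uc CF; apply/msmoothP => c' k.
have := @Ck_comp R n n k _ (chart_map c @` U) (chart_map c \o chart_inv c') F (image_open (c:=c')
  oU).
rewrite compA; apply => //.
  by move=> v; rewrite imageE => -[cv Uv]; exists (chart_inv c' v).
apply: (@Ck_sub _ _ _ k _ (chart_map c' @` (chart_dom c' `&` chart_dom c))).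
  by apply: image_subset; apply: setIS.
by move: k; apply/smooth_onP; exact: transition_smooth.
Qed.

Lemma msmooth_diff U f c x : msmooth U f -> U x -> chart_dom c x ->
  differentiable (f \o chart_inv c) (chart_map c x).
Proof. by move=> sf Ux dx; apply: (sf c [::]); exists x. Qed.

Variable g : riemannian_metric X.

Lemma gram_pd c v : chart_cod c v -> posdef (gram g c v).
Proof. by move=> cv; split; [exact: gram_sym|move=> w; exact: gram_posdef]. Qed.

Lemma transition_diff c c' x : chart_dom c x -> chart_dom c' x ->
  differentiable (chart_map c' \o chart_inv c) (chart_map c x).
Proof. by move=> dx dx'; have := @transition_smooth _ _ _ X c c' [::] (chart_map c x); apply;
  exists x. Qed.

(** The transformation law of the metric, read on tangent vectors. *)
Lemma qnorm_transition c c' x w : chart_dom c x -> chart_dom c' x ->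
  qnorm (gram g c (chart_map c x)) w =
  qnorm (gram g c' (chart_map c' x)) ('d (chart_map c' \o chart_inv c) (chart_map c x) w).
Proof.
move=> dx dx'; rewrite (@gram_transition _ _ _ _ g c c' (chart_map c x)); last by exists x.
rewrite chart_mapK// /qnorm /quad_form; congr (Num.sqrt _).
have -> : 'd (chart_map c' \o chart_inv c) (chart_map c x) w = w *m 'J (chart_map c' \o chart_inv
  c) (chart_map c x).
  by rewrite /jacobian mul_rV_lin1.
by rewrite trmx_mul !mulmxA.
Qed.

Definition slope_in c (f : M -> R) x (L : R) :=
  forall w, `|'d (f \o chart_inv c) (chart_map c x) w| <= L * qnorm (gram g c (chart_map c x)) w.
(** The dual norm of df at x is at most L. Bounding df on tangent vectors, instead of computing
the norm of the gradient, makes the bound easy to change of chart and to obtain from a Lipschitz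
estimate. *)
Definition slope f x L := slope_in (chart_at X x) f x L.

Lemma diff_transition c c' (f : M -> R) x : chart_dom c x -> chart_dom c' x ->
  differentiable (f \o chart_inv c') (chart_map c' x) ->
  differentiable (f \o chart_inv c) (chart_map c x) /\
  'd (f \o chart_inv c) (chart_map c x) =
  'd (f \o chart_inv c') (chart_map c' x) \o 'd (chart_map c' \o chart_inv c) (chart_map c x) :>
    (_ -> _).
Proof.
move=> dx dx' df; have dT := transition_diff dx dx'.
have df0 : differentiable (f \o chart_inv c') ((chart_map c' \o chart_inv c) (chart_map c x)).
  by rewrite /comp chart_mapK.
have dC : differentiable ((f \o chart_inv c') \o (chart_map c' \o chart_inv c)) (chart_map c x).
  exact: differentiable_comp dT df0.
have E : \forall v \near chart_map c x,
  ((f \o chart_inv c') \o (chart_map c' \o chart_inv c)) v = (f \o chart_inv c) v.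
  have : \forall v \near chart_map c x, chart_dom c' (chart_inv c v).
    have cv := cod_mem dx.
    apply: (chart_inv_continuous cv); rewrite chart_mapK//; exact: dom_near.
  by apply: filterS => v dv /=; rewrite chart_mapK.
have df' := near_eq_differentiable E dC.
split => //; apply/funext => w.
apply: (etrans (esym (deriveE w df'))).
apply: (etrans (esym (near_eq_derive w E))).
apply: (etrans (deriveE w dC)).
apply: (etrans (@diff_compE _ _ _ _ _ _ w dT df0)).
have -> : (chart_map c' \o chart_inv c) (chart_map c x) = chart_map c' x by rewrite /comp
  chart_mapK.
by [].
Qed.

(** Both sides are evaluated at corresponding tangent vectors, so a gradient bound may be checked in
any chart. *)
Lemma slope_transition c c' f x L : chart_dom c x -> chart_dom c' x ->
  differentiable (f \o chart_inv c') (chart_map c' x) -> slope_in c' f x L -> slope_in c f x L.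
Proof.
move=> dx dx' df sf w; have [_ ->] := diff_transition dx dx' df.
by rewrite (qnorm_transition _ dx dx') /=; exact: sf.
Qed.

Lemma gradient_norm2_ge0 f x : 0 <= gradient_norm2 g f x.
Proof. by apply: quad_ge0; apply: gram_pd; apply: cod_mem; exact: chart_atP. Qed.

(** Evaluating df on the gradient itself gives q = df(grad) <= L sqrt q. *)
Lemma gradient_norm2_le f x L : 0 <= L ->
  differentiable (f \o chart_inv (chart_at X x)) (chart_map (chart_at X x) x) ->
  slope f x L -> gradient_norm2 g f x <= L ^+ 2.
Proof.
move=> L0 df /(_ (gradient g f x)).
have PG : posdef (gram_at g x) by apply: gram_pd; apply: cod_mem; exact: chart_atP.
rewrite diff_row_sum//.
have -> : \sum_j gradient g f x 0 j *: partial j (f \o chart_inv (chart_at X x)) (chart_map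
  (chart_at X x) x)
   = gradient_norm2 g f x.
  rewrite /gradient_norm2 /quad_form {2}/gradient mulmxKV ?posdef_unit// mxE.
  by apply: eq_bigr => j _; rewrite !mxE mulrC.
rewrite -/(gram_at g x) ger0_norm ?gradient_norm2_ge0//.
rewrite /gradient_norm2 -(qnorm_sqr _ PG) expr2 => H.
have [q0|q0] := eqVneq (qnorm (gram_at g x) (gradient g f x)) 0; first by rewrite q0 mulr0 sqr_ge0.
rewrite ler_pM2r in H; last by rewrite lt_def q0 qnorm_ge0.
by rewrite -expr2 lerXn2r ?nnegrE ?qnorm_ge0.
Qed.

Lemma slope_cst x (a L : R) : 0 <= L -> slope (cst a) x L.
Proof.
move=> L0 w; rewrite (_ : cst a \o _ = cst a)// diff_cst/= normr0.
by rewrite mulr_ge0 ?qnorm_ge0.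
Qed.

Lemma slope_ext f h x L : {near x, f =1 h} -> slope f x L ->
  differentiable (f \o chart_inv (chart_at X x)) (chart_map (chart_at X x) x) -> slope h x L.
Proof.
move=> fh sf df w; have dx := chart_atP X x; set c := chart_at X x in dx sf df *.
have E : \forall v \near chart_map c x, (f \o chart_inv c) v = (h \o chart_inv c) v.
  have := chart_inv_continuous (cod_mem dx); rewrite /prop_for /continuous_at chart_mapK//.
  by move=> /(_ _ fh).
have dh := near_eq_differentiable E df.
rewrite (etrans (esym (deriveE w dh)) (etrans (esym (near_eq_derive w E)) (deriveE w df))).
exact: sf.
Qed.

(** Gluing costs only the derivative of the cutoff p times the gap between the two functions. *)
Lemma slope_glue (p f h : M -> R) x L A d U : msmooth U p -> msmooth U f -> msmooth U h -> U x ->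
  0 <= p x <= 1 -> slope f x L -> slope h x L -> slope p x A -> `|f x - h x| <= d -> 0 <= A ->
  slope (p * f + (cst 1 - p) * h) x (L + d * A).
Proof.
move=> sp sf sh Ux p01 Sf Sh Sp fh A0 w; have dx := chart_atP X x; set c := chart_at X x in dx *.
have dp := msmooth_diff sp Ux dx; have df := msmooth_diff sf Ux dx;
  have dh := msmooth_diff sh Ux dx.
have -> : (p * f + (cst 1 - p) * h) \o chart_inv c =
  (p \o chart_inv c) * (f \o chart_inv c) + (cst 1 - (p \o chart_inv c)) * (h \o chart_inv c) by [].
have e k : (k \o chart_inv c) (chart_map c x) = k x by rewrite /comp chart_mapK.
rewrite (diff_glue w dp df dh) !e.
by apply: glue_bound (Sf w) (Sh w) (Sp w) _ _ _ => //; exact: qnorm_ge0.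
Qed.

End ManifoldCalculus.

(** * Coordinate segments and chains *)

Section Chains.
Set Implicit Arguments.
Unset Strict Implicit.
Context {R : realType} {n : nat} {M : ptopologicalType}.
Variables (X : smooth_manifold R n M) (g : riemannian_metric X).
Implicit Types (c : chart X) (U O : set M) (x y : M).

Definition chart_center x : 'rV[R]_n := chart_map (chart_at X x) x.

(** On such a coordinate ball lengths may be computed with the constant metric at the center, up
to a factor 2; the bound on the volume density serves to estimate volumes of small balls from
below. *)
Definition adapted x r := 0 < r /\ forall v, `|v - chart_center x| < r ->
  [/\ chart_cod (chart_at X x) v,
   forall w, qnorm (gram g (chart_at X x) v) w <= 2 * qnorm (gram_at g x) w /\
             qnorm (gram_at g x) w <= 2 * qnorm (gram g (chart_at X x) v) w &
   \det (gram_at g x) / 2 <= \det (gram g (chart_at X x) v)].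

Definition chart_ball x r : set M :=
  chart_dom (chart_at X x) `&` [set y | `|chart_map (chart_at X x) y - chart_center x| < r].

Lemma gram_at_pd x : posdef (gram_at g x).
Proof. by apply: gram_pd; apply: cod_mem; exact: chart_atP. Qed.

Lemma chart_ball_center x r : 0 < r -> chart_ball x r x.
Proof. by move=> r0; split; [exact: chart_atP|rewrite /= subrr normr0]. Qed.

Lemma chart_ball_sub x r r' : r <= r' -> chart_ball x r `<=` chart_ball x r'.
Proof. by move=> rr y [dy yr]; split => //; exact: lt_le_trans rr. Qed.

Lemma chart_ball_open x r : open (chart_ball x r).
Proof.
rewrite openE => y [dy yr]; apply: filterI; first exact: dom_near.
have cy := chart_map_continuous dy.
suff : nbhs (chart_map (chart_at X x) y) [set v : 'rV[R]_n | `|v - chart_center x| < r] by move=>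
  /cy.
apply/nbhs_ballP; exists (r - `|chart_map (chart_at X x) y - chart_center x|);
  first by rewrite /= subr_gt0.
move=> v; rewrite -ball_normE /= distrC ltrBrDr => H; apply: le_lt_trans H.
by rewrite -[X in `|X|](subrKA (chart_map (chart_at X x) y)) ler_normD.
Qed.

(** The entries of the metric, hence its determinant, are continuous, and finitely many bounds on
entries suffice by [qnorm_compare]. *)
Lemma adapted_exists x O : open O -> O x -> exists2 r, adapted x r & chart_ball x r `<=` O.
Proof.
move=> oO Ox; set c := chart_at X x; have dx : chart_dom c x by exact: chart_atP.
have cv := cod_mem dx; have PG := gram_at_pd x.
have [A A0 AG] := qnorm_coord PG.
(* The tolerance required by qnorm_compare; n^2 is increased by 1 to allow n = 0. *)
pose e := 2^-1 / ((n%:R ^+ 2 + 1) * A ^+ 2) : R.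
have n0 : 0 <= n%:R ^+ 2 :> R by rewrite sqr_ge0.
have e0 : 0 < e by rewrite divr_gt0 ?invr_gt0// mulr_gt0 ?exprn_gt0// ltr_wpDl.
have cG i j : gram g c v i j @[v --> chart_center x] --> gram_at g x i j.
  by have := differentiable_continuous (@gram_smooth _ _ _ _ g c i j [::] (chart_center x) cv).
have N1 : \forall v \near chart_center x, chart_cod c v.
  by apply: open_nbhs_nbhs; split => //; exact: chart_cod_open.
have N2 : \forall v \near chart_center x, O (chart_inv c v).
  by apply: (chart_inv_continuous cv); rewrite chart_mapK//; exact: open_nbhs_nbhs.
have N3 : \forall v \near chart_center x, forall i j, `|gram g c v i j - gram_at g x i j| <= e.
  apply: (@filter_forall _ 'I_n (fun i v => forall j,
    `|gram g c v i j - gram_at g x i j| <= e) _ (nbhs_filter _)) => i.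
  apply: (@filter_forall _ 'I_n (fun j v => `|gram g c v i j - gram_at g x i j| <= e) _
    (nbhs_filter _)) => j.
  have := cG i j => /cvgrPdist_le/(_ _ e0); apply: filterS => v /=; by rewrite distrC.
have N4 : \forall v \near chart_center x, \det (gram_at g x) / 2 <= \det (gram g c v).
  have d0 := posdef_det PG.
  have /cvgrPdist_le/(_ (\det (gram_at g x) / 2)) := @det_continuous R n _ (fun v => gram g c v)
    (chart_center x) cG.
  rewrite divr_gt0// => /(_ isT); apply: filterS => v /=; rewrite -/(gram_at g x) ler_norml.
  by set a := \det (gram g c v); set b := \det _; lra.
have [r /= r0 H] : exists2 r, 0 < r & forall v, `|v - chart_center x| < r ->
  [/\ chart_cod c v, O (chart_inv c v),
   forall i j, `|gram g c v i j - gram_at g x i j| <= e & \det (gram_at g x) / 2 <= \det (gram g c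
     v)].
  have : \forall v \near chart_center x, [/\ chart_cod c v, O (chart_inv c v),
     forall i j, `|gram g c v i j - gram_at g x i j| <= e & \det (gram_at g x) / 2 <= \det (gram g
       c v)].
    near=> v; split.
    - by near: v.
    - by near: v.
    - by near: v.
    - by near: v.
  move=> /nbhs_normP [r r0 H]; exists r => // v vr; apply: H.
  by rewrite /= distrC.
exists r => [|y [dy yr]]; last by have [_] := H _ yr; rewrite chart_mapK.
split => // v /H [cvv _ Gv dv]; split => //.
have PGv : posdef (gram g c v) by exact: gram_pd.
apply: (qnorm_compare PG _ AG A0 Gv) => //.
have N1' : n%:R ^+ 2 + 1 != 0 :> R by rewrite gt_eqF// ltr_wpDl.
have -> : n%:R ^+ 2 * e * A ^+ 2 = 2^-1 * (n%:R ^+ 2 / (n%:R ^+ 2 + 1)).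
  have An0 : A != 0 by exact: lt0r_neq0 A0.
  rewrite /e; move: (n%:R ^+ 2 : R) N1' => N N1'; by field; rewrite An0 N1'.
rewrite -[leRHS]mulr1 ler_wpM2l// ler_pdivrMr ?mul1r ?lerDl//.
Unshelve. all: by end_near. Qed.

Definition segpt (v w : 'rV[R]_n) (t : R) := v + t *: (w - v).

(** A bound l for the speed of the affine parametrization by [0, 1], rather than the length
itself: it is inherited proportionally by any part of the segment. *)
Definition seg x y (l : R) := 0 < l /\ exists c, [/\ chart_dom c x, chart_dom c y &
  forall t, 0 <= t <= 1 ->
    chart_cod c (segpt (chart_map c x) (chart_map c y) t) /\
    qnorm (gram g c (segpt (chart_map c x) (chart_map c y) t)) (chart_map c y - chart_map c x) <=
      l].

Lemma seg_sym x y l : seg x y l -> seg y x l.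
Proof.
move=> [l0 [c [dx dy H]]]; split => //; exists c; split => // t /andP[t0 t1].
have E : segpt (chart_map c y) (chart_map c x) t = segpt (chart_map c x) (chart_map c y) (1 - t).
  by rewrite /segpt scalerBl scale1r scalerBr [in RHS]addrA [in RHS]addrC; apply/rowP => i;
    rewrite !mxE; ring.
rewrite E -qnormN opprB; apply: H; lra.
Qed.

Lemma seg_split x y l s : seg x y l -> 0 < s < 1 ->
  exists z, seg x z (s * l) /\ seg z y ((1 - s) * l).
Proof.
move=> [l0 [c [dx dy H]]] /andP[s0 s1].
set v := chart_map c x in H; set w := chart_map c y in H.
have [|cz _] := H s; first by rewrite !ltW.
have [dz zE] := chart_invK cz; exists (chart_inv c (segpt v w s)).
have s1' : 0 < 1 - s by rewrite subr_gt0.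
split; split; try exact: mulr_gt0; exists c; split => // t /andP[t0 t1]; rewrite zE -/v -/w.
  have -> : segpt v (segpt v w s) t = segpt v w (t * s) by apply/rowP => i; rewrite !mxE; ring.
  have -> : segpt v w s - v = s *: (w - v) by rewrite /segpt addrAC subrr add0r.
  have [|cv Hv] := H (t * s); first by rewrite mulr_ge0 ?(ltW s0)//= mulr_ile1 ?(ltW s0)// ltW.
  by split => //; rewrite qnormZ gtr0_norm// ler_pM2l.
have -> : segpt (segpt v w s) w t = segpt v w (s + t * (1 - s)) by apply/rowP => i; rewrite !mxE;
  ring.
have -> : w - segpt v w s = (1 - s) *: (w - v) by apply/rowP => i; rewrite !mxE; ring.
have [|cv Hv] := H (s + t * (1 - s)).
  have : 0 <= t * (1 - s) by rewrite mulr_ge0// ltW.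
  have : t * (1 - s) <= 1 - s by rewrite ler_piMl// ltW.
  by lra.
by split => //; rewrite qnormZ gtr0_norm// ler_pM2l.
Qed.

Lemma segpt_ball (z v w : 'rV[R]_n) t r : `|v - z| < r -> `|w - z| < r -> 0 <= t <= 1 ->
  `|segpt v w t - z| < r.
Proof.
move=> vr wr /andP[t0 t1].
have -> : segpt v w t - z = (1 - t) *: (v - z) + t *: (w - z) by apply/rowP => i; rewrite !mxE;
  ring.
apply: le_lt_trans (ler_normD _ _) _; rewrite !normrZ (ger0_norm t0) ger0_norm ?subr_ge0//.
have [->|tn0] := eqVneq t 0; first by rewrite subr0 mul1r mul0r addr0.
have t0' : 0 < t by rewrite lt_def tn0.
have -> : r = (1 - t) * r + t * r by ring.
by apply: ler_ltD; [rewrite ler_wpM2l ?subr_ge0// ltW|rewrite ltr_pM2l].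
Qed.

(** Coordinate balls are convex and norms vary by a factor at most 2 on an adapted one. *)
Lemma seg_adapted z r x y l : adapted z r -> chart_ball z r x -> chart_ball z r y -> 0 < l ->
  2 * qnorm (gram_at g z) (chart_map (chart_at X z) y - chart_map (chart_at X z) x) <= l ->
    seg x y l.
Proof.
move=> [r0 H] [dx xr] [dy yr] l0 Hl; split => //; exists (chart_at X z); split => // t t01.
have [cv Hv _] := H _ (segpt_ball xr yr t01); split => //.
by apply: le_trans Hl; have [] := Hv (chart_map (chart_at X z) y - chart_map (chart_at X z) x).
Qed.

Lemma seg_near x e : 0 < e -> \forall y \near x, seg x y e.
Proof.
move=> e0; have [r Ar _] := adapted_exists openT (x := x) I; have r0 := Ar.1.
have [b b0 Hb] := quad_bound (gram_at g x).
pose r' := Num.min r (e / (2 * b)).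
have r'0 : 0 < r' by rewrite lt_min r0 divr_gt0// mulr_gt0.
have : \forall y \near x, chart_ball x r' y.
  by apply: open_nbhs_nbhs; split; [exact: chart_ball_open|exact: chart_ball_center].
apply: filterS => y yr; apply: (seg_adapted Ar) => //.
- exact: chart_ball_center.
- by apply: chart_ball_sub yr; rewrite ge_min lexx.
case: yr => _ /= /ltW yr; apply: (@le_trans _ _ (2 * (b * r'))).
  by rewrite ler_pM2l//; apply: le_trans (Hb _) _; rewrite ler_pM2l.
have : r' <= e / (2 * b) by rewrite ge_min lexx orbT.
by rewrite ler_pdivlMr ?mulr_gt0//; lra.
Qed.

(** The substitute for curves: the last argument bounds the length of the chain, and since bounds
are added along concatenation, the triangle inequality is exact. *)
Inductive reach : M -> M -> R -> Prop :=
| reach1 x y l : seg x y l -> reach x y l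
| reachS x y z l l' : reach x y l -> seg y z l' -> reach x z (l + l').

Lemma reach_gt0 x y l : reach x y l -> 0 < l.
Proof. by elim => [? ? ? [] //|? ? ? k k' _ k0 [k0' _]]; exact: addr_gt0. Qed.

Lemma reach_trans x y z l l' : reach x y l -> reach y z l' -> reach x z (l + l').
Proof.
move=> xy yz; elim: yz xy => [a b k ab xa|a b e k k' _ IH be xa]; first exact: reachS ab.
by rewrite addrA; apply: reachS be; exact: IH.
Qed.

Lemma reach_sym x y l : reach x y l -> reach y x l.
Proof.
elim => [a b k ab|a b e k k' _ IH be]; first by apply: reach1; exact: seg_sym.
by rewrite addrC; apply: reach_trans IH; apply: reach1; exact: seg_sym.
Qed.

(** A coordinate segment can be cut in any proportion, so the cut point is found in one link of the
chain. For a general distance such a z need not exist; the proof of Hopf and Rinow rests on it. *)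
Lemma reach_split x y l a : reach x y l -> 0 < a < l -> exists z, reach x z a /\ reach z y (l - a).
Proof.
have S u v k s : seg u v k -> 0 < s < k -> exists z, seg u z s /\ seg z v (k - s).
  move=> uv /andP[s0 sk]; have k0 := uv.1.
  have [|z [z1 z2]] := @seg_split u v k (s / k) uv;
    first by rewrite divr_gt0//= ltr_pdivrMr// mul1r.
  have E : s / k * k = s by rewrite divfK// gt_eqF.
  exists z; split; first by rewrite -E.
  by rewrite (_ : k - s = (1 - s / k) * k)// mulrBl mul1r E.
move=> xy; elim: xy a => {x y l} [x y l xy|x y z l l' xy IH yz] a /andP[a0 al].
  by have [|z [z1 z2]] := S x y l a xy; [rewrite a0 al|exists z; split; exact: reach1].
have [al'|la|->] := ltgtP a l.
- have [|w [w1 w2]] := IH a; first by rewrite a0 al'.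
  by exists w; split => //; rewrite addrAC; apply: reachS yz.
- have [|w [w1 w2]] := S y z l' (a - l) yz; first by rewrite subr_gt0 la/= ltrBlDl.
  exists w; split; last by rewrite (_ : l + l' - a = l' - (a - l)); [exact: reach1|ring].
  have -> : a = l + (a - l) by ring.
  exact: reachS w1.
- by exists y; split => //; rewrite addrAC subrr add0r; exact: reach1.
Qed.

Definition chain_ball p r : set M := [set y | exists2 L, L < r & reach p y L].

Lemma chain_ball_center p r : 0 < r -> chain_ball p r p.
Proof.
move=> r0; exists (r / 2); first by lra.
by apply: reach1; apply: (nbhs_singleton (seg_near p _)); lra.
Qed.

Lemma chain_ball_open p r : open (chain_ball p r).
Proof.
rewrite openE => y [L Lr py].
have : 0 < (r - L) / 2 by lra.
move=> /(seg_near y); apply: filterS => z yz; exists (L + (r - L) / 2); first by lra.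
exact: reachS yz.
Qed.

Lemma chain_ball_sub p r r' : r <= r' -> chain_ball p r `<=` chain_ball p r'.
Proof. by move=> rr y [L Lr H]; exists L => //; exact: lt_le_trans rr. Qed.

Lemma chain_ball_trans p y r r' : chain_ball p r y -> chain_ball y r' `<=` chain_ball p (r + r').
Proof.
by move=> [L Lr py] z [L' Lr' yz]; exists (L + L'); [exact: ltrD|exact: reach_trans yz].
Qed.

Lemma chain_ball_sym p y r : chain_ball p r y -> chain_ball y r p.
Proof. by move=> [L Lr py]; exists L => //; exact: reach_sym. Qed.

End Chains.

(** * Integrals of nonnegative functions without measurability *)

Section NonMeasurableIntegrals.
Set Implicit Arguments.
Unset Strict Implicit.
Import HBNNSimple.
Local Open Scope ereal_scope.
Context d (T : measurableType d) (R : realType) (mu : {measure set T -> \bar R}).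

(** There is no evident reason for the speed of a curve to be measurable; but the integral of a
nonnegative function is a supremum over simple functions below it, and this alone gives
monotonicity and additivity over disjoint measurable sets. *)
Lemma ge0_integral_sup (D : set T) (f : T -> \bar R) : (forall x, D x -> 0 <= f x) ->
  \int[mu]_(x in D) f x = ereal_sup [set sintegral mu h |
     h in [set h : {nnsfun T >-> R} | forall x, (h x)%:E <= (f \_ D) x]].
Proof. by move=> f0; rewrite ge0_integralE. Qed.

Lemma ge0_integral_mono (D : set T) (f h : T -> \bar R) : (forall x, D x -> 0 <= f x) ->
  (forall x, D x -> f x <= h x) -> \int[mu]_(x in D) f x <= \int[mu]_(x in D) h x.
Proof.
move=> f0 fh; rewrite !ge0_integral_sup//; last by move=> x Dx; exact: le_trans (f0 _ Dx) (fh _ Dx).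
apply: le_ereal_sup => _ [k /= kf <-]; exists k => // x /=; apply: le_trans (kf x) _.
by rewrite /patch; case: ifPn => // /set_mem; exact: fh.
Qed.

Lemma ge0_integral_subset (A B : set T) (f : T -> \bar R) : A `<=` B -> (forall x, B x ->
  0 <= f x) ->
  \int[mu]_(x in A) f x <= \int[mu]_(x in B) f x.
Proof.
move=> AB f0; rewrite !ge0_integral_sup//; last by move=> x /AB; exact: f0.
apply: le_ereal_sup => _ [k /= kf <-]; exists k => // x /=; apply: le_trans (kf x) _.
rewrite /patch; case: ifPn => [/set_mem/AB/mem_set ->//|_].
by case: ifPn => // /set_mem /f0.
Qed.

(** Both sets contain 0, so that neither supremum is -oo and each can be bounded with the other
fixed. *)
Lemma ereal_sup_add_le (A B : set \bar R) c : A 0 -> B 0 ->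
  (forall a b, A a -> B b -> a + b <= c) -> ereal_sup A + ereal_sup B <= c.
Proof.
move=> A0 B0 H.
have c0 : 0 <= c by rewrite -(adde0 0) H.
case: c => [c| |] in H c0 *; [|by rewrite leey|by []].
have sA0 : 0 <= ereal_sup A by exact: ereal_sup_ubound.
have sB0 : 0 <= ereal_sup B by exact: ereal_sup_ubound.
have sA : ereal_sup A <= c%:E.
  by apply/ge_ereal_sup => a Aa; rewrite -[a]adde0; exact: H.
have sAf : ereal_sup A \is a fin_num by rewrite ge0_fin_numE// (le_lt_trans sA)// ltry.
have sB : ereal_sup B <= c%:E - ereal_sup A.
  apply/ge_ereal_sup => b Bb; rewrite leeBrDr//.
  have [bf|] := boolP (b \is a fin_num).
    rewrite addeC -leeBrDr//; apply/ge_ereal_sup => a Aa; rewrite leeBrDr//; exact: H.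
  rewrite fin_numE negb_and !negbK => /orP[/eqP->|/eqP bE]; first by rewrite addNye leNye.
  by have := H _ _ A0 Bb; rewrite bE add0e.
by rewrite addeC -leeBrDr.
Qed.

Lemma ge0_integral_superadd (A B : set T) (f : T -> \bar R) : [disjoint A & B] ->
  (forall x, (A `|` B) x -> 0 <= f x) ->
  \int[mu]_(x in A) f x + \int[mu]_(x in B) f x <= \int[mu]_(x in A `|` B) f x.
Proof.
move=> AB f0.
have fA x : A x -> 0 <= f x by move=> Ax; apply: f0; left.
have fB x : B x -> 0 <= f x by move=> Ax; apply: f0; right.
rewrite !ge0_integral_sup//; apply: ereal_sup_add_le.
- exists nnsfun0; last exact: sintegral0.
  by move=> x /=; rewrite /patch; case: ifPn => // /set_mem /fA.
- exists nnsfun0; last exact: sintegral0.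
  by move=> x /=; rewrite /patch; case: ifPn => // /set_mem /fB.
move=> _ _ [h hA <-] [k kB <-]; rewrite -sintegralD.
apply: ereal_sup_ubound; exists (add_nnsfun h k) => //= x /=.
have := hA x; have := kB x; rewrite /patch in_setU EFinD.
case: (boolP (x \in A)) => [/set_mem xA|nA]; case: (boolP (x \in B)) => [/set_mem xB|nB] /= H1 H2.
- by move/disj_setPS : AB => /(_ x (conj xA xB)).
- by rewrite -[leRHS]adde0; apply: leeD.
- by rewrite -[leRHS]add0e; apply: leeD.
- by rewrite -[leRHS]add0e; apply: leeD.
Qed.

Lemma ge0_integral_subadd (A B : set T) (f : T -> \bar R) : measurable A -> measurable B ->
  [disjoint A & B] ->
  (forall x, (A `|` B) x -> 0 <= f x) ->
  \int[mu]_(x in A `|` B) f x <= \int[mu]_(x in A) f x + \int[mu]_(x in B) f x.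
Proof.
move=> mA mB AB f0.
rewrite [leLHS]ge0_integral_sup//; apply/ge_ereal_sup => _ [h /= hf <-].
have h0 x : 0 <= (h x)%:E by rewrite lee_fin.
have hE : EFin \o h = (EFin \o h) \_ (A `|` B).
  apply/funext => x; rewrite /patch; case: ifPn => // nx /=.
  apply/eqP; rewrite eq_le h0 andbT; have := hf x; by rewrite /patch (negbTE nx).
rewrite -integralT_nnsfun -[X in integral _ _ X]/(EFin \o h) hE -integral_mkcond.
have mh : measurable_fun (A `|` B) h by exact: measurable_funTS.
have /measurable_EFinP mh' := mh.
rewrite (ge0_integral_setU _ mA mB mh')//; last by move=> x _; exact: h0.
apply: leeD; apply: ge0_integral_mono => x Dx; first exact: h0.
- by have := hf x; rewrite /patch mem_set//; left.
- exact: h0.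
- by have := hf x; rewrite /patch mem_set//; right.
Qed.

End NonMeasurableIntegrals.

Section CurveIntegrals.
Set Implicit Arguments.
Unset Strict Implicit.
Context {R : realType}.
Notation mu := (@lebesgue_measure R).

(** The derivative is continuous, so the fundamental theorem of calculus applies; the upper bound
s is only required inside the interval because the end points are negligible. *)
Lemma FTC_le (F : R -> R) (s : R -> R) (a b : R) : a < b ->
  (forall t, a <= t <= b -> derivable F t 1) ->
  (forall t, a <= t <= b -> {for t, continuous (derive1 F)}) ->
  (forall t, a < t < b -> `|derive1 F t| <= s t) ->
  (`|F b - F a|%:E <= \int[mu]_(t in `]a, b[) (s t)%:E)%E.
Proof.
move=> ab dF cF Fs.
have cF' : {within `[a, b], continuous (derive1 F)}.
  by apply: continuous_in_subspaceT => t; rewrite inE/= in_itv/=; exact: cF.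
have FF : (\int[mu]_(t in `[a, b]) (derive1 F t)%:E)%E = ((F b)%:E - (F a)%:E)%E.
  apply: (@continuous_FTC2 R (derive1 F) F a b ab cF') => //; split.
  - by move=> t /[!in_itv]/= /andP[at_ tb]; apply: dF; rewrite !ltW.
  - apply: cvg_at_right_filter; apply: differentiable_continuous; apply/derivable1_diffP; apply: dF.
    by rewrite lexx ltW.
  - apply: cvg_at_left_filter; apply: differentiable_continuous; apply/derivable1_diffP; apply: dF.
    by rewrite lexx ltW.
have mF : measurable_fun `[a, b] (EFin \o derive1 F).
  by apply/measurable_EFinP; apply: subspace_continuous_measurable_fun.
have mFo : measurable_fun `]a, b[ (fun t => `|(derive1 F t)%:E|)%E.
  apply: (@measurableT_comp _ _ _ _ _ _ (@abse R)) => //.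
  by apply: measurable_funS mF => //; exact: subset_itv_oo_cc.
have -> : (`|F b - F a|%:E = `|(F b)%:E - (F a)%:E|)%E by [].
have L := @le_abse_integral _ _ R mu `[a, b]%classic (EFin \o derive1 F) (measurable_itv _) mF.
rewrite -FF; apply: le_trans L _.
rewrite (integral_itv_bndoo _ _ mFo).
apply: ge0_integral_mono => t; rewrite //= in_itv/= => tab; rewrite lee_fin; exact: Fs.
Qed.

End CurveIntegrals.

(** * Bump functions on R^n *)

Section Bumps.
Set Implicit Arguments.
Unset Strict Implicit.
Context {R : realType} {n : nat}.

Definition sqdist (a v : 'rV[R]_n) : R := \sum_i (v 0 i - a 0 i) ^+ 2.

Lemma sqdist_ge a v : `|v - a| ^+ 2 <= sqdist a v.
Proof.
have s0 : 0 <= sqdist a v by apply: sumr_ge0 => i _; exact: sqr_ge0.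
rewrite -[leRHS]sqr_sqrtr// lerXn2r ?nnegrE ?sqrtr_ge0//.
rewrite [leLHS]/Num.Def.normr/= mx_normrE; apply: bigmax_le => [|[i j] _] /=;
  first exact: sqrtr_ge0.
rewrite -sqrtr_sqr ler_wsqrtr// /sqdist (bigD1 j)//= !mxE (ord1 i) lerDl.
by apply: sumr_ge0 => k _; exact: sqr_ge0.
Qed.

Lemma Ck_sqdist a k (U : set 'rV[R]_n) : open U -> Ck k U (sqdist a).
Proof.
move=> oU; have -> : sqdist a = \sum_i ((fun v : 'rV[R]_n => v 0 i) + cst (- a 0 i)) * ((fun v :
  'rV[R]_n => v 0 i) + cst (- a 0 i)).
  by apply/funext => v; rewrite fct_sumE; apply: eq_bigr => i _; rewrite expr2.
apply: Ck_sum => // i.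
by apply: CkM => //; apply: CkD => //;
  [exact: Ck_coord|exact: Ck_cst|exact: Ck_coord|exact: Ck_cst].
Qed.

(** A quotient of flat functions whose denominator never vanishes; squared Euclidean distance is
used because it is smooth, unlike the sup norm. *)
Definition bump_fun (a : 'rV[R]_n) (rho : R) (v : 'rV[R]_n) : R :=
  flat 0 (rho ^+ 2 - sqdist a v) / (flat 0 (rho ^+ 2 - sqdist a v) + flat 0 (sqdist a v - rho ^+ 2
    / 4)).

Lemma flat_gt0 (m : nat) (t : R) : 0 < t -> 0 < flat m t.
Proof. by move=> t0; rewrite /flat t0 mulr_gt0 ?expR_gt0// exprn_gt0// invr_gt0. Qed.

Lemma flat_eq0 (m : nat) (t : R) : t <= 0 -> flat m t = 0.
Proof. by move=> t0; rewrite /flat ltNge t0. Qed.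

Lemma bump_fun_den a rho v : 0 < rho ->
  0 < flat 0 (rho ^+ 2 - sqdist a v) + flat 0 (sqdist a v - rho ^+ 2 / 4).
Proof.
move=> r0; have r2 : 0 < rho ^+ 2 by rewrite exprn_gt0.
have [q|q] := ltP (sqdist a v) (rho ^+ 2).
  by rewrite ltr_pwDl ?flat_ge0// flat_gt0// subr_gt0.
by rewrite ltr_wpDl ?flat_ge0// flat_gt0// subr_gt0; lra.
Qed.

Lemma bump_fun_ge0 a rho v : 0 < rho -> 0 <= bump_fun a rho v <= 1.
Proof.
move=> r0; have d0 := bump_fun_den a v r0.
rewrite /bump_fun divr_ge0 ?flat_ge0 ?(ltW d0)//= ler_pdivrMr// mul1r lerDl; exact: flat_ge0.
Qed.

Lemma bump_fun_eq0 a rho v : 0 < rho -> rho <= `|v - a| -> bump_fun a rho v = 0.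
Proof.
move=> r0 rv; rewrite /bump_fun flat_eq0 ?mul0r// subr_le0.
by apply: le_trans (sqdist_ge a v); rewrite lerXn2r ?nnegrE// ltW.
Qed.

Lemma bump_fun_eq1 a rho v : 0 < rho -> sqdist a v <= rho ^+ 2 / 4 -> bump_fun a rho v = 1.
Proof.
move=> r0 rv; have d0 := bump_fun_den a v r0; rewrite /bump_fun in d0 *.
by rewrite (flat_eq0 _ (t := sqdist a v - _)) ?subr_le0// addr0 in d0 *; rewrite divff// gt_eqF.
Qed.

Lemma Ck_bump_fun a rho k : 0 < rho -> Ck k setT (bump_fun a rho).
Proof.
move=> r0; have oT := @openT 'rV[R]_n.
have C1 : Ck k setT (flat 0 \o (cst (rho ^+ 2) + cst (-1) * sqdist a)).
  apply: Ck_flat => //; apply: CkD => //; first exact: Ck_cst.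
  by apply: CkM => //; [exact: Ck_cst|exact: Ck_sqdist].
have C2 : Ck k setT (flat 0 \o (sqdist a + cst (- (rho ^+ 2 / 4)))).
  by apply: Ck_flat => //; apply: CkD => //; [exact: Ck_sqdist|exact: Ck_cst].
have -> : bump_fun a rho = (flat 0 \o (cst (rho ^+ 2) + cst (-1) * sqdist a)) *
   (GRing.inv \o ((flat 0 \o (cst (rho ^+ 2) + cst (-1) * sqdist a)) + (flat 0 \o (sqdist a + cst
     (- (rho ^+ 2 / 4)))))).
  by apply/funext => v; rewrite /bump_fun !fctE /= mulN1r.
apply: CkM => //; apply: Ck_inv => //; last exact: CkD.
by move=> v _; rewrite !fctE /= mulN1r gt_eqF// bump_fun_den.
Qed.

Definition box (a : 'rV[R]_n) (rho : R) : set 'rV[R]_n := [set v | `|v - a| <= rho].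

Lemma box_compact a rho : 0 <= rho -> compact (box a rho).
Proof.
move=> r0; have := @rV_compact R n (fun i => `[a 0 i - rho,
  a 0 i + rho]%classic) (fun i => @segment_compact _ _ _).
suff -> : box a rho = [set v : 'rV[R]_n | forall i, `[a 0 i - rho,
  a 0 i + rho]%classic (v 0 i)] by [].
apply/seteqP; split => v /= H.
  move=> i; have := le_trans (coord_le_norm (v - a) i) H.
  by rewrite /= in_itv/= !mxE ler_norml; lra.
rewrite /box /= [leLHS]/Num.Def.normr/= mx_normrE; apply: bigmax_le => // -[i j] _ /=.
by rewrite (ord1 i) !mxE; have := H j; rewrite /= in_itv/= ler_norml; lra.
Qed.

Lemma compact_sup_bound (K : set 'rV[R]_n) (f : 'rV[R]_n -> R) : compact K -> continuous f ->
  exists2 B, 0 <= B & forall v, K v -> `|f v| <= B.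
Proof.
move=> cK cf; have [->|/set0P K0] := eqVneq K set0; first by exists 0.
have [c Kc H] := @compact_EVT_max _ R (fun v => `|f v|) K K0 cK
  (continuous_subspaceT (fun v => continuous_comp (cf v) (@norm_continuous _ _ _))).
by exists `|f c| => // v Kv; apply: H; rewrite ?inE.
Qed.

End Bumps.

(** * Bump functions on a manifold *)

Section ManifoldBumps.
Set Implicit Arguments.
Unset Strict Implicit.
Context {R : realType} {n : nat} {M : ptopologicalType}.
Variables (X : smooth_manifold R n M) (g : riemannian_metric X).
Implicit Types (c : chart X) (U O : set M) (x y : M).

(** Near the point the chart and its inverse cancel. *)
Lemma chart_diff c (F : 'rV[R]_n -> R) x : chart_dom c x -> differentiable F (chart_map c x) ->
  differentiable ((F \o chart_map c) \o chart_inv c) (chart_map c x) /\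
  'd ((F \o chart_map c) \o chart_inv c) (chart_map c x) = 'd F (chart_map c x) :> (_ -> _).
Proof.
move=> dx dF.
have E : \forall v \near chart_map c x, F v = ((F \o chart_map c) \o chart_inv c) v.
  have : \forall v \near chart_map c x, chart_cod c v.
    by apply: open_nbhs_nbhs; split; [exact: chart_cod_open|exact: cod_mem].
  by apply: filterS => v /chart_invK[_ /= ->].
have dF' := near_eq_differentiable E dF; split; first exact: dF'.
apply/funext => w.
apply: (etrans (esym (deriveE w dF'))).
by apply: (etrans (esym (near_eq_derive w E))); exact: deriveE.
Qed.

(** Passing from the constant metric at the center of an adapted ball to the metric at x costs a
factor 2. *)
Lemma slope_chart z r (F : 'rV[R]_n -> R) x k : 0 <= k -> adapted g z r -> chart_ball X z r x ->
  differentiable F (chart_map (chart_at X z) x) ->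
  (forall w, `|'d F (chart_map (chart_at X z) x) w| <= k * qnorm (gram_at g z) w) ->
  slope g (F \o chart_map (chart_at X z)) x (2 * k).
Proof.
move=> k0 [_ Az] [dx xr] dF Fk; have [dF' E] := chart_diff dx dF.
apply: (slope_transition (chart_atP X x) dx dF') => w; rewrite E.
have [_ /(_ w)[_ H] _] := Az _ xr.
by apply: le_trans (Fk w) _; rewrite (mulrC 2) -mulrA ler_wpM2l.
Qed.

(** A directional derivative is a limit of difference quotients, each of which obeys the Lipschitz
bound. *)
Lemma lipschitz_diff (F : 'rV[R]_n -> R) (G : 'M[R]_n) v (k : R) : differentiable F v ->
  (forall u u', `|F u - F u'| <= k * qnorm G (u - u')) -> forall w, `|'d F v w| <= k * qnorm G w.
Proof.
move=> dF Fk w; rewrite -(deriveE w dF).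
have C : (fun h => h^-1 *: ((F \o shift v) (h *: w) - F v)) @ 0^' --> 'D_w F v := @diff_derivable
  _ _ _ F v w dF.
apply: (cvgr_to_le (cvg_norm C)); near=> h.
have h0 : h != 0 by near: h; exact: nbhs_dnbhs_neq.
rewrite normrM normfV ler_pdivrMl ?normr_gt0//; apply: le_trans (Fk _ _) _.
by rewrite /= addrK qnormZ mulrCA.
Unshelve. all: by end_near. Qed.

Hypothesis hM : hausdorff_space M.

Lemma chart_box_compact x r rho : adapted g x r -> 0 <= rho < r ->
  compact (chart_inv (chart_at X x) @` box (chart_center X x) rho).
Proof.
move=> [r0 Ax] /andP[rho0 rhor]; apply: continuous_compact; last exact: box_compact.
apply: continuous_in_subspaceT => v /set_mem bv; apply: chart_inv_continuous.
by have [] := Ax v (le_lt_trans bv rhor).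
Qed.

Lemma chart_box_sub x r rho : adapted g x r -> 0 <= rho < r ->
  chart_inv (chart_at X x) @` box (chart_center X x) rho `<=` chart_ball X x r.
Proof.
move=> [r0 Ax] /andP[rho0 rhor] _ [v bv <-].
have vr := le_lt_trans bv rhor; have [cv _ _] := Ax v vr.
by have [dv vE] := chart_invK cv; split; rewrite //= vE.
Qed.

(** A bump function in coordinates, extended by 0. The extension is smooth because the coordinate
box supporting it is compact, hence closed in M; the bound A exists because partial derivatives
are bounded on that box. *)
Lemma manifold_bump x r : adapted g x r -> exists phi : M -> R, exists2 A, 0 <= A &
  [/\ msmooth X setT phi, forall y, 0 <= phi y <= 1, forall y, slope g phi y A,
      \forall y \near x, phi y = 1 &
      exists K, [/\ compact K, K `<=` chart_ball X x r & forall y, ~ K y -> phi y = 0]].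
Proof.
move=> Ax; have [r0 Ar] := Ax; set c := chart_at X x; pose rho := r / 2.
have rho0 : 0 < rho by rewrite divr_gt0.
have rhor : 0 <= rho < r by rewrite ltW//= /rho; lra.
pose b := bump_fun (chart_center X x) rho.
pose K := chart_inv c @` box (chart_center X x) rho.
have cK : compact K := chart_box_compact Ax rhor.
have KB : K `<=` chart_ball X x r := chart_box_sub Ax rhor.
have oK : open (~` K) by apply: closed_openC; exact: compact_closed.
pose phi y := if pselect (chart_dom c y) then b (chart_map c y) else 0.
have phiK y : ~ K y -> phi y = 0.
  rewrite /phi; case: pselect => // dy nK; apply: bump_fun_eq0 => //.
  rewrite leNgt; apply/negP => H; apply: nK; exists (chart_map c y); last exact: chart_mapK.
  exact: ltW.
have phiB y : chart_dom c y -> phi y = b (chart_map c y) by rewrite /phi; case: pselect.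
have CB k : Ck k setT b by exact: Ck_bump_fun.
have db v : differentiable b v by exact: (Ck_diff (CB 0%N)).
have smB : msmooth X (chart_ball X x r) phi.
  apply: (@msmooth_ext _ _ _ X (chart_ball X x r) (b \o chart_map c)); first exact: chart_ball_open.
    by move=> y /set_mem[dy _] /=; rewrite phiB.
  apply: msmooth_chart; [exact: chart_ball_open|by move=> y []|move=> k].
  exact: (Ck_sub (W := setT)).
have sm : msmooth X setT phi.
  apply: msmooth_local => y _; have [Ky|nKy] := pselect (K y).
    by exists (chart_ball X x r) => //; exact: KB.
  exists (~` K) => //; apply: (@msmooth_ext _ _ _ X _ (cst 0)) => //.
    by move=> z /set_mem nK; rewrite phiK.
  exact: msmooth_cst.
have [Bd Bd0 HB] : exists2 B, 0 <= B & forall v w, box (chart_center X x) rho v ->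
  `|'d b v w| <= B * `|w|.
  have H i : exists2 B, 0 <= B & forall v, box (chart_center X x) rho v -> `|partial i b v| <= B.
    apply: (@compact_sup_bound R n (box (chart_center X x) rho) (partial i b));
      first by apply: box_compact; exact: ltW.
    move=> v; apply: differentiable_continuous.
    by have [_ H] := CB 1%N; have [H' _] := H i; exact: H'.
  have /choice[B HB] : forall i, exists B, 0 <= B /\ forall v, box (chart_center X x) rho v ->
    `|partial i b v| <= B.
    by move=> i; have [B B0 HB] := H i; exists B.
  exists (\sum_i B i) => [|v w bv]; first by apply: sumr_ge0 => i _; have [] := HB i.
  rewrite (diff_row_sum w (db v)) mulr_suml; apply: le_trans (ler_norm_sum _ _ _) _.
  apply: ler_sum => i _; rewrite normrM mulrC.
  by apply: ler_pM => //; [have [_] := HB i; exact|exact: coord_le_norm].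
have [A1 A10 HA1] := qnorm_coord (gram_at_pd g x).
exists phi; exists (2 * (Bd * A1)); first by rewrite mulr_ge0// mulr_ge0// ltW.
have A0 : 0 <= Bd * A1 by rewrite mulr_ge0// ltW.
split => //.
- move=> y; rewrite /phi; case: pselect => ?; first exact: bump_fun_ge0.
  by rewrite lexx ler01.
- move=> y; have [Ky|nKy] := pselect (K y).
    have By := KB _ Ky; have [dy yr] := By.
    have S : slope g (b \o chart_map c) y (2 * (Bd * A1)).
      apply: (slope_chart A0 Ax By (db _)) => w.
      apply: le_trans (HB _ w _) _; last by rewrite -mulrA ler_wpM2l.
      case: Ky => v bv <-; have [_ rr] := andP rhor; have [cv _ _] := Ar v (le_lt_trans bv rr).
      by have [_ ->] := chart_invK cv.
    apply: (slope_ext _ S).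
      apply: filterS (dom_near dy) => z dz; by rewrite /= phiB.
    apply: (diff_transition (chart_atP X y) dy _).1.
    exact: (chart_diff dy (db _)).1.
  apply: (@slope_ext _ _ _ X g (cst 0)).
  + have : \forall z \near y, ~ K z by apply: open_nbhs_nbhs.
    by apply: filterS => z nK; rewrite phiK.
  + apply: slope_cst; exact: mulr_ge0.
  + exact: differentiable_cst.
- have N1 : \forall v \near chart_center X x, sqdist (chart_center X x) v <= rho ^+ 2 / 4.
    have c0 : {for chart_center X x, continuous (sqdist (chart_center X x))}.
      apply: differentiable_continuous.
      exact: (Ck_diff (@Ck_sqdist R n (chart_center X x) 0%N setT openT)).
    have s0 : sqdist (chart_center X x) (chart_center X x) = 0 by apply: big1 => i _;
      rewrite subrr expr0n.
    have : sqdist (chart_center X x) (chart_center X x) < rho ^+ 2 / 4 by rewrite s0 divr_gt0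
      ?exprn_gt0.
    by move=> H; apply: filterS (cvgr_lt _ c0 _ H) => v /ltW.
  have dx := chart_atP X x.
  have : \forall y \near x, chart_dom c y /\ sqdist (chart_center X x) (chart_map c y) <= rho ^+ 2
    / 4.
    by apply: filterI; [exact: dom_near|exact: (chart_map_continuous dx N1)].
  by apply: filterS => y [dy H]; rewrite phiB//; exact: bump_fun_eq1.
- by exists K.
Qed.

End ManifoldBumps.

(** * Smooth functions along curves *)

Section CurveLemmas.
Set Implicit Arguments.
Unset Strict Implicit.
Context {R : realType} {n : nat} {M : ptopologicalType}.
Variables (X : smooth_manifold R n M) (g : riemannian_metric X).
Implicit Types (c : chart X) (U O : set M) (x y : M).
Notation mu := (@lebesgue_measure R).

(** In the chart at sig t, f \o sig is a smooth function composed with a C^1 curve near t. *)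
Lemma curve_derivable (f : M -> R) (sig : R -> M) (t : R) :
  msmooth X setT f -> C1_curve_at X sig t ->
  [/\ derivable (f \o sig) t 1, {for t, continuous (derive1 (f \o sig))} &
      derive1 (f \o sig) t =
      'd (f \o chart_inv (chart_at X (sig t))) (chart_map (chart_at X (sig t)) (sig t)) (velocity
        X sig t)].
Proof.
set c := chart_at X (sig t); rewrite /C1_curve_at -/c /=; set u := chart_map c \o sig.
move=> sf [cs du cu']; pose F := f \o chart_inv c.
have dt : chart_dom c (sig t) by exact: chart_atP.
have Nd : \forall s \near t, chart_dom c (sig s) by exact: cs (dom_near dt).
have dF s : chart_dom c (sig s) -> differentiable F (u s) by move=> ds; exact: msmooth_diff sf I ds.
have NF : \forall s \near t, {near s, F \o u =1 f \o sig}.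
  have := near_join Nd; apply: filterS => s; apply: filterS => s' ds' /=.
  by rewrite /F /u /= chart_mapK.
have N : \forall s \near t, derivable (f \o sig) s 1 /\ derive1 (f \o sig) s = \sum_j (derive1 u
  s) 0 j * partial j F (u s).
  near=> s.
  have ds : chart_dom c (sig s) by near: s.
  have dus : derivable u s 1 by near: s.
  have NFs : {near s, F \o u =1 f \o sig} by near: s.
  have du1 : differentiable u s by apply/derivable1_diffP.
  have dFu : differentiable (F \o u) s by apply: differentiable_comp => //; exact: dF.
  have dfs : differentiable (f \o sig) s := near_eq_differentiable NFs dFu.
  split; first exact/derivable1_diffP.
  rewrite derive1E -(@near_eq_derive _ _ _ _ _ s 1 NFs) (deriveE _ dFu) (@diff_compE _ _ _ _ u F s
    1 du1 (dF _ ds)).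
  by rewrite -(deriveE _ du1) -derive1E (diff_row_sum _ (dF _ ds)).
have [dft E] := nbhs_singleton N.
split; [exact: dft| |by rewrite E /velocity -/c -/u (diff_row_sum _ (dF _ dt))].
rewrite /prop_for /continuous_at E.
apply: cvg_trans (_ : (fun s => \sum_j (derive1 u s) 0 j * partial j F (u s)) @ t --> _).
  by apply: near_eq_cvg; apply: filterS N => s [_ ->].
apply: (@cvgr_sum R _ t _ (index_enum 'I_n) (fun j s => (derive1 u s) 0 j * partial j F (u s))) =>
  j.
have dut : differentiable u t by apply/derivable1_diffP; exact: nbhs_singleton du.
apply: cvgM.
  apply: (@cvg_comp _ _ _ (derive1 u) (fun v => v 0 j : R) _ _ _ cu').
  exact: coord_continuous.
apply: (@cvg_comp _ _ _ u (partial j F) _ _ _ (differentiable_continuous dut)).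
apply: differentiable_continuous.
apply: (sf c [:: j]); exists (sig t) => //.
Unshelve. all: by end_near. Qed.

Lemma speed_ge0 (gam : R -> M) t : 0 <= speed g gam t.
Proof. exact: sqrtr_ge0. Qed.

Lemma curve_slope (f : M -> R) (sig : R -> M) (t : R) :
  msmooth X setT f -> (forall x, slope g f x 1) -> C1_curve_at X sig t ->
  `|derive1 (f \o sig) t| <= speed g sig t.
Proof.
move=> sf Sf Cs; have [_ _ ->] := curve_derivable sf Cs.
by apply: le_trans (Sf _ _) _; rewrite mul1r.
Qed.

(** Both the base point and the velocity depend on the curve near t only. *)
Lemma speed_near (gam sig : R -> M) t : {near t, gam =1 sig} -> speed g gam t = speed g sig t.
Proof.
move=> E; have e := nbhs_singleton E; rewrite /speed /velocity e.
suff -> : derive1 (chart_map (chart_at X (sig t)) \o gam) t = derive1 (chart_map (chart_at X (sig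
  t)) \o sig) t by [].
rewrite !derive1E; apply: near_eq_derive; apply: filterS E => s /= ->.
by [].
Qed.

(** The subdivision condition in [piecewise_C1], freed from the interval [0, 1] for inductions on
the list of break points. *)
Definition pieces (gam : R -> M) (a : R) (s : seq R) :=
  forall j, (j < size s)%N -> exists sigma : R -> M,
      forall t, nth 0 (a :: s) j <= t <= nth 0 s j -> C1_curve_at X sigma t /\ gam t = sigma t.

Lemma pieces_cons gam a b s : pieces gam a (b :: s) ->
  (exists sigma : R -> M, forall t, a <= t <= b ->
    C1_curve_at X sigma t /\ gam t = sigma t) /\ pieces gam b s.
Proof. by move=> H; split; [exact: (H 0%N)|move=> j js; exact: (H j.+1)]. Qed.

Lemma path_last_le (a : R) s : path <%R a s -> a <= last a s.
Proof. by elim: s a => [|b s IH] a //= /andP[ab /IH]; apply: le_trans; exact: ltW. Qed.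

(** On each piece this is the fundamental theorem of calculus and |df(v)| <= |v|; pieces add up by
superadditivity of the integral. *)
Lemma curve_variation (f : M -> R) (gam : R -> M) a s :
  msmooth X setT f -> (forall x, slope g f x 1) -> path <%R a s -> pieces gam a s ->
  (`|f (gam (last a s)) - f (gam a)|%:E <= \int[mu]_(t in `]a, (last a s)]) (speed g gam t)%:E)%E.
Proof.
move=> sf Sf; elim: s a => [|b s IH] a /=.
  by move=> _ _; rewrite subrr normr0 integral_ge0// => t _; rewrite lee_fin speed_ge0.
move=> /andP[ab ps] /pieces_cons[[sig Hs] P].
have bl := path_last_le ps.
have -> : `]a, (last b s)]%classic = `]a, b]%classic `|` `]b, (last b s)]%classic.
  by rewrite -itv_bndbnd_setU// bnd_simp// ltW.
apply: le_trans (ge0_integral_superadd _ _ _); last 2 first.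
- apply/disj_setPS => t [] /=; rewrite !in_itv/= => /andP[_ tb] /andP[bt _].
  by move: (le_lt_trans tb bt); rewrite ltxx.
- by move=> t _; rewrite lee_fin speed_ge0.
apply: (@le_trans _ _ (`|f (gam b) - f (gam a)|%:E + `|f (gam (last b s)) - f (gam b)|%:E)%E).
  rewrite -EFinD lee_fin; apply: le_trans (ler_normD _ _).
  by rewrite [in leRHS]addrC addrA subrK.
apply: leeD; last exact: IH.
have Ea : gam a = sig a by have [] := Hs a; rewrite ?lexx ?ltW.
have Eb : gam b = sig b by have [] := Hs b; rewrite ?lexx ?ltW.
rewrite Ea Eb.
apply: (@le_trans _ _ (\int[mu]_(t in `]a, b[) (speed g gam t)%:E)%E); last first.
  apply: ge0_integral_subset => [t|t _]; last by rewrite lee_fin speed_ge0.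
  by rewrite /= !in_itv/= => /andP[-> /ltW].
apply: (@FTC_le R (f \o sig)) => // t tab.
- have [Cs _] := Hs t tab; by have [] := curve_derivable sf Cs.
- have [Cs _] := Hs t tab; by have [] := curve_derivable sf Cs.
- have tab' : a <= t <= b by case/andP: tab => ? ?; rewrite !ltW.
  have [Cs _] := Hs t tab'; rewrite (@speed_near gam sig); first exact: curve_slope.
  have : \forall s \near t, a < s < b.
    have : `]a, b[%classic t by rewrite /= in_itv.
    by move=> H; have := open_nbhs_nbhs (conj (@interval_open _ (BRight a) (BLeft b) isT isT) H);
      apply: filterS => z; rewrite /= in_itv.
  apply: filterS => z /andP[az zb]; apply: (proj2 (Hs z _)); by rewrite !ltW.
Qed.

Lemma curve_le (f : M -> R) (gam : R -> M) :
  msmooth X setT f -> (forall x, slope g f x 1) -> piecewise_C1 X gam ->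
  (`|f (gam 1) - f (gam 0)|%:E <= curve_length g gam)%E.
Proof.
move=> sf Sf [s [ps ls P]]; have := curve_variation sf Sf ps P; rewrite ls => /le_trans; apply.
apply: ge0_integral_subset => [t|t _]; last by rewrite lee_fin speed_ge0.
by rewrite /= !in_itv/= => /andP[/ltW -> ->].
Qed.

Lemma dist_ge_smooth (f : M -> R) x y :
  msmooth X setT f -> (forall x, slope g f x 1) -> (`|f y - f x|%:E <= riemannian_dist g x y)%E.
Proof.
move=> sf Sf; apply: le_ereal_inf_tmp => _ [gam [P g0 g1] <-].
by have := curve_le sf Sf P; rewrite g0 g1.
Qed.

Lemma slope_scale (f : M -> R) x a L : msmooth X setT f -> slope g f x L ->
  slope g (cst a * f) x (`|a| * L).
Proof.
move=> sf Sf w; have df := msmooth_diff sf I (chart_atP X x).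
have -> : (cst a * f) \o chart_inv (chart_at X x) = a *: (f \o chart_inv (chart_at X x)) by [].
have -> := congr1 (fun k => k w) (diffZ a df).
by rewrite /= normrM -mulrA ler_wpM2l.
Qed.

Hypothesis hM : hausdorff_space M.

(** A bump function at x with support in U, divided by a bound for its gradient, is 1-Lipschitz: a
point too close to x to lose the value of the bump lies in its support. *)
Lemma dist_nbhs x U : open U -> U x ->
  exists2 e, 0 < e & forall y, (riemannian_dist g y x < e%:E)%E -> U y.
Proof.
move=> oU Ux; have [r Ar rU] := adapted_exists g oU Ux.
have [phi [A A0 [sp p01 Sp p1 [K [cK KB K0]]]]] := manifold_bump hM Ar.
have A1 : 0 < A + 1 by rewrite ltr_wpDl.
have a0 : 0 < (A + 1)^-1 by rewrite invr_gt0.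
exists (A + 1)^-1 => // y yx.
have sf : msmooth X setT (cst (A + 1)^-1 * phi).
  by apply: msmoothM; [exact: openT|exact: msmooth_cst|].
have Sf z : slope g (cst (A + 1)^-1 * phi) z 1.
  have S := slope_scale (A + 1)^-1 sp (Sp z); move=> w; apply: le_trans (S w) _.
  rewrite ler_wpM2r ?qnorm_ge0// gtr0_norm// mulrC ler_pdivrMr// mul1r; lra.
have := le_lt_trans (dist_ge_smooth y x sf Sf) yx; rewrite lte_fin !fctE (nbhs_singleton p1) mulr1.
have [Ky _|nKy] := pselect (K y); first by apply: rU; exact: KB.
by rewrite (K0 _ nKy) mulr0 subr0 gtr0_norm// ltxx.
Qed.

End CurveLemmas.

(** * Prolonging a curve by coordinate segments *)

Section Extend.
Set Implicit Arguments.
Unset Strict Implicit.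
Context {R : realType} {n : nat} {M : ptopologicalType}.
Variables (X : smooth_manifold R n M) (g : riemannian_metric X).
Implicit Types (c : chart X) (U O : set M) (x y : M).
Notation mu := (@lebesgue_measure R).

(** A coordinate segment, parametrized affinely by [t0, t1]. It is C^1 on a neighborhood of that
interval because the codomain of a chart is open. *)
Lemma seg_curve x y l (t0 t1 : R) : seg g x y l -> t0 < t1 ->
  exists kap : R -> M, [/\ kap t0 = x, kap t1 = y &
    forall t, t0 <= t <= t1 -> C1_curve_at X kap t /\ speed g kap t <= l / (t1 - t0)].
Proof.
move=> [l0 [c [dx dy H]]] t01; set v := chart_map c x in H; set w := chart_map c y in H.
have d0 : 0 < t1 - t0 by rewrite subr_gt0.
pose q := (t1 - t0)^-1; have q0 : 0 < q by rewrite invr_gt0.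
pose P (t : R) : 'rV[R]_n := segpt v w ((t - t0) * q).
have P0 : P t0 = v by rewrite /P subrr mul0r /segpt scale0r addr0.
have P1 : P t1 = w by rewrite /P /q divff ?gt_eqF// /segpt scale1r addrC subrK.
have dP t : is_diff t P (fun h => (h * q) *: (w - v)).
  have -> : P = cst v + (fun s : R => (s * q) *: (w - v)) - cst ((t0 * q) *: (w - v)).
    by apply/funext => s; rewrite /P /segpt !fctE mulrBl scalerBl addrA.
  have L : linear (fun s : R => (s * q) *: (w - v)).
    by move=> a b b'; rewrite scalerA -scalerDl mulrDl mulrA.
  pose lin := HB.pack_for {linear R ->
    'rV[R]_n} (fun s : R => (s * q) *: (w - v)) (@GRing.isLinear.Build _ _ _ _ _ L).
  have cl : continuous lin.
    move=> s; apply: (@cvgZr_tmp _ _ _ _ _ (fun s : R => s * q)).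
    by apply: cvgM; [exact: cvg_id|exact: cvg_cst].
  have il : is_diff t lin lin by apply: DiffDef; [exact: linear_differentiable|exact: diff_lin].
  have := is_diffB (is_diffD (is_diff_cst v t) il) (is_diff_cst ((t0 * q) *: (w - v)) t).
  by move=> D; apply: (is_diff_eq D); apply/funext => s; rewrite !fctE subr0 add0r.
have Pcod t : t0 <= t <= t1 -> chart_cod c (P t) /\ qnorm (gram g c (P t)) (w - v) <= l.
  move=> /andP[a b]; apply: H.
  by rewrite mulr_ge0 ?subr_ge0 ?(ltW q0)//= /q ler_pdivrMr// mul1r lerD2r.
exists (chart_inv c \o P); split.
- by rewrite /= P0 chart_mapK.
- by rewrite /= P1 chart_mapK.
move=> t tt; have [cP HP] := Pcod t tt; have [dom_t mapE] := chart_invK cP.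
set c' := chart_at X ((chart_inv c \o P) t).
have dom_t' : chart_dom c' (chart_inv c (P t)) by exact: chart_atP.
pose T : 'rV[R]_n -> 'rV[R]_n := chart_map c' \o chart_inv c.
pose U := chart_map c @` (chart_dom c `&` chart_dom c').
have oU : open U by apply: image_open; exact: chart_dom_open.
have CT k : Ck k U T by move: k; apply/smooth_onP; exact: transition_smooth.
have PU : U (P t) by exists (chart_inv c (P t)).
have cPt s : {for s, continuous P} by apply: differentiable_continuous; apply: ex_diff.
have NU : \forall s \near t, U (P s) by apply: (cPt t); exact: open_nbhs_nbhs.
have Du s : U (P s) -> differentiable (T \o P) s /\ derive1 (T \o P) s = 'd T (P s) (q *: (w - v)).
  move=> Us; have dT := Ck_diff (CT 0%N) Us.
  have dPs : differentiable P s by apply: ex_diff.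
  have dTP : differentiable (T \o P) s by exact: differentiable_comp.
  split => //; rewrite derive1E (deriveE _ dTP) (@diff_compE _ _ _ _ P T s 1 dPs dT).
  by rewrite (@diff_val _ _ _ _ _ _ _ (dP s)) mul1r.
have [_ E] := Du _ PU.
split.
  rewrite /C1_curve_at -/c' compA -/T; split.
  - by apply: continuous_comp => //; exact: chart_inv_continuous.
  - by apply: filterS NU => s /Du[D _]; apply/derivable1_diffP.
  - rewrite /prop_for /continuous_at E.
    pose F2 : 'rV[R]_n -> 'rV[R]_n := \sum_(j < n) ((q *: (w - v)) 0 j *: partial j T).
    have F2E s : U (P s) -> 'd T (P s) (q *: (w - v)) = F2 (P s).
      move=> Us; rewrite (diff_row_sum _ (Ck_diff (CT 0%N) Us)) /F2 fct_sumE.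
      by apply: eq_bigr.
    rewrite (F2E _ PU); apply: cvg_trans (_ : (F2 \o P) @ t --> _).
      by apply: near_eq_cvg; apply: filterS NU => s Us /=; rewrite (Du _ Us).2 F2E.
    apply: (@continuous_comp _ _ _ P F2) => //; apply: differentiable_continuous.
    apply: differentiable_sum => j; apply: differentiableZ.
    by have [_ /(_ j) Hj] := CT 1%N; have [Hj' _] := Hj; exact: Hj'.
rewrite /speed /velocity -/c' compA -/T E.
have -> : Num.sqrt (quad_form (gram_at g ((chart_inv c \o P) t)) ('d T (P t) (q *: (w - v)))) =
   qnorm (gram g c' (chart_map c' (chart_inv c (P t)))) ('d T (P t) (q *: (w - v))) by [].
have := @qnorm_transition R n M X g c c' (chart_inv c (P t)) (q *: (w - v)) dom_t dom_t'.
rewrite mapE => <-.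
by rewrite qnormZ gtr0_norm// mulrC ler_pM2r.
Qed.

(** The bound is replaced by +oo at the two end points, where the speed may be meaningless. *)
Lemma ge0_integral_bound (t0 t1 k : R) (f : R -> \bar R) : t0 < t1 -> 0 <= k ->
  (forall t, (0 <= f t)%E) ->
  (forall t, t0 < t < t1 -> (f t <= k%:E)%E) ->
  (\int[mu]_(t in `[t0, t1]) f t <= (k * (t1 - t0))%:E)%E.
Proof.
move=> t01 k0 f0 fk.
(* Only the values on the open interval matter for the integral of h. *)
pose h t : \bar R := if t0 < t < t1 then k%:E else +oo%E.
apply: (@le_trans _ _ (\int[mu]_(t in `[t0, t1]) h t)%E).
  apply: ge0_integral_mono => t _; first exact: f0.
  by rewrite /h; case: ifPn => [/fk//|_]; rewrite leey.
have hk t : `]t0, t1[%classic t -> k%:E = h t by rewrite /= in_itv/= /h => ->.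
have mh : measurable_fun `]t0, t1[ h.
  apply: (@eq_measurable_fun _ _ _ _ _ (cst k%:E)); last exact: measurable_cst.
  by move=> t /set_mem /hk.
rewrite (integral_itv_bndoo _ _ mh).
rewrite (eq_integral (cst k%:E)); last by move=> t /set_mem/hk.
rewrite integral_cst//= lebesgue_measure_itv/= lte_fin t01.
by rewrite -EFinB -EFinM.
Qed.

Lemma pieces_cat gam a s1 s2 : pieces X gam a s1 -> pieces X gam (last a s1) s2 ->
  pieces X gam a (s1 ++ s2).
Proof.
elim: s1 a => [|b s1 IH] a //= /pieces_cons[H1 H2] /(IH _ H2) P [_|j js]; [exact: H1|exact: P].
Qed.

Lemma pieces_rcons gam a s b : pieces X gam a (rcons s b) ->
  pieces X gam a s /\ exists sigma : R -> M, forall t, last a s <= t <= b ->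
    C1_curve_at X sigma t /\ gam t = sigma t.
Proof.
elim: s a => [|b' s IH] a /=; first by move=> /pieces_cons[H _]; split => // -[].
move=> /pieces_cons[H1 /IH[H2 H3]]; split => // -[_|j js]; [exact: H1|exact: H2].
Qed.

Lemma pieces_ext gam gam' a s : path <%R a s -> (forall t, t <= last a s -> gam t = gam' t) ->
  pieces X gam a s -> pieces X gam' a s.
Proof.
elim: s a => [|b s IH] a /=; first by move=> _ _ _ [].
move=> /andP[ab ps] E /pieces_cons[[sig H1] H2] [_|j js] /=; last exact: (IH b ps E H2).
exists sig => t tab; have [Cs <-] := H1 t tab; split => //; apply/esym/E.
by case/andP: tab => _ tb; apply: le_trans tb _; exact: path_last_le.
Qed.

(** An almost minimal curve from p to x is followed up to a time tau < 1 close to its end, then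
replaced on [tau, 1] by a short coordinate segment to x and the given segment to y. The initial
part keeps its parametrization, hence its speed integral up to tau is unchanged. *)
Lemma dist_extend p x y (a l : R) : (riemannian_dist g p x < a%:E)%E -> seg g x y l ->
  (riemannian_dist g p y < (a + l)%:E)%E.
Proof.
move=> /ereal_inf_lt[_ [gam [[s [ps ls P]] g0 g1] <-] La] xy.
have L0 : (0 <= curve_length g gam)%E by apply: integral_ge0 => t _; rewrite lee_fin speed_ge0.
have Lf : curve_length g gam \is a fin_num by rewrite ge0_fin_numE// (lt_trans La)// ltry.
move: La; rewrite -(fineK Lf) lte_fin; set L := fine _ => La.
case/lastP: s => [|s' e] in ps ls P *; first by move: ls => /= /eqP; rewrite eq_sym oner_eq0.
rewrite last_rcons in ls; rewrite {e}ls in ps P.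
move: ps; rewrite rcons_path => /andP[ps]; set b := last 0 s' => b1.
have [P' [sig Hsig]] := pieces_rcons P; rewrite -/b in Hsig.
have b0 : 0 <= b by exact: path_last_le.
have [Cs1 Es1] : C1_curve_at X sig 1 /\ gam 1 = sig 1 by apply: Hsig; rewrite lexx ltW.
have [cs1 _ _] := Cs1.
have e0 : 0 < (a - L) / 2 by lra.
have [tau [btau tau1 segt]] : exists tau, [/\ b < tau, tau < 1 & seg g (sig tau) x ((a - L) / 2)].
  have N : \forall t \near (1 : R), seg g x (sig t) ((a - L) / 2).
    have := seg_near g (sig 1) e0; rewrite -Es1 g1 => N.
    by have := cs1; rewrite /prop_for /continuous_at -Es1 g1 => /(_ _ N).
  have : \forall t \near (1 : R)^'-, b < t /\ seg g x (sig t) ((a - L) / 2).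
    apply: filterI; first by apply: nbhs_left_gt.
    exact: cvg_at_left_filter N.
  move=> N'; have [t [[bt st] t1]] := @filter_ex _ _ _ _ (filterI N' (nbhs_left_lt 1)).
  by exists t; split => //; exact: seg_sym.
pose m := (tau + 1) / 2.
have taum : tau < m by rewrite /m; lra.
have m1 : m < 1 by rewrite /m; lra.
have [k1 [k1a k1b K1]] := seg_curve segt taum.
have [k2 [k2a k2b K2]] := seg_curve xy m1.
(* The end of the curve is replaced by a segment to x on [tau, m] and the segment to y on [m, 1]. *)
pose gam' t := if t <= tau then gam t else if t <= m then k1 t else k2 t.
have E1 t : t <= tau -> gam' t = gam t by rewrite /gam' => ->.
have Gtau : gam tau = sig tau by have [] := Hsig tau; rewrite ?(ltW btau) ?(ltW tau1).
have E2 t : tau <= t <= m -> gam' t = k1 t.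
  move=> /andP[t1 t2]; rewrite /gam' t2; case: ifPn => // t3.
  by have -> : t = tau; [apply/le_anti; rewrite t1 t3|rewrite k1a].
have E3 t : m <= t -> gam' t = k2 t.
  move=> t1; rewrite /gam' leNgt (lt_le_trans taum t1)/=; case: ifPn => // t3.
  by have -> : t = m; [apply/le_anti; rewrite t1 t3|rewrite k1b k2a].
have PC : piecewise_C1 X gam'.
  exists (s' ++ [:: tau; m; 1]); split.
  - by rewrite cat_path ps /= btau taum m1.
  - by rewrite last_cat.
  - apply: pieces_cat; first by apply: pieces_ext P' => // t tb; rewrite E1//;
    apply: le_trans tb _; exact: ltW.
    case=> [_|[_|[_|//]]] /=.
    + exists sig => t /andP[bt tt]; rewrite (E1 t tt); apply: Hsig; apply/andP; split;
      [exact: bt|exact: le_trans tt (ltW tau1)].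
    + exists k1 => t tt; rewrite (E2 t tt); split; [exact: (K1 t tt).1|by []].
    + exists k2 => t tt; split; first exact: (K2 t tt).1.
      by case/andP: tt => mt _; exact: E3.
have len : (curve_length g gam' <= L%:E + (((a - L) / 2)%:E + l%:E))%E.
  have tau0 : 0 < tau by exact: le_lt_trans btau.
  have sp t : (0 <= (speed g gam' t)%:E)%E by rewrite lee_fin speed_ge0.
  rewrite /curve_length.
  have -> : `[0, 1]%classic = `[0, tau[%classic `|` `[tau, 1]%classic :> set R.
    by rewrite -itv_bndbnd_setU// bnd_simp// ltW.
  apply: le_trans (ge0_integral_subadd _ _ _ _ _) _ => //.
    apply/disj_setPS => t [] /=; rewrite !in_itv/= => /andP[_ tb] /andP[bt _].
    by move: (le_lt_trans bt tb); rewrite ltxx.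
  apply: leeD.
    apply: (@le_trans _ _ (\int[mu]_(t in `[0%R, tau[) (speed g gam t)%:E)%E).
      apply: ge0_integral_mono => [t _|t]; first exact: sp.
      rewrite /= in_itv/= => /andP[_ tt].
      have N : \forall s \near t, s < tau by exact: lt_nbhsl.
      have N' : {near t, gam' =1 gam} by apply: filterS N => z /ltW/E1.
      by rewrite (speed_near g N').
    rewrite /L fineK//; apply: ge0_integral_subset => [t|t _]; last by rewrite lee_fin speed_ge0.
    by rewrite /= !in_itv/= => /andP[-> tt]; rewrite ltW// (lt_trans tt).
  have -> : `[tau, 1]%classic = `[tau, m[%classic `|` `[m, 1]%classic :> set R.
    by rewrite -itv_bndbnd_setU// bnd_simp// ltW.
  apply: le_trans (ge0_integral_subadd _ _ _ _ _) _ => //.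
    apply/disj_setPS => t [] /=; rewrite !in_itv/= => /andP[_ tb] /andP[bt _].
    by move: (le_lt_trans bt tb); rewrite ltxx.
  have l0 := xy.1.
  have m1' : 0 < 1 - m by rewrite subr_gt0.
  have mt' : 0 < m - tau by rewrite subr_gt0.
  apply: leeD.
    apply: (@le_trans _ _ (\int[mu]_(t in `[tau, m]) (speed g gam' t)%:E)%E).
      apply: ge0_integral_subset => [t|t _]; last exact: sp.
      by rewrite /= !in_itv/= => /andP[-> /ltW].
    apply: le_trans (ge0_integral_bound taum _ _ (k := (a - L) / 2 / (m - tau)) _) _;
      [|exact: sp| |].
    - by rewrite divr_ge0// ltW.
    - move=> t /andP[t1 t2]; rewrite lee_fin.
      have N : \forall s \near t, tau < s /\ s < m by apply: filterI;
        [exact: lt_nbhsr|exact: lt_nbhsl].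
      have N' : {near t, gam' =1 k1} by apply: filterS N => z [z1 z2]; apply: E2; rewrite !ltW.
      by rewrite (speed_near g N'); apply: (K1 t _).2; rewrite !ltW.
    - by rewrite divfK ?lexx// gt_eqF.
  apply: le_trans (ge0_integral_bound m1 _ _ (k := l / (1 - m)) _) _; [|exact: sp| |].
  - by rewrite divr_ge0// ltW.
  - move=> t /andP[t1 t2]; rewrite lee_fin.
    have N : \forall s \near t, m < s by exact: lt_nbhsr.
    have N' : {near t, gam' =1 k2} by apply: filterS N => z /ltW/E3.
    by rewrite (speed_near g N'); apply: (K2 t _).2; rewrite !ltW.
  - by rewrite divfK ?lexx// gt_eqF.
apply: le_lt_trans (_ : curve_length g gam' < (a + l)%:E)%E.
  apply: ereal_inf_lbound; exists gam' => //; split => //;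
    first by rewrite E1// ltW// (le_lt_trans b0).
  by rewrite E3// ltW.
apply: le_lt_trans len _; rewrite -!EFinD lte_fin; lra.
Qed.

Lemma dist_refl p : (riemannian_dist g p p <= 0)%E.
Proof.
apply: ereal_inf_lbound; exists (cst p); last first.
  rewrite /curve_length integral0_eq// => t _.
  have -> : speed g (cst p) t = 0.
    rewrite /speed /velocity (_ : chart_map _ \o cst p = cst (chart_map (chart_at X p) p))//.
    by rewrite derive1_cst quad0 sqrtr0.
  by [].
split => //; exists [:: 1]; split => //=; first by rewrite ltr01.
move=> [_|//] /=; exists (cst p) => t _; split => //.
rewrite /C1_curve_at /= (_ : chart_map _ \o cst p = cst (chart_map (chart_at X p) p))//; split.
- exact: cst_continuous.
- by apply: filterE => s; exact: derivable_cst.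
- rewrite (_ : derive1 _ = cst 0); first exact: cst_continuous.
  by apply/funext => s; rewrite derive1_cst.
Qed.

Lemma dist_reach p y L a : reach g p y L -> L < a -> (riemannian_dist g p y < a%:E)%E.
Proof.
move=> py; elim: py a => {p y L} [p y l py|p x y l l' px IH xy] a la.
  have := @dist_extend p p y (a - l) l _ py; rewrite subrK; apply.
  by apply: le_lt_trans (dist_refl p) _; rewrite lte_fin subr_gt0.
have := @dist_extend p x y (a - l') l' _ xy; rewrite subrK; apply.
by apply: IH; rewrite ltrBrDr.
Qed.

Lemma chain_ball_geodesic p r : chain_ball g p r `<=` geodesic_ball g p r.
Proof. by move=> y [L Lr py]; exact: dist_reach py Lr. Qed.

(** Points near y are joined to y by arbitrarily short coordinate segments. *)
Lemma geodesic_ball_open p r : open (geodesic_ball g p r).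
Proof.
rewrite openE => y /= Hy; rewrite /geodesic_ball /= in Hy.
have [a ya ar] : exists2 a : R, (riemannian_dist g p y < a%:E)%E & a < r.
  have d0 : (0 <= riemannian_dist g p y)%E.
    by apply: le_ereal_inf_tmp => _ [gam _ <-]; apply: integral_ge0 => t _;
      rewrite lee_fin speed_ge0.
  have df : riemannian_dist g p y \is a fin_num by rewrite ge0_fin_numE// (lt_trans Hy)// ltry.
  move: Hy; rewrite -(fineK df) lte_fin => Hy; exists ((fine (riemannian_dist g p y) + r) / 2).
    by rewrite -(fineK df) lte_fin; lra.
  by lra.
have e0 : 0 < r - a by rewrite subr_gt0.
apply: filterS (seg_near g y e0) => z yz; rewrite /geodesic_ball /=.
by have := dist_extend ya yz; rewrite addrC subrK.
Qed.

End Extend.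

(** * The Hopf-Rinow theorem *)

Section HopfRinow.
Set Implicit Arguments.
Unset Strict Implicit.
Context {R : realType} {n : nat} {M : ptopologicalType}.
Variables (X : smooth_manifold R n M) (g : riemannian_metric X).
Hypothesis complete_g : riemannian_complete g.
Let hM : hausdorff_space M := manifold_hausdorff X.
Implicit Types (K U : set M) (x y z p : M).
Local Notation chain_ball := (chain_ball g).

(** Chain balls lie in geodesic balls, so this follows from [dist_nbhs]. *)
Lemma chain_ball_nbhs x U : open U -> U x -> exists2 e, 0 < e & chain_ball x e `<=` U.
Proof.
move=> oU Ux; have [e e0 H] := dist_nbhs g hM oU Ux; exists e => // y xy.
by apply: H; exact: chain_ball_geodesic (chain_ball_sym xy).
Qed.

Lemma chain_ball_trans_sum x y z a b c : chain_ball x a y -> chain_ball y b z -> a + b <= c ->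
  chain_ball x c z.
Proof. by move=> xy yz abc; apply: (chain_ball_sub abc); exact: chain_ball_trans xy _ yz. Qed.

Lemma compact_finite_cover K (f : M -> set M) : compact K -> (forall z, open (f z)) ->
  (forall z, K z -> f z z) -> exists s : seq M, (forall z, z \in s -> K z) /\ forall y, K y ->
    exists2 z, z \in s & f z y.
Proof.
rewrite compact_cover => cK fo fz.
have [|D DK H] := cK M K f (fun z _ => fo z); first by move=> z Kz; exists z => //; exact: fz.
exists (finmap.enum_fset D); split; first by move=> z /DK; rewrite inE.
by move=> y /H [z Dz fzy]; exists z.
Qed.

Definition totally_bounded (A : set M) := forall e, 0 < e ->
  exists s : seq M, forall y, A y -> exists2 z, z \in s & chain_ball z e y.

(** An ultrafilter containing a finite union contains one of its members. *)
Lemma ultra_finite_cover (F : set_system M) (s : seq M) (f : M ->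
  set M) (A : set M) : UltraFilter F -> F A ->
  (forall y, A y -> exists2 z, z \in s & f z y) -> exists z, F (f z).
Proof.
move=> UF; have PF : ProperFilter F := @ultra_proper _ _ UF.
elim: s A => [|z s IH] A FA H.
  have [y Ay] := @filter_ex _ _ PF _ FA; by have [] := H y Ay.
have [Fz|Fz] := in_ultra_setVsetC (f z) UF; first by exists z.
apply: (IH (A `&` ~` f z)); first exact: filterI.
by move=> y [Ay nz]; have [z'] := H y Ay; rewrite inE => /orP[/eqP->//|zs] fz'; exists z'.
Qed.

Lemma natinv_lt (e : R) : 0 < e -> exists N, forall k, (N <= k)%N -> (k.+1%:R)^-1 < e.
Proof. by move=> e0; have [N _ H] := near_infty_natSinv_lt (PosNum e0); exists N. Qed.

(** An ultrafilter on A contains a ball of radius 1/k for every k. The centers form a Cauchy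
sequence, and the ultrafilter converges to its limit. *)
Lemma complete_totally_bounded_compact A : closed A -> totally_bounded A -> compact A.
Proof.
move=> cA tA; rewrite compact_ultra => F UF FA.
have PF : ProperFilter F := @ultra_proper _ _ UF.
have /choice[z Hz] : forall k : nat, exists z, F (chain_ball z (k.+1%:R)^-1).
  move=> k; have [|s Hs] := tA (k.+1%:R)^-1; first by rewrite invr_gt0.
  exact: ultra_finite_cover FA Hs.
have zz i j : chain_ball (z i) ((i.+1%:R)^-1 + (j.+1%:R)^-1) (z j).
  have [y [yi yj]] := @filter_ex _ _ PF _ (filterI (Hz i) (Hz j)).
  exact: chain_ball_trans yi _ (chain_ball_sym yj).
have [|x Hx] := complete_g (u := z).
  move=> e e0; have [|N HN] := natinv_lt (e := e / 2); first by lra.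
  exists N => i j Ni Nj; apply: chain_ball_geodesic; apply: chain_ball_sub (zz i j).
  by rewrite (splitr e) ltW// ltrD// HN.
have Fx : F --> x.
  move=> V; rewrite nbhsE => -[U [oU Ux] UV]; apply: filterS UV _.
  have [e e0 He] := chain_ball_nbhs oU Ux.
  have [|e' e'0 He'] := dist_nbhs g hM (@chain_ball_open _ _ _ _ g x (e / 2)) (chain_ball_center _
    _ _); first by lra.
  have [N HN] := Hx _ e'0.
  have [|N' HN'] := natinv_lt (e := e / 2); first by lra.
  apply: filterS (Hz (maxn N N')) => y zy; apply: He.
  apply: chain_ball_trans_sum (He' _ (HN _ (leq_maxl _ _))) zy _.
  by rewrite [leRHS](splitr e) lerD2l ltW// HN'// leq_maxr.
exists x; split => //; apply: cA => V Vx.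
exact: (@filter_ex _ _ PF _ (filterI FA (Fx _ Vx))).
Qed.

Definition rel_compact_ball p r := exists2 K, compact K & chain_ball p r `<=` K.

Lemma rel_compact_ball_le p r r' : r' <= r -> rel_compact_ball p r -> rel_compact_ball p r'.
Proof. by move=> rr [K cK H]; exists K => // y /(chain_ball_sub rr)/H. Qed.

Lemma rel_compact_ball_small p : exists2 r, 0 < r & rel_compact_ball p r.
Proof.
have [r Ar _] := adapted_exists g (@openT M) (x := p) I; have r0 := Ar.1.
have r2 : 0 <= r / 2 < r by apply/andP; split; lra.
have [|e e0 H] := chain_ball_nbhs (chart_ball_open X p (r / 2)) (chart_ball_center X p _);
  first by lra.
exists e => //; exists (chart_inv (chart_at X p) @` box (chart_center X p) (r / 2)).
  exact: chart_box_compact Ar r2.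
by move=> y /H [dy yr]; exists (chart_map (chart_at X p) y); [exact: ltW|exact: chart_mapK].
Qed.

Lemma rel_compact_ball_seq (rho : M -> R) (s : seq M) : (forall z, rel_compact_ball z (rho z)) ->
  exists2 K, compact K & forall z, z \in s -> chain_ball z (rho z) `<=` K.
Proof.
move=> H; elim: s => [|z s [K cK HK]]; first by exists set0; [exact: compact0|].
have [K' cK' HK'] := H z; exists (K' `|` K); first exact: compactU.
move=> z'; rewrite inE => /orP[/eqP ->|zs] y yz; [by left; exact: HK'|by right; exact: HK yz].
Qed.

Lemma seq_min_pos (rho : M -> R) (s : seq M) : (forall z, 0 < rho z) ->
  exists2 r, 0 < r & forall z, z \in s -> r <= rho z.
Proof.
move=> H; elim: s => [|z s [r r0 Hr]]; first by exists 1.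
exists (Num.min r (rho z)); first by rewrite lt_min r0 H.
by move=> z'; rewrite inE => /orP[/eqP ->|/Hr]; rewrite ge_min ?lexx ?orbT// => ->.
Qed.

(** A chain of length less than r from p can be cut at a point at distance less than s < r and
close to its end; so finitely many small balls centered in the relatively compact ball of radius s
cover the ball of radius r, which is thus totally bounded. *)
Lemma rel_compact_ball_limit p r : 0 < r -> (forall s, s < r -> rel_compact_ball p s) ->
  rel_compact_ball p r.
Proof.
move=> r0 H; exists (closure (chain_ball p r)); last exact: subset_closure.
apply: complete_totally_bounded_compact; first exact: closed_closure.
(* Close enough to r, and positive. *)
move=> e e0; pose s := Num.max (r / 2) (r - e / 8).
have sr : s < r by rewrite /s gt_max; apply/andP; split; lra.
have s2 : r / 2 <= s by rewrite le_max lexx.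
have s8 : r - e / 8 <= s by rewrite le_max lexx orbT.
have [K cK HK] := H s sr.
have e8 : 0 < e / 8 by lra.
have [S [_ HS]] := compact_finite_cover cK (fun z => @chain_ball_open _ _ _ _ g z (e / 8)) (fun z
  _ => chain_ball_center g z e8).
exists S => y cy.
have [y' [[L Lr py'] yy']] := cy (chain_ball y (e / 8)) (open_nbhs_nbhs (conj (@chain_ball_open _
  _ _ _ g y (e / 8)) (chain_ball_center g y e8))).
have [w pw wy'] : exists2 w, chain_ball p s w & chain_ball w (e / 2) y'.
  have [Ls|sL] := ltP L s; first by exists y'; [exists L|apply: chain_ball_center; lra].
  pose a := Num.max (s / 2) (s - e / 8).
  have a2 : s / 2 <= a by rewrite le_max lexx.
  have a8 : s - e / 8 <= a by rewrite le_max lexx orbT.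
  have as_ : a < s by rewrite gt_max; apply/andP; split; lra.
  have [|w [w1 w2]] := reach_split py' (a := a); first by apply/andP; split; lra.
  by exists w; [exists a|exists (L - a) => //; lra].
have [z zS zw] := HS _ (HK _ pw); exists z => //.
have zy' : chain_ball z (e / 8 + e / 2) y' by exact: chain_ball_trans zw _ wy'.
by apply: chain_ball_trans_sum zy' (chain_ball_sym yy') _; lra.
Qed.

(** A compact set containing the ball of radius r is covered by finitely many balls whose doubles
are relatively compact; these doubles cover a slightly larger ball. *)
Lemma rel_compact_ball_open p r : 0 < r -> rel_compact_ball p r ->
  exists2 e, 0 < e & rel_compact_ball p (r + e).
Proof.
move=> r0 [K cK HK].
have /choice[rho Hrho] : forall z, exists r, 0 < r /\ rel_compact_ball z r.
  by move=> z; have [e e0 He] := rel_compact_ball_small z; exists e.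
have rho0 z : 0 < rho z / 2 by have [] := Hrho z; lra.
have [S [_ HS]] := compact_finite_cover cK (fun z => @chain_ball_open _ _ _ _ g z (rho z / 2))
  (fun z _ => chain_ball_center g z (rho0 z)).
have [K' cK' HK'] := rel_compact_ball_seq S (fun z => (Hrho z).2).
have [e e0 He] := seq_min_pos S rho0.
exists e => //; exists K' => // y [L Lre py].
have [w pw wy] : exists2 w, chain_ball p r w & chain_ball w e y.
  have [Lr|rL] := ltP L r; first by exists y; [exists L|exact: chain_ball_center].
  pose a := Num.max (r / 2) (r - (r + e - L) / 2).
  have a2 : r / 2 <= a by rewrite le_max lexx.
  have a8 : r - (r + e - L) / 2 <= a by rewrite le_max lexx orbT.
  have as_ : a < r by rewrite gt_max; apply/andP; split; lra.
  have [|w [w1 w2]] := reach_split py (a := a); first by apply/andP; split; lra.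
  by exists w; [exists a|exists (L - a) => //; lra].
have [z zS zw] := HS _ (HK _ pw); apply: (HK' z zS).
by apply: chain_ball_trans_sum zw wy _; have := He z zS; lra.
Qed.

(** The set of radii of relatively compact balls is closed under limits from below and open, so it
has no finite supremum. *)
Lemma hopf_rinow p r : rel_compact_ball p r.
Proof.
apply: contrapT => nr.
have [r0 r00 Hr0] := rel_compact_ball_small p.
pose S := [set s : R | 0 < s /\ rel_compact_ball p s].
have ub : ubound S r.
  move=> s [s0 Hs]; rewrite leNgt; apply/negP => rs; apply: nr; apply: rel_compact_ball_le Hs;
    exact: ltW.
have hS : has_sup S by split; [exists r0|exists r].
have sS : S r0 by split.
have sup0 : 0 < sup S by apply: lt_le_trans r00 _; exact: sup_upper_bound.
have Hsup : rel_compact_ball p (sup S).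
  apply: rel_compact_ball_limit => // s ss.
  have [|t [t0 Ht] st] := sup_adherent _ hS (eps := sup S - s); first by rewrite subr_gt0.
  by apply: rel_compact_ball_le Ht; move: st; rewrite subKr; exact: ltW.
have [e e0 He] := rel_compact_ball_open sup0 Hsup.
have : sup S + e <= sup S by apply: sup_upper_bound => //; split => //; exact: addr_gt0.
by rewrite gerDl leNgt e0.
Qed.

End HopfRinow.

(** * Smoothing Lipschitz functions by soft minima of cones *)

Section EuclideanSmoothing.
Set Implicit Arguments.
Unset Strict Implicit.
Context {R : realType} {n : nat}.
Variables (G : 'M[R]_n) (PG : posdef G).

Lemma Ck_quad a k (U : set 'rV[R]_n) : open U -> Ck k U (fun v => quad_form G (v - a)).
Proof.
move=> oU; have -> : (fun v : 'rV[R]_n => quad_form G (v - a)) =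
    \sum_i \sum_j ((fun v : 'rV[R]_n => v 0 i) + cst (- a 0 i)) * (cst (G i j) * ((fun v :
      'rV[R]_n => v 0 j) + cst (- a 0 j))).
  apply/funext => v; rewrite quad_sum fct_sumE; apply: eq_bigr => i _; rewrite fct_sumE.
  by apply: eq_bigr => j _; rewrite !fctE !mxE mulrA.
apply: Ck_sum => // i; apply: Ck_sum => // j.
have C l : Ck k U ((fun v : 'rV[R]_n => v 0 l) + cst (- a 0 l)) by apply: CkD => //;
  [exact: Ck_coord|exact: Ck_cst].
by apply: CkM => //; apply: CkM => //; exact: Ck_cst.
Qed.

(** The function sqrt (t^2 + a^2) of a is 1-Lipschitz; it rounds the vertex of the cone. *)
Lemma sqrt_add_lip (t a b : R) : 0 <= a -> 0 <= b ->
  Num.sqrt (t ^+ 2 + a ^+ 2) <= Num.sqrt (t ^+ 2 + b ^+ 2) + `|a - b|.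
Proof.
move=> a0 b0; set B := Num.sqrt (t ^+ 2 + b ^+ 2).
have B0 : 0 <= B by exact: sqrtr_ge0.
have t2 : 0 <= t ^+ 2 by exact: sqr_ge0.
have b2 : 0 <= b ^+ 2 by exact: sqr_ge0.
have BB : B ^+ 2 = t ^+ 2 + b ^+ 2 by rewrite sqr_sqrtr// addr_ge0.
have bB : b <= B by rewrite -(ger0_norm b0) -sqrtr_sqr ler_wsqrtr// lerDr.
have d0 : 0 <= `|a - b| by [].
rewrite -[leRHS]ger0_norm ?addr_ge0// -sqrtr_sqr ler_wsqrtr//.
have dd : `|a - b| ^+ 2 = (a - b) ^+ 2 by rewrite real_normK ?num_real.
have ab : a - b <= `|a - b| by exact: ler_norm.
rewrite sqrrD BB dd.
have H : b * (a - b) <= B * `|a - b|.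
  by apply: (@le_trans _ _ (b * `|a - b|)); [rewrite ler_wpM2l|rewrite ler_wpM2r].
rewrite sqrrB; move: H; rewrite mulrBr -expr2 (mulrC b a); rewrite !mulr2n; lra.
Qed.

Section Softmin.
Variables (u : 'rV[R]_n -> R) (k th beta : R) (s : seq 'rV[R]_n).
Hypotheses (k0 : 0 <= k) (th0 : 0 < th) (b0 : 0 < beta) (s0 : (0 < size s)%N).

Definition cone (y v : 'rV[R]_n) : R := u y + k * Num.sqrt (th ^+ 2 + quad_form G (v - y)).
Definition softsum (v : 'rV[R]_n) : R := \sum_(y <- s) expR (- beta * cone y v).
(** The soft minimum of the rounded cones with vertices in s. It lies between their minimum minus
(ln m)/beta, m being the number of cones, and their minimum. *)
Definition softmin (v : 'rV[R]_n) : R := - (beta^-1 * ln (softsum v)).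

Lemma softsum_ge y v : y \in s -> expR (- beta * cone y v) <= softsum v.
Proof.
rewrite /softsum; elim: s => // z r IH; rewrite inE big_cons => /orP[/eqP <-|/IH H].
  by rewrite lerDl sumr_ge0// => i _; exact: expR_ge0.
by apply: le_trans H _; rewrite lerDr expR_ge0.
Qed.

Lemma softsum_gt0 v : 0 < softsum v.
Proof.
case: s s0 (@softsum_ge) => // y r _ H; apply: lt_le_trans (H y v _); first exact: expR_gt0.
exact: mem_head.
Qed.

Lemma Ck_softmin j : Ck j setT softmin.
Proof.
have oT := @openT 'rV[R]_n.
have Cc y : Ck j setT (cone y).
  have -> : cone y = cst (u y) + cst k * (Num.sqrt \o (cst (th ^+ 2) + (fun v => quad_form G (v -
    y)))) by [].
  apply: CkD => //; first exact: Ck_cst.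
  apply: CkM => //; first exact: Ck_cst.
  apply: Ck_sqrt => //.
    by move=> v _; rewrite !fctE ltr_wpDr ?quad_ge0// exprn_gt0.
  by apply: CkD => //; [exact: Ck_cst|exact: Ck_quad].
have Cs : Ck j setT softsum.
  have -> : softsum = \sum_(y <- s) (expR \o (cst (- beta) * cone y)) by apply/funext => v;
    rewrite fct_sumE.
  apply: Ck_sum => // y; apply: Ck_exp => //; apply: CkM => //; exact: Ck_cst.
have -> : softmin = cst (- beta^-1) * (@ln R \o softsum) by apply/funext => v;
  rewrite !fctE /softmin mulNr.
apply: CkM => //; first exact: Ck_cst.
by apply: Ck_ln => // v _; exact: softsum_gt0.
Qed.

Lemma cone_lip y v w : cone y v <= cone y w + k * qnorm G (v - w).
Proof.
rewrite /cone -addrA lerD2l -mulrDr ler_wpM2l// -!(qnorm_sqr _ PG).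
apply: le_trans (sqrt_add_lip _ (qnorm_ge0 _ _) (qnorm_ge0 G (w - y))) _.
have T1 : qnorm G (w - y) <= qnorm G (v - w) + qnorm G (v - y).
  by have := qnormD (w - v) (v - y) PG; rewrite addrA subrK -(qnormN G (v - w)) opprB.
have T2 : qnorm G (v - y) <= qnorm G (v - w) + qnorm G (w - y).
  by have := qnormD (v - w) (w - y) PG; rewrite addrA subrK.
by rewrite lerD2l ler_norml; lra.
Qed.

(** If every cone increases by at most c, every term of the sum decreases by a factor at most
exp (-beta c). *)
Lemma softmin_lip1 v w : softmin v <= softmin w + k * qnorm G (v - w).
Proof.
set c := k * _.
have H : expR (- beta * c) * softsum w <= softsum v.
  rewrite /softsum mulr_sumr; apply: ler_sum => y _;
    rewrite -expRD ler_expR -mulrDr !mulNr lerN2 ler_pM2l//.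
  by rewrite addrC; exact: cone_lip.
have := H; rewrite -ler_ln ?posrE ?softsum_gt0 ?mulr_gt0 ?expR_gt0 ?softsum_gt0// lnM ?posrE
  ?expR_gt0 ?softsum_gt0// expRK => L.
have := ler_wpM2l (ltW (y := beta^-1) (x := 0) _) L; rewrite invr_gt0 => /(_ b0).
rewrite mulrDr mulrA mulrN mulVf ?gt_eqF// mulN1r /softmin.
by move: (beta^-1 * _) (beta^-1 * _) => a b; lra.
Qed.

Lemma softmin_lip v w : `|softmin v - softmin w| <= k * qnorm G (v - w).
Proof.
rewrite ler_norml lerBlDl softmin_lip1 andbT lerNl opprB lerBlDl -(qnormN G (v - w)) opprB.
exact: softmin_lip1.
Qed.

Lemma softmin_le y v : y \in s -> softmin v <= cone y v.
Proof.
move=> ys; have := softsum_ge v ys; rewrite -ler_ln ?posrE ?softsum_gt0 ?expR_gt0// expRK => L.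
have := ler_wpM2l (ltW (y := beta^-1) (x := 0) _) L; rewrite invr_gt0 => /(_ b0).
rewrite mulNr mulrN mulKf ?gt_eqF// /softmin; lra.
Qed.

(** The crude bound ln m <= m is enough since beta is free. *)
Lemma softmin_ge v m : (forall y, y \in s -> m <= cone y v) ->
  m - beta^-1 * (size s)%:R <= softmin v.
Proof.
move=> H; have : softsum v <= (size s)%:R * expR (- beta * m).
  rewrite /softsum; elim: s H => [|y r IH] H; first by rewrite big_nil mul0r.
  rewrite big_cons /= -natr1 mulrDl mul1r addrC; apply: lerD.
    by apply: IH => z zr; apply: H; rewrite inE zr orbT.
  by rewrite ler_expR !mulNr lerN2 ler_pM2l// H// mem_head.
have sz : 0 < (size s)%:R :> R by rewrite ltr0n.
rewrite -ler_ln ?posrE ?softsum_gt0 ?mulr_gt0 ?expR_gt0// lnM ?posrE ?expR_gt0// expRK => L.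
have := ler_wpM2l (ltW (y := beta^-1) (x := 0) _) L; rewrite invr_gt0 => /(_ b0).
rewrite mulrDr mulNr mulrN mulKf ?gt_eqF//.
have : beta^-1 * ln (size s)%:R <= beta^-1 * (size s)%:R.
  by rewrite ler_pM2l ?invr_gt0// ltW// ln_sublinear.
rewrite /softmin; lra.
Qed.

End Softmin.

(** A th-net of B is taken for the vertices, th being also the rounding parameter: the cone at a
vertex within th of v exceeds u v by at most 3 k th, which is d; and beta is chosen so that the loss
m/beta of the soft minimum is d as well. *)
Lemma euclidean_smoothing (B : set 'rV[R]_n) (u : 'rV[R]_n -> R) (k d : R) :
  compact B -> 0 < k -> 0 < d -> (forall v w, B v -> B w -> u v <= u w + k * qnorm G (v - w)) ->
  exists F : 'rV[R]_n -> R, [/\ forall j, Ck j setT F,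
    forall v w, `|F v - F w| <= k * qnorm G (v - w) & forall v, B v -> `|F v - u v| <= d].
Proof.
move=> cB k0 d0 Lu.
have [->|/set0P[v0 Bv0]] := eqVneq B set0.
  exists (cst 0); split => //; first by move=> j; exact: Ck_cst.
  by move=> v w; rewrite subrr normr0 mulr_ge0 ?qnorm_ge0// ltW.
have [b b0 Hb] := quad_bound G.
(* The cone at a vertex within th of v costs k th for u, and 2 k th for its rounded radial part. *)
pose th := d / (3 * k).
have th0 : 0 < th by rewrite divr_gt0// mulr_gt0.
pose f (y : 'rV[R]_n) := ball y (th / b).
have tb : 0 < th / b by rewrite divr_gt0.
have [||s [sB Hs]] := compact_finite_cover cB (f := f).
- by move=> y; exact: ball_open.
- by move=> y _; exact: ballxx.
have s0 : (0 < size s)%N by have [z] := Hs _ Bv0; case: (s).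
have sz : 0 < (size s)%:R :> R by rewrite ltr0n.
pose beta := (size s)%:R / d.
have be0 : 0 < beta by rewrite divr_gt0.
exists (softmin u k th beta s); split.
- by move=> j; apply: Ck_softmin.
- by move=> v w; apply: softmin_lip => //; exact: ltW.
move=> v Bv; rewrite ler_norml; apply/andP; split.
  have : u v - beta^-1 * (size s)%:R <= softmin u k th beta s v.
    apply: softmin_ge => // y ys; apply: le_trans (Lu _ _ Bv (sB _ ys)) _.
    rewrite /cone lerD2l ler_pM2l// ler_wsqrtr// lerDr sqr_ge0//.
  by rewrite /beta invf_div divfK ?gt_eqF//; lra.
have [y ys vy] := Hs _ Bv.
have qth : qnorm G (v - y) <= th.
  apply: le_trans (Hb _) _; rewrite -ler_pdivlMl// mulrC.
  by move: vy; rewrite /f -ball_normE /= distrC => /ltW.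
have := softmin_le u k th be0 s0 v ys; rewrite /cone.
have H1 : Num.sqrt (th ^+ 2 + quad_form G (v - y)) <= 2 * th.
  have -> : 2 * th = Num.sqrt ((2 * th) ^+ 2) by rewrite sqrtr_sqr ger0_norm// mulr_ge0// ltW.
  rewrite ler_wsqrtr//.
  have : quad_form G (v - y) <= th ^+ 2 by rewrite -qnorm_sqr// lerXn2r ?nnegrE ?qnorm_ge0// ltW.
  have t2 : 0 <= th ^+ 2 by exact: sqr_ge0.
  by move=> qq; rewrite expr2 in t2 qq *; rewrite expr2; lra.
have H2 := Lu _ _ (sB _ ys) Bv.
have H3 : k * qnorm G (y - v) <= k * th by rewrite ler_pM2l// -qnormN opprB.
have H4 : k * Num.sqrt (th ^+ 2 + quad_form G (v - y)) <= k * (2 * th) by rewrite ler_pM2l.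
have H5 : k * th = d / 3 by rewrite /th; field; rewrite gt_eqF.
move: H4; rewrite mulrCA H5; move: H3; rewrite H5 => H3 H4; lra.
Qed.

End EuclideanSmoothing.

(** * Smooth cutoff functions on a complete manifold *)

Section ManifoldSmoothing.
Set Implicit Arguments.
Unset Strict Implicit.
Context {R : realType} {n : nat} {M : ptopologicalType}.
Variables (X : smooth_manifold R n M) (g : riemannian_metric X).
Let hM : hausdorff_space M := manifold_hausdorff X.
Implicit Types (K U : set M) (x y z p : M) (u : M -> R).

(** 1-Lipschitz for the distance given by chains. *)
Definition chain_lipschitz u := forall x y l, seg g x y l -> u x <= u y + l.

(** In the chart u is 2-Lipschitz for the constant metric at the center; the smoothed function is
again 2-Lipschitz for it, hence has gradient at most 4. *)
Lemma local_smoothing z r K u d : adapted g z r -> compact K -> K `<=` chart_ball X z r ->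
  chain_lipschitz u -> 0 < d -> exists F : M -> R, [/\ msmooth X (chart_ball X z r) F,
   forall y, chart_ball X z r y -> slope g F y 4 & forall y, K y -> `|F y - u y| <= d].
Proof.
move=> Az cK KB Lu d0; set c := chart_at X z.
have Kc y : K y -> chart_dom c y by move=> /KB[].
have cB : compact (chart_map c @` K).
  apply: continuous_compact => //; apply: continuous_in_subspaceT => y /set_mem Ky.
  exact: chart_map_continuous (Kc _ Ky).
have [|F [CF LF AF]] := euclidean_smoothing (gram_at_pd g z) (u := u \o chart_inv c) cB (ltr0n R
  2) d0.
  move=> _ _ [x Kx <-] [y Ky <-] /=; rewrite !chart_mapK; [|exact: Kc|exact: Kc].
  apply/ler_addgt0Pr => e e0; rewrite -addrA; apply: Lu.
  apply: (seg_adapted Az (KB _ Kx) (KB _ Ky)).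
    by rewrite ltr_wpDl// mulr_ge0// qnorm_ge0.
  by rewrite -(qnormN _ (_ - _)) opprB lerDl ltW.
have dF v : differentiable F v := Ck_diff (CF 0%N) I.
exists (F \o chart_map c); split.
- apply: msmooth_chart; [exact: chart_ball_open|by move=> y []|move=> k].
  exact: (Ck_sub (W := setT)).
- move=> y By; have -> : 4 = 2 * 2 :> R by lra.
  by apply: (slope_chart _ Az By (dF _)) => //; exact: lipschitz_diff.
- move=> y Ky; have := AF (chart_map c y); rewrite /= chart_mapK; last exact: Kc.
  by apply; exists y.
Qed.

(** What [manifold_bump] provides: phi is a bump at z supported in K, with gradient at most A. *)
Definition patch_at (r A : R) (phi : M -> R) K z := [/\ adapted g z r, 0 <= A,
  [/\ msmooth X setT phi, forall y, 0 <= phi y <= 1 & forall y, slope g phi y A],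
  \forall y \near z, phi y = 1 &
  [/\ compact K, K `<=` chart_ball X z r & forall y, ~ K y -> phi y = 0]].

(** Induction on the list of patches. The new function is phi F + (1 - phi) f', where F is a local
approximation of u and f' comes from the remaining patches. Because f' can be required to be as
close to u as desired before phi enters, the term (F - f') dphi is negligible. Where u vanishes,
the zero function serves as initial approximation. *)
Lemma glue_smoothing (r A : M -> R) (phi : M -> M -> R) (K : M -> set M) u (s : seq M) :
  (forall z, patch_at (r z) (A z) (phi z) (K z) z) -> chain_lipschitz u ->
  forall d e, 0 < d -> 0 < e -> exists f : M -> R, [/\ msmooth X setT f,
    forall y, (forall z, z \in s -> ~ K z y) -> f y = 0 &
    forall y, u y = 0 \/ (exists2 z, z \in s & \forall x \near y, phi z x = 1) ->
      `|f y - u y| <= d /\ slope g f y (4 + e)].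
Proof.
move=> HP Lu; elim: s => [|z s IH] d e d0 e0.
  exists (cst 0); split => //; first exact: msmooth_cst.
  move=> y [->|[z]]; last by rewrite in_nil.
  rewrite /cst subrr normr0 ltW//; split => //; apply: slope_cst; lra.
have [Az A0 [sp p01 Sp] p1 [cK KB K0]] := HP z.
(* Both F and f' are within d' of u, so the derivative of phi contributes at most 2 d' A. *)
pose d' := Num.min d (e / (4 * (A z + 1))).
have A1 : 0 < A z + 1 by rewrite ltr_wpDl.
have d'0 : 0 < d' by rewrite lt_min d0 divr_gt0// mulr_gt0.
have d'd : d' <= d by rewrite ge_min lexx.
have d'A : 2 * d' * A z <= e / 2.
  have : d' * (4 * (A z + 1)) <= e by rewrite -ler_pdivlMr ?mulr_gt0// ge_min lexx orbT.
  by have := ltW d'0; lra.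
have [F [sF SF AF]] := local_smoothing Az cK KB Lu d'0.
have [f' [sf' f'0 Hf']] := IH d' (e / 2) d'0 (divr_gt0 e0 (ltr0n R 2)).
have oB := chart_ball_open X z (r z).
have oK : open (~` K z) by apply: closed_openC; exact: compact_closed.
pose f : M -> R := phi z * F + (cst 1 - phi z) * f'.
have fE y : f y = phi z y * F y + (1 - phi z y) * f' y by [].
have fK : {in ~` K z, f' =1 f} by move=> y /set_mem nK; rewrite fE K0// mul0r add0r subr0 mul1r.
have smB : msmooth X (chart_ball X z (r z)) f.
  have sp' : msmooth X (chart_ball X z (r z)) (phi z) by apply: msmooth_sub sp.
  apply: msmoothD => //; apply: msmoothM => //; last by apply: msmooth_sub sf'.
  have -> : cst 1 - phi z = cst 1 + cst (-1) * phi z :> (M -> R).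
    by apply/funext => y; rewrite !fctE mulN1r.
  by apply: msmoothD => //; [exact: msmooth_cst|apply: msmoothM => //; exact: msmooth_cst].
have sm : msmooth X setT f.
  apply: msmooth_local => y _; have [Ky|nKy] := pselect (K z y);
    first by exists (chart_ball X z (r z)) => //; exact: KB.
  by exists (~` K z) => //; apply: msmooth_ext oK fK _; apply: msmooth_sub sf'.
exists f; split => //.
  move=> y H; have nK : ~ K z y by apply: H; rewrite mem_head.
  by rewrite -fK ?inE//; apply: f'0 => w ws; apply: H; rewrite inE ws orbT.
move=> y Hy.
have [[z' zs z'1]|nz] := pselect (exists2 z', z' = z & \forall x \near y, phi z' x = 1).
  rewrite {}zs in z'1; have p1y := nbhs_singleton z'1.
  have Ky : K z y by apply: contrapT => /K0; rewrite p1y => /eqP; rewrite oner_eq0.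
  split; first by rewrite fE p1y subrr mul0r addr0 mul1r; exact: le_trans (AF _ Ky) d'd.
  have S4 : slope g F y (4 + e).
    by move=> w; apply: le_trans (SF _ (KB _ Ky) w) _; rewrite ler_wpM2r ?qnorm_ge0// lerDl ltW.
  apply: (slope_ext _ S4); last exact: msmooth_diff sF (KB _ Ky) (chart_atP X y).
  by apply: filterS z'1 => x px; rewrite fE px subrr mul0r addr0 mul1r.
have Hy' : u y = 0 \/ (exists2 z, z \in s & \forall x \near y, phi z x = 1).
  case: Hy => [->|[z']]; first by left.
  rewrite inE => /orP[/eqP zz H|z's H]; last by right; exists z'.
  by exfalso; apply: nz; exists z'.
have [Af' Sf'] := Hf' y Hy'.
have [Ky|nKy] := pselect (K z y); last first.
  split; first by rewrite -fK ?inE//; exact: le_trans Af' d'd.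
  have S4 : slope g f' y (4 + e).
    by move=> w; apply: le_trans (Sf' w) _; rewrite ler_wpM2r ?qnorm_ge0//; lra.
  apply: (slope_ext _ S4); last exact: msmooth_diff sf' I (chart_atP X y).
  have : \forall x \near y, ~ K z x by apply: open_nbhs_nbhs.
  by apply: filterS => x nK; apply: fK; rewrite inE.
have AFy := AF _ Ky; have /andP[q0 q1] := p01 y.
split.
  have -> : f y - u y = phi z y * (F y - u y) + (1 - phi z y) * (f' y - u y) by rewrite fE; ring.
  apply: le_trans (ler_normD _ _) _; rewrite !normrM (ger0_norm q0).
  have q1' : 0 <= 1 - phi z y by rewrite subr_ge0.
  rewrite (ger0_norm q1'); apply: le_trans d'd.
  have -> : d' = phi z y * d' + (1 - phi z y) * d' by ring.
  by apply: lerD; rewrite ler_wpM2l.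
have S1 : slope g F y (4 + e / 2).
  by move=> w; apply: le_trans (SF _ (KB _ Ky) w) _; rewrite ler_wpM2r ?qnorm_ge0//; lra.
have D : `|F y - f' y| <= 2 * d'.
  have -> : F y - f' y = (F y - u y) - (f' y - u y) by ring.
  by apply: le_trans (ler_normB _ _) _; lra.
have S := @slope_glue R n M X g (phi z) F f' y (4 + e / 2) (A z) (2 * d') (chart_ball X z (r z))
  (msmooth_sub (@subsetT _ _) sp) sF (msmooth_sub (@subsetT _ _) sf') (KB _ Ky) (p01 y) S1 Sf' (Sp
    y) D A0.
by move=> w; apply: le_trans (S w) _; rewrite ler_wpM2r ?qnorm_ge0//; lra.
Qed.

Hypothesis complete_g : riemannian_complete g.

(** Written as a supremum, max (rad - d(p,x), 0) also makes sense, with value 0, at a point that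
no chain joins to p. *)
Definition tent p (rad : R) x : R := sup [set t | t = 0 \/ exists2 L, reach g p x L & t = rad - L].

Lemma tent_sup p rad x : 0 <= rad ->
  has_sup [set t | t = 0 \/ exists2 L, reach g p x L & t = rad - L].
Proof.
move=> r0; split; first by exists 0; left.
exists rad => t [->//|[L /reach_gt0 L0 ->]]; lra.
Qed.

Lemma tent_ge0 p rad x : 0 <= rad -> 0 <= tent p rad x.
Proof. by move=> r0; apply: sup_upper_bound; [exact: tent_sup|left]. Qed.

Lemma tent_ge p rad x L : 0 <= rad -> reach g p x L -> rad - L <= tent p rad x.
Proof. by move=> r0 px; apply: sup_upper_bound; [exact: tent_sup|right; exists L]. Qed.

Lemma tent_le p rad x m : 0 <= rad -> 0 <= m -> (forall L, reach g p x L -> rad - L <= m) ->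
  tent p rad x <= m.
Proof.
move=> r0 m0 H; apply: ge_sup; first by exists 0; left.
by move=> t [->//|[L px ->]]; exact: H.
Qed.

Lemma tent_lip p rad : 0 <= rad -> chain_lipschitz (tent p rad).
Proof.
move=> r0 x y l xy; have l0 := xy.1; apply: tent_le => //.
  by rewrite addr_ge0 ?tent_ge0// ltW.
move=> L px; have := tent_ge r0 (reachS px xy); lra.
Qed.

Lemma tent_eq0 p rad x : 0 <= rad -> ~ chain_ball g p rad x -> tent p rad x = 0.
Proof.
move=> r0 nx; apply/le_anti/andP; split; last exact: tent_ge0.
apply: tent_le => // L px; rewrite subr_le0 leNgt; apply/negP => Lr; apply: nx.
by exists L.
Qed.

(** The tent function of radius r/2 vanishes off the ball of radius r/2, whose closure is compact by
[hopf_rinow] and contained in the open ball of radius r. Patches inside that open ball cover this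
closure, and gluing on them within r/8 of the tent function gives f. *)
Lemma smooth_cutoff p r : 0 < r -> exists f : M -> R, [/\ smooth_compact_support X f,
  msmooth X setT f, forall x, slope g f x 5, forall x, ~ chain_ball g p r x ->
    f x = 0 /\ (\forall y \near x, f y = 0) &
  forall x, chain_ball g p (r / 4) x -> r / 8 <= f x].
Proof.
move=> r0; have r2 : 0 <= r / 2 by lra.
pose O := chain_ball g p r.
have oO : open O := chain_ball_open _ _ _.
have /choice[D HD] : forall z, exists D : (R * R) * ((M -> R) * set M),
    patch_at D.1.1 D.1.2 D.2.1 D.2.2 z /\ (O z -> D.2.2 `<=` O).
  move=> z.
  have [ra Ar rO] : exists2 ra, adapted g z ra & (O z -> chart_ball X z ra `<=` O).
    have [Oz|nO] := pselect (O z).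
      by have [ra Ar H] := adapted_exists g oO Oz; exists ra.
    by have [ra Ar H] := adapted_exists g (@openT M) (x := z) I; exists ra.
  have [phi [A A0 [sp p01 Sp p1 [K [cK KB K0]]]]] := manifold_bump hM Ar.
  by exists ((ra, A), (phi, K)); split => //= Oz y /KB; exact: rO.
have HP z := (HD z).1.
have [K0 cK0 HK0] := hopf_rinow complete_g p (r / 2).
pose Kp := closure (chain_ball g p (r / 2)).
have cKp : compact Kp.
  apply: (subclosed_compact _ cK0); first exact: closed_closure.
  rewrite (closure_id K0).1; last exact: compact_closed.
  exact: closure_subset.
have KpO : Kp `<=` O.
  move=> y cy; have e0 : 0 < r / 4 by lra.
  have [w [pw yw]] := cy (chain_ball g y (r / 4)) (open_nbhs_nbhs (conj (@chain_ball_open _ _ _ _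
    g y (r / 4)) (chain_ball_center g y e0))).
  apply: (@chain_ball_sub _ _ _ _ g p (r / 2 + r / 4)); first by lra.
  exact: chain_ball_trans pw _ (chain_ball_sym yw).
have [||s [sK Hs]] := compact_finite_cover cKp (f := fun z => [set y | (D z).2.1 y = 1]^°).
- by move=> z; exact: open_interior.
- by move=> z _; have [_ _ _ p1 _] := HP z.
have d0 : 0 < r / 8 by lra.
have [f [sf f0 Hf]] := @glue_smoothing (fun z => (D z).1.1) (fun z => (D z).1.2) (fun z => (D
  z).2.1) (fun z => (D z).2.2)
  (tent p (r / 2)) s HP (tent_lip p r2) (r / 8) 1 d0 ltr01.
have cov y : tent p (r / 2) y = 0 \/ (exists2 z, z \in s & \forall x \near y, (D z).2.1 x = 1).
  have [py|npy] := pselect (chain_ball g p (r / 2) y); last by left; exact: tent_eq0.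
  by right; have [z zs Hz] := Hs y (subset_closure py); exists z.
have cKs : compact (\big[setU/set0]_(z <- s) (D z).2.2).
  by apply: bigsetU_compact => z _; have [_ _ _ _ []] := HP z.
have sub y : f y != 0 -> (\big[setU/set0]_(z <- s) (D z).2.2) y.
  move=> fy; apply: contrapT => ny; move/eqP: fy; apply; apply: f0 => z zs Kz; apply: ny.
  by rewrite -bigcup_seq; exists z.
have clK : closed (\big[setU/set0]_(z <- s) (D z).2.2) by exact: compact_closed.
have KO : (\big[setU/set0]_(z <- s) (D z).2.2) `<=` O.
  by rewrite -bigcup_seq => y [z /= zs]; apply: (HD z).2; exact: KpO (sK _ zs).
exists f; split => //.
- split.
    by move=> c; have := sf c; rewrite setIT.
  apply: (subclosed_compact _ cKs); first exact: closed_closure.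
  by rewrite [X in _ `<=` X](closure_id _).1//; apply: closure_subset => y; exact: sub.
- by move=> x w; have [_ S] := Hf x (cov x); apply: le_trans (S w) _;
  rewrite ler_wpM2r ?qnorm_ge0//; lra.
- move=> x nx.
  have N : \forall y \near x, f y = 0.
    have : \forall y \near x, ~ (\big[setU/set0]_(z <- s) (D z).2.2) y.
      apply: open_nbhs_nbhs; split; first exact: closed_openC.
      by move=> /KO.
    by apply: filterS => y ny; apply/eqP; apply: contrapT => /negP /sub.
  by split => //; exact: nbhs_singleton N.
- move=> x [L Lr px]; have [+ _] := Hf x (cov x); rewrite ler_norml => /andP[+ _].
  by have := tent_ge r2 px; lra.
Qed.

End ManifoldSmoothing.

(** * Lower bounds for iterated integrals *)

Section BoxIntegral.
Set Implicit Arguments.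
Unset Strict Implicit.
Context {R : realType}.

Lemma lebesgue_int_ge0 n (f : 'rV[R]_n -> \bar R) : (forall v, (0 <= f v)%E) ->
  (0 <= lebesgue_int f)%E.
Proof.
elim: n f => [|n IH] f f0 /=; first exact: f0.
by apply: integral_ge0 => t _; apply: IH => v; exact: f0.
Qed.

(** Integrating one variable at a time over an interval of length 2 rho contributes a factor at
least rho. *)
Lemma lebesgue_int_box n (f : 'rV[R]_n -> \bar R) (a : 'I_n -> R) (rho c : R) : 0 <= c -> 0 < rho ->
  (forall v, (0 <= f v)%E) -> (forall v : 'rV[R]_n, (forall i, `|v 0 i - a i| < rho) ->
    (c%:E <= f v)%E) ->
  ((c * rho ^+ n)%:E <= lebesgue_int f)%E.
Proof.
move=> c0 r0; elim: n f a => [|n IH] f a f0 fc /=.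
  by rewrite expr0 mulr1; apply: fc => -[].
pose a0 := a (lshift n (0 : 'I_1)).
have cr0 : 0 <= c * rho ^+ n by rewrite mulr_ge0// exprn_ge0// ltW.
have inner t : a0 - rho < t < a0 + rho ->
  ((c * rho ^+ n)%:E <= lebesgue_int (fun v : 'rV[R]_n => f (row_mx (t%:M : 'rV[R]_1) v)))%E.
  move=> /andP[t1 t2]; apply: (IH _ (fun j => a (rshift 1 j))) => [v|v Hv]; first exact: f0.
  apply: fc => i; case: (split_ordP (i : 'I_(1 + n))) => j ->.
    by rewrite (row_mxEl (t%:M : 'rV[R]_1) v 0 j) (ord1 j) mxE eqxx mulr1n ltr_norml -/a0; lra.
  by rewrite (row_mxEr (t%:M : 'rV[R]_1) v 0 j).
apply: (@le_trans _ _ (\int[lebesgue_measure]_(t in `](a0 - rho)%R,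
  (a0 + rho)%R[) (c * rho ^+ n)%:E)%E).
  rewrite integral_cst//= lebesgue_measure_itv/= lte_fin ifT; last by lra.
  rewrite -EFinB -EFinM lee_fin exprS mulrCA -[leLHS]mulrC ler_wpM2l//; lra.
have nn t : (0 <= lebesgue_int (fun v : 'rV[R]_n => f (row_mx (t%:M : 'rV[R]_1) v)))%E.
  by apply: lebesgue_int_ge0 => v; exact: f0.
apply: le_trans (ge0_integral_subset _ (B := setT) _ _); last 2 first.
- exact: subsetT.
- by move=> t _; exact: nn.
apply: ge0_integral_mono => t; first by rewrite lee_fin.
by rewrite /= in_itv/=; exact: inner.
Qed.

End BoxIntegral.

(** * The numerical iteration *)

Section Growth.
Set Implicit Arguments.
Unset Strict Implicit.
Context {R : realType}.

Lemma bernoulli (h : R) j : 0 <= h -> 1 + j%:R * h <= (1 + h) ^+ j.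
Proof.
move=> h0; elim: j => [|j IH]; first by rewrite mul0r addr0 expr0.
rewrite exprS; apply: le_trans (ler_wpM2l _ IH); last by rewrite addr_ge0.
have : 0 <= j%:R * h * h by rewrite !mulr_ge0.
by rewrite -natr1; lra.
Qed.

(** If m 0 < 0 then m k decreases like chi^k; at k = 2j, Bernoulli's inequality squared shows that
this is at least quadratic in j, whereas the lower bound is affine. *)
Lemma iterated_lower_bound (chi P Q : R) (K : nat) (m : nat -> R) : 1 < chi -> 0 <= P -> 0 <= Q ->
  (forall k, m k.+1 / chi <= m k) -> (forall k, (K <= k)%N -> - (P + Q * k%:R) <= m k) ->
    0 <= m 0%N.
Proof.
move=> chi1 P0 Q0 Hm Hlow; rewrite leNgt; apply/negP => m0.
have chi0 : 0 < chi by lra.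
have it k : m k <= m 0%N * chi ^+ k.
  elim: k => [|k IH]; first by rewrite expr0 mulr1.
  have := Hm k; rewrite ler_pdivrMr// => H; apply: le_trans H _.
  by rewrite exprSr mulrA ler_pM2r.
pose h := chi - 1; have h0 : 0 < h by rewrite /h; lra.
pose c := - m 0%N * h ^+ 2; have c0 : 0 < c by rewrite mulr_gt0 ?exprn_gt0// oppr_gt0.
have quad j : (K <= j.*2)%N -> c * j%:R ^+ 2 <= P + Q * (j.*2)%:R.
  move=> Kj; have := le_trans (Hlow _ Kj) (it _); rewrite lerNl -mulNr => H; apply: le_trans H.
  rewrite /c -mulrA ler_wpM2l; [|by rewrite oppr_ge0 ltW|].
    by [].
  rewrite -exprMn -muln2 exprM lerXn2r ?nnegrE ?mulr_ge0 ?exprn_ge0 ?(ltW h0) ?(ltW chi0)//.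
  have := @bernoulli h j (ltW h0); rewrite /h (_ : 1 + (chi - 1) = chi); last by ring.
  rewrite mulrC; apply: le_trans; lra.
have [j0 Hj0] : exists j : nat, (P + 2 * Q) / c < j%:R.
  by exists (Num.truncn ((P + 2 * Q) / c)).+1; rewrite truncnS_gt.
pose j := maxn 1 (maxn K j0).
have j1 : 1 <= j%:R :> R by rewrite ler1n leq_maxl.
have jj0 : (P + 2 * Q) / c < j%:R by apply: lt_le_trans Hj0 _; rewrite ler_nat !leq_max leqnn !orbT.
have Kj : (K <= j.*2)%N by rewrite -addnn; apply: leq_trans (leq_addr _ _);
  rewrite !leq_max leqnn orbT.
have := quad _ Kj; rewrite -muln2 natrM.
move: jj0; rewrite ltr_pdivrMr// => jj0 H.
have H2 : (P + 2 * Q) * j%:R < j%:R * c * j%:R by rewrite ltr_pM2r// (lt_le_trans _ j1).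
have H3 : P * 1 <= P * j%:R by rewrite ler_wpM2l.
move: H; rewrite expr2; lra.
Qed.

End Growth.

(** * Volume of balls *)

Section Volume.
Set Implicit Arguments.
Unset Strict Implicit.
Context {R : realType} {n : nat} {M : ptopologicalType}.
Variables (X : smooth_manifold R n M) (g : riemannian_metric X).
Variable vol : {measure set (borel M) -> \bar R}.
Hypothesis volE : riemannian_volume g vol.
Implicit Types (x y z p : M).

Lemma open_measurable_borel (U : set (borel M)) : @open M U -> measurable U.
Proof. by move=> oU; apply: sub_sigma_algebra. Qed.

Lemma vol_mono (U V : set M) : open U -> open V -> U `<=` V -> (vol U <= vol V)%E.
Proof. by move=> oU oV UV; apply: le_measure; rewrite ?inE//; exact: open_measurable_borel. Qed.

(** A small chain ball contains a coordinate box of proportional size on which the volume density is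
bounded below. *)
Lemma vol_chain_ball_lower p : exists c rho0, [/\ 0 < c, 0 < rho0 &
  forall rho, 0 < rho <= rho0 -> ((c * rho ^+ n)%:E <= vol (chain_ball g p rho))%E].
Proof.
have [r Ar _] := adapted_exists g (@openT M) (x := p) I; have [r0 Hr] := Ar.
have [b b0 Hb] := quad_bound (gram_at g p).
have D0 := posdef_det (gram_at_pd g p).
pose c0 := Num.sqrt (\det (gram_at g p) / 2).
have c00 : 0 < c0 by rewrite sqrtr_gt0 divr_gt0.
(* Norms in the box are at most twice those at p, which are at most b times coordinate norms. *)
pose kap := (2 * b + 1)^-1.
have k1 : 0 < 2 * b + 1 by rewrite addr_gt0// mulr_gt0.
have kap0 : 0 < kap by rewrite invr_gt0.
exists (c0 * kap ^+ n), r; split => //; first by rewrite mulr_gt0// exprn_gt0.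
move=> rho /andP[rho0 rhor]; pose t := kap * rho.
have t0 : 0 < t by rewrite mulr_gt0.
have tE : t * (2 * b + 1) = rho by rewrite /t mulrAC mulVf ?mul1r// gt_eqF.
have tr : t <= r.
  apply: le_trans rhor; rewrite -tE mulrDr mulr1 lerDr mulr_ge0// ?ltW// mulr_gt0//.
have sub : chart_ball X p t `<=` chain_ball g p rho.
  move=> y By; have [dy yt] := By; exists (2 * b * t + t / 2).
    by move: tE; rewrite mulrDr; lra.
  apply: reach1; apply: (seg_adapted Ar).
  - exact: chart_ball_center.
  - exact: chart_ball_sub By.
  - by rewrite addr_gt0// ?mulr_gt0//; lra.
  - rewrite -/(chart_center X p); have := Hb (chart_map (chart_at X p) y - chart_center X p).
    have : b * `|chart_map (chart_at X p) y - chart_center X p| <= b * t by rewrite ler_wpM2l ?ltW.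
    by lra.
apply: le_trans (vol_mono (chart_ball_open X p t) (chain_ball_open g p rho) sub).
rewrite (volE (c := chart_at X p)); last 2 first.
- by apply: open_measurable_borel; exact: chart_ball_open.
- by move=> y [].
rewrite -mulrA -exprMn -/t.
apply: (@lebesgue_int_box R n _ (fun i => chart_center X p 0 i)) => //; first exact: ltW.
move=> v Hv; have vt : `|v - chart_center X p| < t.
  rewrite [ltLHS]/Num.Def.normr/= mx_normrE; apply: bigmax_lt => // -[i j] _ /=.
  by rewrite (ord1 i) !mxE.
have [cv _ dv] := Hr _ (lt_le_trans vt tr).
have [domv mapv] := chart_invK cv.
rewrite indicE mem_set; last by exists (chart_inv (chart_at X p) v) => //; split => //=;
  rewrite mapv.
by rewrite mul1r lee_fin ler_wsqrtr.
Qed.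

Lemma vol_chain_ball_gt0 p rho : 0 < rho -> (0 < vol (chain_ball g p rho))%E.
Proof.
move=> rho0; have [c [r0 [c0 r00 H]]] := vol_chain_ball_lower p.
pose t := Num.min rho r0; have t0 : 0 < t by rewrite lt_min rho0.
have tr : t <= rho by rewrite ge_min lexx.
apply: lt_le_trans (vol_mono (chain_ball_open g p t) (chain_ball_open g p rho) (chain_ball_sub tr)).
apply: lt_le_trans (H t _); last by rewrite t0 ge_min lexx orbT.
by rewrite lte_fin mulr_gt0// exprn_gt0.
Qed.

Variables (chi S : R).
Hypothesis sob : sobolev_inequality g vol chi S.
Hypothesis complete_g : riemannian_complete g.

(** Sobolev's inequality for the cutoff function. Its gradient is at most 5 on the ball and
vanishes off it. *)
Lemma sobolev_chain_ball p r : 0 < r ->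
  (S%:E * ((((r / 8) `^ (2 * chi))%R)%:E * vol (chain_ball g p (r / 4)%R)) `^ chi^-1 <= 25%:E *
    vol (chain_ball g p r))%E.
Proof.
move=> r0; have [chi1 S0 Hs] := sob.
have [f [cf sf Sf f0 fr]] := smooth_cutoff complete_g p r0.
have dfx x := msmooth_diff sf I (chart_atP X x).
have I1 : ((((r / 8) `^ (2 * chi))%R)%:E * vol (chain_ball g p (r / 4)%R) <= \int[vol]_x ((`|f x|
  `^ (2 * chi))%R)%:E)%E.
  have mD : measurable (chain_ball g p (r / 4) : set (borel M)) by apply: open_measurable_borel;
    exact: chain_ball_open.
  rewrite -(integral_cst vol mD).
  apply: le_trans (ge0_integral_subset vol (B := setT) (@subsetT _ _) _); last first.
    by move=> x _; rewrite lee_fin powR_ge0.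
  apply: ge0_integral_mono => x; first by rewrite lee_fin powR_ge0.
  move=> /fr H; rewrite lee_fin; apply: ge0_ler_powR.
  - by rewrite mulr_ge0//; lra.
  - by rewrite nnegrE; lra.
  - by rewrite nnegrE.
  - by apply: le_trans H _; exact: ler_norm.
have I2 : (\int[vol]_x (gradient_norm2 g f x)%:E <= 25%:E * vol (chain_ball g p r))%E.
  have mD : measurable (chain_ball g p r : set (borel M)) by apply: open_measurable_borel;
    exact: chain_ball_open.
  rewrite -(integral_cst vol mD) [leRHS]integral_mkcond.
  apply: ge0_integral_mono => x _; first by rewrite lee_fin gradient_norm2_ge0.
  rewrite /patch; case: ifPn => [_|]; last first.
    rewrite notin_setE => /f0 [fx N].
    have S00 : slope g f x 0.
      apply: (@slope_ext _ _ _ X g (cst 0)).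
      + by apply: filterS N => y ->.
      + exact: slope_cst.
      + exact: differentiable_cst.
    by rewrite lee_fin; have := gradient_norm2_le (lexx 0) (dfx x) S00; rewrite expr0n.
  rewrite lee_fin; have := gradient_norm2_le (ler0n R 5) (dfx x) (Sf x).
  by rewrite -natrX.
apply: le_trans _ I2; apply: le_trans (Hs f cf); apply: lee_wpmul2l; first by rewrite lee_fin ltW.
apply: gt0_ler_poweR => //.
- by rewrite invr_ge0; lra.
- rewrite in_itv/= leey andbT; apply: mule_ge0 => //; by rewrite lee_fin powR_ge0.
- by rewrite in_itv/= leey andbT; apply: integral_ge0 => x _; rewrite lee_fin powR_ge0.
Qed.

(** The constant is the fixed point exp (B chi/(chi-1)) of the recursion m |-> B + m/chi satisfied
by the normalized logarithm of the volume, with al = 2 + al/chi; 1600 is 25 * 8^2. *)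
Lemma chain_ball_volume_growth p r : 0 < r ->
  (((expR ((ln (S / 1600) - 2 / (chi - 1) * ln 4) * (chi / (chi - 1))) * r `^ (2 * chi / (chi -
    1)))%R)%:E
    <= vol (chain_ball g p r))%E.
Proof.
move=> r0; have [chi1 S0 _] := sob.
have [Vinf|Vfin] := eqVneq (vol (chain_ball g p r)) +oo%E; first by rewrite Vinf leey.
pose rk k := r / 4 ^+ k : R.
have four k : 0 < 4 ^+ k :> R by rewrite exprn_gt0.
have rk0 k : 0 < rk k by rewrite divr_gt0.
have rkr k : rk k <= r.
  rewrite ler_pdivrMr//; apply: ler_peMr; first exact: ltW.
  by apply: exprn_ege1; lra.
have rkS k : rk k / 4 = rk k.+1 by rewrite /rk exprS; field; rewrite gt_eqF.
have Vf k : vol (chain_ball g p (rk k)) \is a fin_num.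
  rewrite ge0_fin_numE//; apply: le_lt_trans (vol_mono (chain_ball_open g p _) (chain_ball_open g
    p r) (chain_ball_sub (rkr k))) _.
  by rewrite ltey.
pose v k := fine (vol (chain_ball g p (rk k))).
have vE k : vol (chain_ball g p (rk k)) = (v k)%:E by rewrite fineK.
have v0 k : 0 < v k by rewrite -lte_fin -vE vol_chain_ball_gt0.
have rec k : S * ((rk k / 8) ^+ 2 * v k.+1 `^ chi^-1) <= 25 * v k.
  have := sobolev_chain_ball p (rk0 k); rewrite rkS !vE -!EFinM lee_fin.
  have r8 : 0 <= rk k / 8 by rewrite divr_ge0// ltW.
  rewrite powRM ?powR_ge0 ?(ltW (v0 _))// -powRrM mulfK; last by rewrite gt_eqF//; lra.
  by rewrite powR_mulrn.
have chi0 : 0 < chi by lra.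
have h0 : 0 < chi - 1 by lra.
pose al := 2 * chi / (chi - 1).
pose lr k := ln (rk k).
have lrE k : lr k = ln r - k%:R * ln 4.
  rewrite /lr /rk ln_div ?posrE// lnXn// mulr_natl//.
pose B := ln (S / 1600) - 2 / (chi - 1) * ln 4.
pose ls := B * (chi / (chi - 1)).
pose m k := ln (v k) - al * lr k - ls.
have lrec k : ln (S / 1600) + 2 * lr k + chi^-1 * ln (v k.+1) <= ln (v k).
  have H : S / 1600 * (rk k ^+ 2 * v k.+1 `^ chi^-1) <= v k.
    have E64 : 8 ^+ 2 = 64 :> R by rewrite -natrX.
    have := rec k; rewrite expr_div_n E64.
    by move: (rk k ^+ 2) (v k.+1 `^ chi^-1) => a b; rewrite mulrAC; lra.
  have p0 : 0 < S / 1600 by lra.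
  move: (S / 1600) H p0 => S' H p0.
  have pw : 0 < v k.+1 `^ chi^-1 by rewrite powR_gt0.
  have q0 : 0 < rk k ^+ 2 by rewrite exprn_gt0.
  have := H; rewrite -ler_ln ?posrE ?mulr_gt0//.
  by rewrite lnM ?posrE ?mulr_gt0// lnM ?posrE// lnXn// ln_powR mulr2n -/(lr k); lra.
have mrec k : m k.+1 / chi <= m k.
  have := lrec k; rewrite /m /ls /B /al.
  have -> : lr k.+1 = lr k - ln 4 by rewrite !lrE -natr1; ring.
  set a := ln (S / 1600); set L4 := ln 4; set V := ln (v k); set V' := ln (v k.+1).
  move=> H; rewrite -subr_ge0.
  have -> : V - 2 * chi / (chi - 1) * lr k - (a - 2 / (chi - 1) * L4) * (chi / (chi - 1)) -
     (V' - 2 * chi / (chi - 1) * (lr k - L4) - (a - 2 / (chi - 1) * L4) * (chi / (chi - 1))) / chi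
     = V - (a + 2 * lr k + chi^-1 * V').
    by field; rewrite ?gt_eqF.
  by rewrite subr_ge0.
have [c [rho0 [c0 rho00 Hc]]] := vol_chain_ball_lower p.
have [K HK] : exists K, forall k, (K <= k)%N -> rk k <= rho0.
  have [K HK] : exists K : nat, r / rho0 < K%:R by exists (Num.truncn (r / rho0)).+1;
    rewrite truncnS_gt.
  exists K => k Kk; rewrite /rk ler_pdivrMr// mulrC -ler_pdivrMr//.
  apply: (le_trans (ltW HK)); apply: (@le_trans _ _ (k%:R)); first by rewrite ler_nat.
  by rewrite -natrX ler_nat ltnW// ltn_expl.
pose P := `|ln c| + `|n%:R - al| * `|ln r| + `|ls|.
pose Q := `|n%:R - al| * `|ln 4| : R.
have low k : (K <= k)%N -> - (P + Q * k%:R) <= m k.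
  move=> /HK Hk; have := Hc (rk k); rewrite rk0 Hk vE lee_fin => /(_ isT).
  rewrite -ler_ln ?posrE ?mulr_gt0 ?exprn_gt0// lnM ?posrE ?exprn_gt0// lnXn// -/(lr k) => H.
  have E : m k = (ln (v k) - (ln c + lr k *+ n)) + (ln c + (n%:R - al) * (ln r - k%:R * ln 4) - ls).
    by rewrite /m -lrE -mulr_natl; ring.
  have T1 : - (`|n%:R - al| * (`|ln r| + k%:R * `|ln 4|)) <= (n%:R - al) * (ln r - k%:R * ln 4).
    apply: lerNnormlW; rewrite normrM ler_wpM2l//; apply: le_trans (ler_normB _ _) _.
    by rewrite normrM (ger0_norm (ler0n R k)).
  have T2 : - `|ln c| <= ln c by apply: lerNnormlW.
  have T3 : ls <= `|ls| by exact: ler_norm.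
  rewrite E /P /Q; move: T1; rewrite mulrDr; lra.
have m0 : 0 <= m 0%N.
  apply: (@iterated_lower_bound R chi P Q K m) => //.
  - by rewrite !addr_ge0// mulr_ge0.
  - by rewrite mulr_ge0.
have r00 : rk 0%N = r by rewrite /rk expr0 divr1.
rewrite -r00 vE lee_fin r00 /powR gt_eqF// -expRD -[leRHS]lnK ?posrE// ler_expR.
by move: m0; rewrite /m /lr r00 -/al -/B -/ls; lra.
Qed.

End Volume.

Theorem theorem1p3 (R : realType) (chi S_chi : R) :
  1 < chi -> 0 < S_chi ->
  exists C : R, 0 < C /\
    forall (n : nat) (M : ptopologicalType) (X : smooth_manifold R n M)
           (g : riemannian_metric X) (vol : {measure set (borel M) -> \bar R}),
      riemannian_volume g vol ->
      riemannian_complete g ->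
      ~ compact [set: M] ->
      sobolev_inequality g vol chi S_chi ->
      forall (p : M) (r : R), 0 < r ->
        ((C * r `^ (2 * chi / (chi - 1)))%:E <= vol (geodesic_ball g p r))%E.
Proof.
move=> chi1 S0.
exists (expR ((ln (S_chi / 1600) - 2 / (chi - 1) * ln 4) * (chi / (chi - 1)))); split;
  first exact: expR_gt0.
move=> n M X g vol volE cg _ sob p r r0.
apply: le_trans (chain_ball_volume_growth volE sob cg p r0) _.
apply: vol_mono; [exact: chain_ball_open|exact: geodesic_ball_open|exact: chain_ball_geodesic].
Qed.
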